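(* Let $K$ be a number field and let $f\in K[X]$ be a separable polynomial of odd degree $d\geq 3$. Let $C$ be the (projective) curve defined by $Y^{2}=f$, let $J$ be the Jacobian of the normalization of $C$, and let $F=K[T]/(f(T))$. Let $L=K(J[2])$ and let $G_{2}$ be a 2-Sylow subgroup of $\mathrm{Gal}(L/K)$. If the group $H^{1}(G_{2},J[2])$ is trivial, then the group $C^{2}(K,J)$ is isomorphic to the kernel of the norm from the unramified elements in $F^{\ast}/F^{\ast 2}$ to the unramified elements in $K^{\ast}/K^{\ast 2}$.
   Context: $C^2(K,J)$ is the subgroup of $\mathrm{Hom}_{\mathrm{Gal}(L/K)}(\mathrm{Gal}(\overline L/L),J[2])$ (continuous $\mathrm{Gal}(L/K)$-invariant homomorphisms) consisting of the homomorphisms that factor through the Galois group of a totally unramified extension of $L$, i.e. an extension unramified at all primes, finite and infinite; equivalently those factoring through $\mathrm{Gal}(H(L)/L)$ with $H(L)$ the Hilbert class field of $L$. For a number field $W$, an element of $W^\ast/W^{\ast 2}$ is called unramified if adjoining to $W$ a square root of a representative gives an extension of $W$ unramified at all primes (finite and infinite). Writing $F\cong F_1\times\cdots\times F_r$ as a product of number fields, $F^\ast/F^{\ast 2}\cong\prod_i F_i^\ast/F_i^{\ast 2}$, and an element of $F^\ast/F^{\ast2}$ is called unramified if its image in each $F_i^\ast/F_i^{\ast 2}$ is unramified. The norm $F^\ast/F^{\ast2}\to K^\ast/K^{\ast2}$ is induced by the $K$-algebra norm $N_{F/K}$, and it takes unramified elements to unramified elements. *)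

(* Defs.v *)
From HB Require Import structures.
From mathcomp Require Import all_boot all_order all_fingroup all_algebra.
From mathcomp Require Import all_solvable all_field.
From mathcomp Require Import boolp classical_sets functions.
From mathcomp Require Import freeg generic_quotient.

Set Implicit Arguments.
Unset Strict Implicit.
Unset Printing Implicit Defensive.

Import GRing.Theory.
Local Open Scope ring_scope.
Local Open Scope quotient_scope.

(* Normalized discrete valuations. E is a field in every use below (it is
   only typed as a ring with units because the function field of a curve is
   built as a quotient algebra), so "x is a unit" means "x != 0". The value at
   0 is a convention: with it two equal valuations are equal as functions. *)
Record is_dvaluation (E : comUnitRingType) (v : E -> int) : Prop := {
  dval0 : forall x, x \isn't a GRing.unit -> v x = 0;
  dvalM : forall x y, x \is a GRing.unit -> y \is a GRing.unit ->
    v (x * y) = v x + v y;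
  dvalD : forall x y, x \is a GRing.unit -> y \is a GRing.unit ->
    x + y \is a GRing.unit -> Order.min (v x) (v y) <= v (x + y);
  dval_surj : exists2 x, x \is a GRing.unit & v x = 1 }.

(* E / W is an extension of number fields. The finite primes of E are its
   normalized discrete valuations v, and the ramification index of v over W is
   the positive generator of v (W^* ), so that it is 1 iff v takes the value 1
   on W; the residue extensions are separable, being extensions of finite
   fields. The complex embeddings of a number field take values in algC, and an
   infinite prime ramifies iff it is complex and lies over a real one. *)
Definition unramified_ext (W : fieldType) (E : fieldExtType W) : Prop :=
  (forall v : E -> int, is_dvaluation v -> exists x : W, v x%:A = 1) /\
  (forall s : {rmorphism E -> algC},
     (forall x : W, s x%:A \is Num.real) -> forall y : E, s y \is Num.real).

(* Unit groups, written additively, and their quotients by squares. *)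
Section SquareClasses.
Variable R : comUnitRingType.

Record mulgrp := Mulgrp { mulgrp_val :> R; _ : mulgrp_val \is a GRing.unit }.
HB.instance Definition _ := [isSub for mulgrp_val].
HB.instance Definition _ := [Choice of mulgrp by <:].

Fact mulgrp_mul_subproof (x y : mulgrp) : val x * val y \is a GRing.unit.
Proof. by rewrite unitrM (valP x) (valP y). Qed.
Fact mulgrp_inv_subproof (x : mulgrp) : (val x)^-1 \is a GRing.unit.
Proof. by rewrite unitrV (valP x). Qed.
Definition mulgrp_one : mulgrp := Mulgrp (unitr1 R).
Definition mulgrp_mul (x y : mulgrp) : mulgrp := Mulgrp (mulgrp_mul_subproof x y).
Definition mulgrp_inv (x : mulgrp) : mulgrp := Mulgrp (mulgrp_inv_subproof x).

Fact mulgrp_mulA : associative mulgrp_mul.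
Proof. by move=> x y z; apply/val_inj; rewrite /= mulrA. Qed.
Fact mulgrp_mulC : commutative mulgrp_mul.
Proof. by move=> x y; apply/val_inj; rewrite /= mulrC. Qed.
Fact mulgrp_mul1 : left_id mulgrp_one mulgrp_mul.
Proof. by move=> x; apply/val_inj; rewrite /= mul1r. Qed.
Fact mulgrp_mulV : left_inverse mulgrp_one mulgrp_inv mulgrp_mul.
Proof. by move=> x; apply/val_inj; rewrite /= mulVr // (valP x). Qed.
HB.instance Definition _ := GRing.isZmodule.Build mulgrp
  mulgrp_mulA mulgrp_mulC mulgrp_mul1 mulgrp_mulV.

Definition squares : {pred mulgrp} := [pred x | `[< exists y, x = y + y >]].

Fact squares_closed : zmod_closed squares.
Proof.
split=> [|_ _ /asboolP[x ->] /asboolP[y ->]]; apply/asboolP.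
  by exists 0; rewrite addr0.
by exists (x - y); rewrite addrACA opprD.
Qed.
HB.instance Definition _ := GRing.isZmodClosed.Build mulgrp squares
  squares_closed.

(* R^* / R^*2; the class of x is only meaningful for a unit x. *)
Definition sqclass : Type := {ideal_quot squares}.
HB.instance Definition _ := GRing.Zmodule.on sqclass.
Definition to_sqclass (x : R) : sqclass := \pi_{ideal_quot squares} (insubd mulgrp_one x).

End SquareClasses.

(* The map on square classes induced by a g that maps units to units
   multiplicatively. *)
Definition sqclass_map (R S : comUnitRingType) (g : R -> S) (c : sqclass R) :
  sqclass S := to_sqclass (g (val (repr c))).

Definition unramified_class (W : fieldType) (c : sqclass W) : Prop :=
  exists x : W, x != 0 /\ to_sqclass x = c /\
  exists (E : fieldExtType W) (s : E),
    [/\ s ^+ 2 = x%:A, <<1; s>>%VS = fullv & unramified_ext E].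

HB.instance Definition _ (K : fieldType) (h : {poly K}) :=
  Vector.on {poly %/ h}.

Definition alg_norm (K : fieldType) (A : falgType K) (x : A) : K :=
  \det (passmx.mxof (vbasis {:A}) (vbasis {:A}) (amull x)).

Fact alg_normM (K : fieldType) (A : falgType K) :
  {morph @alg_norm K A : x y / x * y}.
Proof.
move=> x y; have -> : alg_norm (x * y) = \det (passmx.mxof (vbasis {:A}) (vbasis {:A})
    (amull x \o amull y)%VF).
  by rewrite /alg_norm; congr (\det (passmx.mxof _ _ _));
     apply/lfunP=> z; rewrite comp_lfunE !lfunE /= mulrA.
by rewrite (passmx.mxof_comp _ _ (vbasisP {:A})) det_mulmx mulrC.
Qed.
Fact alg_norm1 (K : fieldType) (A : falgType K) : alg_norm (1 : A) = 1.
Proof. by rewrite /alg_norm amull1 passmx.mxof1 ?det1 // (basis_free (vbasisP _)). Qed.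
Fact alg_norm_unit (K : fieldType) (A : falgType K) (x : A) :
  x \is a GRing.unit -> alg_norm x \is a GRing.unit.
Proof.
move=> ux; apply/unitrPr; exists (alg_norm x^-1).
by rewrite -alg_normM divrr // alg_norm1.
Qed.

Section EtaleAlgebra.
Variables (K : fieldType) (f : {poly K}).

(* K[T] / (f); {poly %/ h} is only the expected quotient for a monic h. *)
Definition root_alg : Type := {poly %/ (lead_coef f)^-1 *: f}.
HB.instance Definition _ := GRing.ComUnitAlgebra.on root_alg.
HB.instance Definition _ := Vector.on root_alg.

(* The factors of root_alg are the K[T] / (p), p a monic irreducible divisor
   of f. *)
Definition unramified_root_class (c : sqclass root_alg) : Prop :=
  forall (p : {poly K}) (mi : monic_irreducible_poly p), p %| f ->
    @unramified_class {poly %/ p with mi}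
      (sqclass_map (fun u : root_alg => in_qpoly p (val u)) c).

Definition norm_sqclass : sqclass root_alg -> sqclass K :=
  sqclass_map (@alg_norm K root_alg).

Definition ker_norm_unramified : set (sqclass root_alg) :=
  [set c | unramified_root_class c /\ norm_sqclass c = 0].

End EtaleAlgebra.

Arguments ker_norm_unramified {K} f _.

(* The curve Y^2 = f over a field k, f not a square. *)
Section Curve.
Variables (k : fieldType) (f : {poly k}).

Definition curve_poly : {poly {fraction {poly k}}} := 'X^2 - (tofrac f)%:P.

Definition funfield : Type := {poly %/ curve_poly}.
HB.instance Definition _ := GRing.ComUnitAlgebra.on funfield.

Definition funfield_cst (c : k) : funfield := qpolyC curve_poly (tofrac c%:P).

(* For k algebraically closed, the points of the normalization of the
   projective curve: the normalized discrete valuations of the function field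
   that are trivial on k. *)
Definition is_point (v : funfield -> int) : Prop :=
  is_dvaluation v /\ forall c, c != 0 -> v (funfield_cst c) = 0.

Record point := Point { ord_at :> funfield -> int; _ : `[< is_point ord_at >] }.
HB.instance Definition _ := [isSub for ord_at].
HB.instance Definition _ := [Choice of point by <:].

Definition divisor : Type := {freeg point}.
HB.instance Definition _ := GRing.Zmodule.on divisor.

Definition principal : {pred divisor} := [pred D | `[<
  exists2 h : funfield, h \is a GRing.unit &
    forall P : point, coeff P D = P h >]].

Fact dval1 (E : comUnitRingType) (v : E -> int) : is_dvaluation v -> v 1 = 0.
Proof.
move=> dv; apply: (addrI (v 1)).
by rewrite -(dvalM dv) ?unitr1 // mulr1 addr0.
Qed.

Fact principal_closed : zmod_closed principal.
Proof.
split=> [|D D' /asboolP[h uh hE] /asboolP[h' uh' hE']]; apply/asboolP.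
  exists 1 => [|P]; first exact: unitr1.
  by rewrite coeff0 dval1 //; case: P => v /= /asboolP[].
exists (h / h') => [|P]; first by rewrite unitrM uh unitrV.
have dP : is_dvaluation P by case: P => v /= /asboolP[].
rewrite coeffB hE hE' (dvalM dP) ?unitrV //.
by apply/eqP; rewrite subr_eq -addrA -(dvalM dP) ?unitrV // mulVr // dval1 // addr0.
Qed.
HB.instance Definition _ := GRing.isZmodClosed.Build divisor principal
  principal_closed.

Definition Pic : Type := {ideal_quot principal}.
HB.instance Definition _ := GRing.Zmodule.on Pic.

(* For k algebraically closed, the group J(k) = Pic^0 and its 2-torsion, as
   subsets of Pic. *)
Definition Jac : set Pic :=
  [set \pi_{ideal_quot principal} D | D in [set D : divisor | deg D = 0]].
Definition Jac2 : set Pic := [set c | Jac c /\ c *+ 2 = 0].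

End Curve.

Fact frac_subE (A : comNzRingType) (F : fieldType) (phi : {rmorphism A -> F})
    (a b c d : A) : phi b != 0 -> phi d != 0 ->
  phi a / phi b - phi c / phi d = phi (a * d - c * b) / phi (b * d).
Proof.
by move=> b0 d0; rewrite rmorphB !rmorphM -[- (phi c / _)]mulNr addf_div // mulNr.
Qed.
Fact frac_mulE (A : comNzRingType) (F : fieldType) (phi : {rmorphism A -> F})
    (a b c d : A) :
  phi a / phi b * (phi c / phi d) = phi (a * c) / phi (b * d).
Proof. by rewrite !rmorphM /= mulf_div. Qed.

Section CurveAut.
Variables (k : fieldType) (f : {poly k}).
Implicit Types s t : {rmorphism k -> k}.

(* The action of s on k(x), through the coefficients. *)
Definition fraction_map s (x : {fraction {poly k}}) : {fraction {poly k}} :=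
  tofrac (map_poly s (frac (repr x)).1) / tofrac (map_poly s (frac (repr x)).2).

(* If s fixes f, it acts on k(x)[y] / (y^2 - f), fixing y. *)
Definition funfield_map s (h : funfield f) : funfield f :=
  in_qpoly (curve_poly f) (map_poly (fraction_map s) (val h)).

Fact fracE (x : {fraction {poly k}}) :
  x = tofrac (frac (repr x)).1 / tofrac (frac (repr x)).2.
Proof.
have d0 : tofrac (frac (repr x)).2 != 0 by rewrite tofrac_eq0 denom_ratioP.
apply: (canRL (mulfK d0)); rewrite -{1}[x]reprK.
set r := repr x; rewrite /tofrac; unlock FracField.tofrac.
rewrite -[LHS]FracField.pi_mul; apply/eqmodP.
rewrite /= FracField.equivfE /FracField.mulf /=.
by rewrite !numden_Ratio ?mulf_neq0 ?oner_neq0 ?denom_ratioP // !mulr1 mulrC.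
Qed.

Fact fraction_mapE s (p q : {poly k}) : q != 0 ->
  fraction_map s (tofrac p / tofrac q) =
  tofrac (map_poly s p) / tofrac (map_poly s q).
Proof.
move=> q0; rewrite /fraction_map; set x := tofrac p / _.
have d0 : (frac (repr x)).2 != 0 by exact: denom_ratioP.
have := fracE x; rewrite {1}/x.
move: (frac (repr x)).1 (frac (repr x)).2 d0 => n d d0 /eqP.
rewrite eqr_div ?tofrac_eq0 // -!tofracM tofrac_eq => /eqP pdE.
apply/eqP; rewrite eqr_div ?tofrac_eq0 ?map_poly_eq0 //.
by rewrite -!tofracM tofrac_eq -!rmorphM /= pdE.
Qed.

Fact fraction_map_tofrac s p : fraction_map s (tofrac p) = tofrac (map_poly s p).
Proof.
have := @fraction_mapE s p 1 (oner_neq0 _).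
by rewrite !rmorph1 !divr1.
Qed.

Fact fraction_mapB_subproof s (x y : {fraction {poly k}}) :
  fraction_map s (x - y) = fraction_map s x - fraction_map s y.
Proof.
rewrite (fracE x) (fracE y).
move: (denom_ratioP (repr x)) (denom_ratioP (repr y)).
move: (frac _).1 (frac _).2 (frac _).1 (frac _).2 => c d a b b0 d0.
have nz (p : {poly k}) : p != 0 -> tofrac p != 0 /\ tofrac (map_poly s p) != 0.
  by move=> p0; rewrite !tofrac_eq0 map_poly_eq0.
have [b1 b2] := nz b b0; have [d1 d2] := nz d d0.
have subE := @frac_subE _ _ (@FracField.tofrac {poly k}).
rewrite (subE a b c d b1 d1).
rewrite (fraction_mapE s _ (mulf_neq0 b0 d0)) (fraction_mapE s a b0).
rewrite (fraction_mapE s c d0).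
rewrite (subE _ _ _ _ b2 d2).
by rewrite rmorphB !(rmorphM (map_poly s)).
Qed.

Fact fraction_mapB s : zmod_morphism (fraction_map s).
Proof. exact: fraction_mapB_subproof. Qed.

Fact fraction_mapM s : monoid_morphism (fraction_map s).
Proof.
split=> [|x y].
  by rewrite -tofrac1 fraction_map_tofrac !rmorph1.
rewrite (fracE x) (fracE y).
move: (denom_ratioP (repr x)) (denom_ratioP (repr y)).
move: (frac _).1 (frac _).2 (frac _).1 (frac _).2 => c d a b b0 d0.
have mulE := @frac_mulE _ _ (@FracField.tofrac {poly k}).
rewrite (mulE a b c d) (fraction_mapE s _ (mulf_neq0 b0 d0)).
rewrite (fraction_mapE s a b0) (fraction_mapE s c d0) mulE.
by rewrite !(rmorphM (map_poly s)).
Qed.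

HB.instance Definition _ s := GRing.isZmodMorphism.Build
  {fraction {poly k}} {fraction {poly k}} (fraction_map s) (fraction_mapB s).
HB.instance Definition _ s := GRing.isMonoidMorphism.Build
  {fraction {poly k}} {fraction {poly k}} (fraction_map s) (fraction_mapM s).

Fact fraction_mapK s t : cancel s t -> cancel (fraction_map s) (fraction_map t).
Proof.
move=> sK x.
have d0 : map_poly s (frac (repr x)).2 != 0 by rewrite map_poly_eq0 denom_ratioP.
have mK p : map_poly t (map_poly s p) = p.
  by apply/polyP=> i; rewrite !coef_map /= sK.
by rewrite [fraction_map s x]/fraction_map (fraction_mapE t _ d0) !mK -fracE.
Qed.

Fact curve_poly_map s : map_poly s f = f ->
  map_poly (fraction_map s) (curve_poly f) = curve_poly f.
Proof.
move=> fs; rewrite /curve_poly rmorphB /= map_polyXn map_polyC /=.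
by rewrite fraction_map_tofrac fs.
Qed.

Fact curve_poly_mk : mk_monic (curve_poly f) = curve_poly f.
Proof.
have szC : (size (tofrac f)%:P < size ('X^2 : {poly {fraction {poly k}}}))%N.
  by rewrite size_polyXn ltnS (leq_trans (size_polyC_leq1 _)).
have sz : size (curve_poly f) = 3 by rewrite size_polyDl ?size_polyN // size_polyXn.
have mon : curve_poly f \is monic.
  by rewrite monicE lead_coefDl ?size_polyN // lead_coefXn.
by rewrite /mk_monic sz mon.
Qed.

Fact in_funfield_map s p : map_poly s f = f ->
  funfield_map s (in_qpoly (curve_poly f) p) =
  in_qpoly (curve_poly f) (map_poly (fraction_map s) p).
Proof.
move=> fs; rewrite /funfield_map /= curve_poly_mk.
rewrite -Pdiv.IdomainMonic.modpE; last first.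
  by rewrite -{1}curve_poly_mk monic_mk_monic.
rewrite [in RHS](divp_eq p (curve_poly f)) rmorphD rmorphM /=.
rewrite curve_poly_map // in_qpolyD in_qpolyM.
suff -> : in_qpoly (curve_poly f) (curve_poly f) = 0 by rewrite mulr0 add0r.
apply/val_inj; rewrite /= curve_poly_mk Pdiv.RingMonic.rmodpp //.
by rewrite -{1}curve_poly_mk monic_mk_monic.
Qed.

Fact funfield_mapD s : map_poly s f = f ->
  {morph funfield_map s : g h / g + h}.
Proof.
move=> fs g h; rewrite /funfield_map -in_qpolyD -rmorphD.
by [].
Qed.

Fact funfield_mapM s : map_poly s f = f ->
  {morph funfield_map s : g h / g * h}.
Proof.
move=> fs g h.
transitivity (funfield_map s (in_qpoly (curve_poly f) (val g * val h))) => //.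
by rewrite in_funfield_map // rmorphM in_qpolyM.
Qed.

Fact funfield_map_cst s c : map_poly s f = f ->
  funfield_map s (funfield_cst f c) = funfield_cst f (s c).
Proof.
move=> fs.
transitivity (in_qpoly (curve_poly f)
  (map_poly (fraction_map s) (tofrac c%:P)%:P)) => //.
rewrite map_polyC /= fraction_map_tofrac map_polyC /=.
apply/val_inj; apply: in_qpoly_small.
by rewrite (leq_ltn_trans (size_polyC_leq1 _)) // size_mk_monic_gt1.
Qed.

Fact funfield_map1 s : map_poly s f = f -> funfield_map s 1 = 1.
Proof.
move=> fs; have := funfield_map_cst 1 fs; rewrite rmorph1 /funfield_cst.
by rewrite !rmorph1.
Qed.

Fact funfield_mapK s t : map_poly s f = f -> map_poly t f = f ->
  cancel s t -> cancel (funfield_map s) (funfield_map t).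
Proof.
move=> fs ft sK h.
transitivity (funfield_map t (in_qpoly (curve_poly f)
  (map_poly (fraction_map s) (val h)))) => //.
rewrite in_funfield_map //.
have -> : map_poly (fraction_map t) (map_poly (fraction_map s) (val h)) = val h.
  by apply/polyP=> i; rewrite !coef_map /= (fraction_mapK sK).
by apply/val_inj; apply: in_qpoly_small; apply: size_mk_monic.
Qed.

Fact funfield_map_unit s h : map_poly s f = f ->
  h \is a GRing.unit -> funfield_map s h \is a GRing.unit.
Proof.
move=> fs uh; apply/unitrPr; exists (funfield_map s h^-1).
by rewrite -funfield_mapM // divrr // funfield_map1.
Qed.

Fact point_comp s t (v : funfield f -> int) : map_poly s f = f ->
  map_poly t f = f -> cancel s t -> cancel t s -> is_point v ->
  is_point (fun h => v (funfield_map s h)).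
Proof.
move=> fs ft sK tK [dv vc]; have sfK := funfield_mapK fs ft sK.
have tfK := funfield_mapK ft fs tK.
split; last first.
  by move=> c c0; rewrite funfield_map_cst // vc // fmorph_eq0.
split=> [h nuh|g h ug uh|g h ug uh ugh|].
- apply: (dval0 dv); apply: contra nuh => /(funfield_map_unit ft).
  by rewrite sfK.
- by rewrite funfield_mapM // (dvalM dv) // funfield_map_unit.
- rewrite funfield_mapD // (dvalD dv) ?funfield_map_unit //.
  by rewrite -funfield_mapD // funfield_map_unit.
- have [h uh hv] := dval_surj dv; exists (funfield_map t h); last by rewrite tfK.
  exact: funfield_map_unit.
Qed.

End CurveAut.

(* Gal(E / i(k)), for an algebraic (possibly infinite) extension i : k -> E. *)
Record autover (k E : fieldType) (i : {rmorphism k -> E}) := Autover {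
  aut :> {rmorphism E -> E};
  aut_inv : {rmorphism E -> E};
  autK : cancel aut aut_inv;
  aut_invK : cancel aut_inv aut;
  aut_fix : forall x, aut (i x) = i x }.

HB.instance Definition _ (k E : fieldType) (i : {rmorphism k -> E}) :=
  gen_eqMixin (autover i).
HB.instance Definition _ (k E : fieldType) (i : {rmorphism k -> E}) :=
  gen_choiceMixin (autover i).

Definition autover_id (k E : fieldType) (i : {rmorphism k -> E}) : autover i :=
  @Autover k E i idfun idfun (fun _ => erefl) (fun _ => erefl) (fun _ => erefl).

(* Throughout, algC is the algebraic closure of the number field K, embedded
   in it by iK; C is the curve Y^2 = f and J its Jacobian. *)
Section GaloisAction.
Variables (K : fieldType) (iK : {rmorphism K -> algC}) (f : {poly K}).
Let fC : {poly algC} := map_poly iK f.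
Implicit Types s : autover iK.

Fact aut_fC s : map_poly s fC = fC.
Proof. by apply/polyP=> i; rewrite !coef_map /= aut_fix. Qed.

Fact aut_inv_fC s : map_poly (aut_inv s) fC = fC.
Proof. by apply/polyP=> i; rewrite !coef_map /= -{1}(aut_fix s) autK. Qed.

Fact point_act_subproof s (P : point fC) :
  `[< is_point (fun h => P (funfield_map (aut_inv s) h)) >].
Proof.
apply/asboolP/(point_comp (aut_inv_fC s) (aut_fC s)); last by case: P => v /= /asboolP.
- exact: aut_invK.
- exact: autK.
Qed.

(* ord_(s P) (h) = ord_P (s^-1 h) *)
Definition point_act s (P : point fC) : point fC := Point (point_act_subproof s P).

Definition divisor_act s (D : divisor fC) : divisor fC :=
  \sum_(P <- dom D) << coeff P D *g point_act s P >>.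

Definition Pic_act s (c : Pic fC) : Pic fC :=
  \pi_{ideal_quot @principal algC fC} (divisor_act s (repr c)).

(* J[2], inside Pic(C) over algC. *)
Definition J2 : set (Pic fC) := @Jac2 algC fC.

(* The field K(J[2]), as a subfield of algC. *)
Definition J2_field : set algC :=
  [set z | forall s, (forall c, J2 c -> Pic_act s c = c) -> s z = z].

Section Splitting.
Variables (L : splittingFieldType K) (iL : {rmorphism L -> algC}).

(* The action of Gal(L / K) on J[2] when L = K(J[2]), through any lift to algC.
   It is a right action, since the product g * h in gal_of is "g, then h". *)
Definition gal_act (g : gal_of {:L}) (c : Pic fC) : Pic fC :=
  Pic_act (xget (autover_id iK) [set s | forall x, s (iL x) = iL (g x)]) c.

(* phi : Gal(algC / L) -> J[2] is continuous iff it is trivial on Gal(algC / M)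
   for some finite extension M of L. *)
Definition continuous_hom (phi : autover iL -> Pic fC) : Prop :=
  exists (M : fieldExtType L) (iM : {rmorphism M -> algC}),
    (forall x : L, iM x%:A = iL x) /\
    (forall s : autover iL, (forall y, s (iM y) = iM y) -> phi s = 0).

Definition factors_unramified (phi : autover iL -> Pic fC) : Prop :=
  exists (M : splittingFieldType L) (iM : {rmorphism M -> algC}),
    [/\ forall x : L, iM x%:A = iL x, galois 1 {:M}, unramified_ext M &
        forall s : autover iL, (forall y, s (iM y) = iM y) -> phi s = 0].

(* Invariance is phi (t s t^-1) = t (phi s), for t in Gal(algC / K). *)
Definition C2 : set (autover iL -> Pic fC) :=
  [set phi | [/\ (forall s : autover iL, J2 (phi s)) /\
                 (forall s t u : autover iL, u =1 s \o t ->
                    phi u = phi s + phi t),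
                 forall (t : autover iK) (s s' : autover iL),
                   s' \o t =1 t \o s -> phi s' = Pic_act t (phi s),
                 continuous_hom phi &
                 factors_unramified phi]].

End Splitting.
End GaloisAction.

Arguments Pic_act {K iK f} s c.
Arguments J2 {K} iK f _.
Arguments J2_field {K} iK f _.
Arguments gal_act {K} iK f {L} iL g c.
Arguments C2 {K} iK f {L} iL _.

(* H^1(G, A) = 0 for a right action of G on the subgroup A of M. *)
Definition H1_trivial (gT : finGroupType) (G : {set gT}) (M : zmodType)
    (A : set M) (act : gT -> M -> M) : Prop :=
  forall c : gT -> M,
    (forall g, g \in G -> A (c g)) ->
    (forall g h, g \in G -> h \in G -> c (g * h)%g = act h (c g) + c h) ->
  exists2 m, A m & forall g, g \in G -> c g = act g m - m.

(* An isomorphism between the subgroups P of A and Q of B. *)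
Definition isomorphic_subgroups (A B : zmodType) (P : set A) (Q : set B) : Prop :=
  exists theta : A -> B, set_bij P Q theta /\
    (forall x y, P x -> P y -> theta (x + y) = theta x + theta y).

(* Main.v *)
(* Let R be the set of roots of f and e_x = [P_x] - [oo] for x in R. The sums of
   the e_x over subsets of R exhaust J[2], and two subsets give the same class
   exactly when they are equal or complementary; as d is odd, each class comes
   from one even subset. Hence a class u in F^* / F^*2 of square norm defines the
   homomorphism s |-> sum of the e_x over the x such that s moves sqrt (u x), and
   the coordinates of a homomorphism into J[2] that factors through an unramified
   extension are the Kummer characters of unramified classes b_x of L^* / L^*2,
   permuted by Gal(L / K) and of square product. To descend the b_x to an element
   of F: by Shapiro's lemma, H^1(G2, J[2]) = 0 forces a nontrivial 2-element of
   Gal(L / K) to fix at most one root. So a 2-Sylow subgroup T of the stabilizer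
   H of a root a acts freely on the other roots, and b_a, being the product of the
   other b_x, has a T-invariant representative; the product of its conjugates over
   the cosets of T in H, which are in odd number, is H-invariant and in the class
   of b_a. The same argument applied to square roots gives the injectivity. These
   products stay unramified over the fixed fields because an unramified class is
   locally of the form d^2 (1 + 4 e), where weak approximation lets d be chosen
   compatibly at all the primes involved. *)
From HB Require Import structures.
Require Import Defs.
From mathcomp Require Import all_boot all_order all_fingroup all_algebra.
From mathcomp Require Import all_solvable all_field.
From mathcomp Require Import boolp classical_sets functions.
From mathcomp Require Import freeg generic_quotient.
From mathcomp Require Import zify ring.

Set Implicit Arguments.
Unset Strict Implicit.
Unset Printing Implicit Defensive.

Import Order.TTheory GRing.Theory Num.Theory.
Local Open Scope ring_scope.

(** * Valuations *)

(** The descent is delicate because L/K may ramify: an element of a subfield of L can be unramified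
    over L without being so over the subfield. So the local condition is always carried with its
    witness d, which has to lie in the subfield, and only constructions that make new witnesses out
    of old ones are used: products over orbits and norms of odd index. The form d^2 (1 + 4 e) is
    reached without completions: at a prime above 2 residues are algebraic over F_2, so they have
    square roots, and a square root lying in an extension of ramification index 1 can be
    approximated modulo 2 from the base field. In the same spirit J[2] is computed without
    Riemann-Roch: the hyperelliptic involution is -1 on the Jacobian, so a 2-torsion class is
    invariant; Hilbert 90 represents it by an invariant divisor, and invariant divisors are built
    from fibres of x and ramification points. *)

Section Valuations.
Variables (E : fieldType) (v : E -> int).

(** Normalization is dropped because the value group may shrink under restriction to a subfield;
    [valuation_normalize] restores it. *)
Definition is_valuation : Prop :=
  [/\ v 0 = 0,
      forall x y, x != 0 -> y != 0 -> v (x * y) = v x + v y,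
      forall x y, x != 0 -> y != 0 -> x + y != 0 ->
        Order.min (v x) (v y) <= v (x + y) &
      exists2 x, x != 0 & v x != 0].

(** Here 0 behaves as if its value were infinite, against the convention [v 0 = 0]; estimates then
    pass through sums and products without nonvanishing conditions. *)
Definition vge (n : int) (x : E) : bool := (x == 0) || (n <= v x).

Lemma dvaluation_valuation : is_dvaluation v -> is_valuation.
Proof.
case=> v0 vM vD [x ux vx]; split.
- by apply: v0; rewrite unitr0.
- by move=> y z; rewrite -!unitfE; apply: vM.
- by move=> y z; rewrite -!unitfE; apply: vD.
- by exists x; rewrite -?unitfE // vx.
Qed.

Lemma valuation_dvaluation : is_valuation -> (exists2 x, x != 0 & v x = 1) ->
  is_dvaluation v.
Proof.
case=> v0 vM vD _ [x x0 vx]; split.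
- by move=> y; rewrite unitfE negbK => /eqP ->.
- by move=> y z; rewrite !unitfE; apply: vM.
- by move=> y z; rewrite !unitfE; apply: vD.
- by exists x; rewrite ?unitfE.
Qed.

Hypothesis vP : is_valuation.

Lemma val0 : v 0 = 0. Proof. by case: vP. Qed.

Lemma valM x y : x != 0 -> y != 0 -> v (x * y) = v x + v y.
Proof. by case: vP => _ H _ _; apply: H. Qed.

Lemma val1 : v 1 = 0.
Proof. by have := @valM 1 1 (oner_neq0 _) (oner_neq0 _); rewrite mulr1; lia. Qed.

Lemma valN1 : v (-1) = 0.
Proof.
have n0 : (-1 : E) != 0 by rewrite oppr_eq0 oner_neq0.
by have := valM n0 n0; rewrite mulN1r opprK val1; lia.
Qed.

Lemma valN x : v (- x) = v x.
Proof.
have [->|x0] := eqVneq x 0; first by rewrite oppr0.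
by rewrite -mulN1r valM ?oppr_eq0 ?oner_neq0 // valN1 add0r.
Qed.

Lemma valV x : v x^-1 = - v x.
Proof.
have [->|x0] := eqVneq x 0; first by rewrite invr0 val0 oppr0.
have := @valM x x^-1 x0; rewrite invr_eq0 => /(_ x0).
by rewrite divff // val1; lia.
Qed.

Lemma valX x n : v (x ^+ n) = v x *+ n.
Proof.
have [->|x0] := eqVneq x 0.
  by case: n => [|n]; rewrite ?expr0 ?val1 ?mulr0n // expr0n val0 mul0rn.
elim: n => [|n IH]; first by rewrite expr0 val1 mulr0n.
by rewrite exprS valM ?expf_neq0 // IH mulrS.
Qed.

Lemma valF x y : x != 0 -> y != 0 -> v (x / y) = v x - v y.
Proof. by move=> x0 y0; rewrite valM ?invr_eq0 // valV. Qed.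

Lemma vge0 n : vge n 0. Proof. by rewrite /vge eqxx. Qed.

Lemma vge1 : vge 0 1. Proof. by rewrite /vge val1 lexx orbT. Qed.

Lemma vgeN n x : vge n (- x) = vge n x.
Proof. by rewrite /vge oppr_eq0 valN. Qed.

Lemma vgeD n x y : vge n x -> vge n y -> vge n (x + y).
Proof.
rewrite /vge; have [->|x0] := eqVneq x 0; first by rewrite add0r.
have [->|y0] := eqVneq y 0; first by rewrite addr0 (negPf x0).
have [//|xy0 /= vx vy] := eqVneq (x + y) 0.
case: vP => _ _ /(_ x y x0 y0 xy0) + _.
by apply: le_trans; rewrite le_min vx.
Qed.

Lemma vgeB n x y : vge n x -> vge n y -> vge n (x - y).
Proof. by move=> vx vy; rewrite vgeD // vgeN. Qed.

Lemma vgeM m n x y : vge m x -> vge n y -> vge (m + n) (x * y).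
Proof.
rewrite /vge; have [->|x0] := eqVneq x 0; first by rewrite mul0r eqxx.
have [->|y0] := eqVneq y 0; first by rewrite mulr0 eqxx.
by rewrite mulf_eq0 (negPf x0) (negPf y0) /= valM //; lia.
Qed.

Lemma vgeM0 x y : vge 0 x -> vge 0 y -> vge 0 (x * y).
Proof. by move=> vx vy; rewrite -[X in vge X]addr0 vgeM. Qed.

Lemma vgeMl n x y : vge 0 x -> vge n y -> vge n (x * y).
Proof. by move=> vx vy; rewrite -[X in vge X]add0r vgeM. Qed.

Lemma vgeMr n x y : vge n x -> vge 0 y -> vge n (x * y).
Proof. by move=> vx vy; rewrite -[X in vge X]addr0 vgeM. Qed.

Lemma vgeX x n : vge 0 x -> vge 0 (x ^+ n).
Proof. by move=> vx; elim: n => [|n IH]; rewrite ?vge1 // exprS vgeM0. Qed.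

Lemma vge_nat n : vge 0 n%:R.
Proof. by elim: n => [|n IH]; rewrite ?vge0 // mulrSr vgeD ?vge1. Qed.

Lemma vge_le m n x : m <= n -> vge n x -> vge m x.
Proof. by rewrite /vge; case: (x == 0) => //=; lia. Qed.

Lemma vge_val n x : n <= v x -> vge n x.
Proof. by rewrite /vge => ->; rewrite orbT. Qed.

Lemma vgeP n x : x != 0 -> vge n x = (n <= v x).
Proof. by rewrite /vge => /negPf ->. Qed.

Lemma vge_div n x y : y != 0 -> vge n (x / y) = vge (n + v y) x.
Proof.
move=> y0; rewrite /vge mulf_eq0 invr_eq0 (negPf y0) orbF.
by have [//|x0 /=] := eqVneq x 0; rewrite valF //; lia.
Qed.

Lemma vge_sum n I (r : seq I) (P : pred I) F :
  (forall i, P i -> vge n (F i)) -> vge n (\sum_(i <- r | P i) F i).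
Proof. by move=> H; apply: (big_ind (vge n)) => //; [exact: vge0|exact: vgeD]. Qed.

Lemma valDl (x y : E) : x != 0 -> vge (v x + 1) y -> x + y != 0 /\ v (x + y) = v x.
Proof.
move=> x0 vy.
have xy0 : x + y != 0.
  apply: contraTneq vy => /eqP; rewrite addrC addr_eq0 => /eqP ->.
  by rewrite vgeN vgeP //; lia.
split=> //; apply/eqP; rewrite eq_le; apply/andP; split; last first.
  rewrite -(vgeP _ xy0) vgeD //; first exact: vge_val.
  by apply: (vge_le _ vy); lia.
rewrite leNgt; apply/negP => lt_v.
have: vge (v x + 1) (x + y - y) by rewrite vgeB // vge_val //; lia.
by rewrite addrK vgeP //; lia.
Qed.

Lemma val1D y : vge 1 y -> 1 + y != 0 /\ v (1 + y) = 0.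
Proof.
by move=> vy; have := @valDl 1 y (oner_neq0 _); rewrite val1 add0r; apply.
Qed.

End Valuations.

(** The values form a nonzero subgroup of Z; e is its least positive element and p an element of
    value e. The remainder of v x modulo e is the value of x divided by a power of p, so minimality
    kills it. *)
Lemma valuation_normalize (E : fieldType) (v : E -> int) : is_valuation v ->
  exists (e : int) (u : E -> int),
    [/\ 0 < e, is_dvaluation u & forall x, v x = e * u x].
Proof.
move=> vP; have [x0 x00 vx00] : exists2 x, x != 0 & v x != 0 by case: vP.
have ex : exists n : nat, `[< (0 < n)%N /\ exists2 x, x != 0 & v x = n%:Z >].
  have [vp|vn] := ltP 0 (v x0).
    exists `|v x0|%N; apply/asboolP; split; first lia.
    by exists x0 => //; lia.
  exists `|v x0|%N; apply/asboolP; split; first lia.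
  by exists x0^-1; rewrite ?invr_eq0 // (valV vP); lia.
case: (ex_minnP ex) => e /asboolP[e0 [p p0 vp]] emin.
have div x : (v x = e%:Z * (v x %/ e%:Z)%Z).
  have [->|xn0] := eqVneq x 0; first by rewrite (val0 vP) div0z mulr0.
  suff r0 : (v x %% e%:Z)%Z = 0 by rewrite {1}(divz_eq (v x) e%:Z) r0 addr0 mulrC.
  apply/eqP; apply: contraTT isT => r0.
  have rge : 0 <= (v x %% e%:Z)%Z by rewrite modz_ge0 //; lia.
  have rlt : (v x %% e%:Z)%Z < e%:Z by rewrite ltz_pmod //; lia.
  have pz0 k : p ^ k != 0 by rewrite expfz_neq0.
  have vpz k : v (p ^ k) = e%:Z * k.
    case: k => k; rewrite /exprz ?(valV vP) (valX vP) vp; lia.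
  have : (e <= `|(v x %% e%:Z)%Z|)%N.
    apply: emin; apply/asboolP; split; first lia.
    exists (x / p ^ (v x %/ e%:Z)%Z); first by rewrite mulf_neq0 ?invr_eq0.
    rewrite (valF vP) // vpz; have := divz_eq (v x) e%:Z; lia.
  lia.
exists e%:Z, (fun x => (v x %/ e%:Z)%Z); split=> //.
case: (vP) => v0 vM vD _.
apply: valuation_dvaluation.
  split.
  - by rewrite v0 div0z.
  - move=> x y xn0 yn0; have := vM x y xn0 yn0.
    rewrite (div x) (div y) (div (x * y)) -mulrDr => /mulfI; rewrite !mulKz; lia.
  - move=> x y xn0 yn0 xyn0; have := vD x y xn0 yn0 xyn0.
    by rewrite !ge_min (div x) (div y) (div (x + y)) !ler_pM2l ?ltz_nat // !mulKz //; lia.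
  - by exists p => //; rewrite vp divzz; lia.
by exists p => //; rewrite vp divzz; lia.
Qed.

(** * Restriction of valuations, and valuation rings by Zorn's lemma *)

Section Extension.
Variables (W E : fieldType) (j : {rmorphism W -> E}).

(* If v is trivial on W, a valuation of x is killed by the lowest coefficient
   of an equation for x. *)
Lemma valuation_restrict (v : E -> int) :
  (forall x, algebraicOver j x) -> is_valuation v -> is_valuation (v \o j).
Proof.
move=> alg vP; split=> [|x y x0 y0|x y x0 y0 xy0|] /=.
- by rewrite rmorph0 (val0 vP).
- by rewrite rmorphM (valM vP) ?fmorph_eq0.
- rewrite rmorphD; case: vP => _ _ + _; apply; rewrite -?rmorphD ?fmorph_eq0 //.
apply: contrapT => triv.
have {}triv x : v (j x) = 0.
  have [->|x0] := eqVneq x 0; first by rewrite rmorph0 (val0 vP).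
  by apply/eqP; apply: contrapT => /negP vx; apply: triv; exists x.
have [x x0 vx] : exists2 x, x != 0 & 0 < v x.
  case: (vP) => _ _ _ [x x0 vx].
  have [|] := ltP 0 (v x); first by exists x.
  by exists x^-1; rewrite ?invr_eq0 // (valV vP); lia.
have [p p0 rpx] := alg x.
(* As x is nonzero, factors X can be removed until the constant coefficient is nonzero. *)
have [n] := ubnP (size p); elim: n p p0 rpx => // n IH p p0 rpx sp.
move: p0 rpx sp.
elim/poly_ind: p => [|q c _]; first by rewrite eqxx.
have [->|c0] := eqVneq c 0.
  rewrite addr0 => qX0; have q0 : q != 0 by apply: contraNneq qX0 => ->; rewrite mul0r.
  rewrite rmorphM /= map_polyX rootM rootX (negPf x0) orbF => rq.
  by rewrite size_mulX // ltnS => sq; apply: IH rq _.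
move=> _; rewrite rmorphD rmorphM /= map_polyX map_polyC /= /root hornerMXaddC.
rewrite addrC addr_eq0 => /eqP jc _.
have: vge v 1 (j c).
  rewrite jc vgeN //; apply: vgeMl => //; last by rewrite vgeP //; lia.
  rewrite horner_coef vge_sum // => i _; rewrite vgeM0 ?vgeX //.
    by rewrite coef_map vge_val //= triv.
  by rewrite vgeP // ltW.
by rewrite vgeP ?fmorph_eq0 // triv.
Qed.

Lemma dvaluation_restrict (v : E -> int) :
  (forall x, algebraicOver j x) -> is_dvaluation v ->
  exists (e : int) (u : W -> int),
    [/\ 0 < e, is_dvaluation u & forall x, v (j x) = e * u x].
Proof.
move=> alg /dvaluation_valuation vP.
by have [e [u []]] := valuation_normalize (valuation_restrict alg vP); exists e, u.
Qed.

Definition subring_set (A : set E) : Prop :=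
  [/\ A 1, forall x y, A x -> A y -> A (x - y) & forall x y, A x -> A y -> A (x * y)].

Section SubringSet.
Variables (A : set E) (AP : subring_set A).

Lemma subring_set1 : A 1. Proof. by case: AP. Qed.
Lemma subring_setB x y : A x -> A y -> A (x - y). Proof. by case: AP => _ + _; apply. Qed.
Lemma subring_setM x y : A x -> A y -> A (x * y). Proof. by case: AP => _ _; apply. Qed.
Lemma subring_set0 : A 0.
Proof. by rewrite -(subrr 1); apply: subring_setB; exact: subring_set1. Qed.
Lemma subring_setN x : A x -> A (- x).
Proof. by move=> Ax; rewrite -sub0r; apply: subring_setB => //; exact: subring_set0. Qed.
Lemma subring_setD x y : A x -> A y -> A (x + y).
Proof. by move=> Ax Ay; rewrite -[y]opprK; apply: subring_setB => //; exact: subring_setN. Qed.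
Lemma subring_setX x n : A x -> A (x ^+ n).
Proof.
move=> Ax; elim: n => [|n IH]; first by rewrite expr0; exact: subring_set1.
by rewrite exprS; exact: subring_setM.
Qed.

Definition adjoin_set (x : E) : set E :=
  [set y | exists2 p : {poly E}, forall i, A p`_i & y = p.[x]].

Lemma adjoin_subring x : subring_set (adjoin_set x).
Proof.
split.
- exists 1; last by rewrite hornerE.
  by move=> i; rewrite coef1; case: eqP => _; [exact: subring_set1|exact: subring_set0].
- move=> _ _ [p Ap ->] [q Aq ->]; exists (p - q); last by rewrite !hornerE.
  by move=> i; rewrite coefB; exact: subring_setB.
- move=> _ _ [p Ap ->] [q Aq ->]; exists (p * q); last by rewrite !hornerE.
  move=> i; rewrite coefM; apply: big_ind => [|y z|k _]; first exact: subring_set0.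
    exact: subring_setD.
  exact: subring_setM.
Qed.

Lemma sub_adjoin x y : A y -> adjoin_set x y.
Proof.
move=> Ay; exists y%:P; last by rewrite hornerC.
by move=> i; rewrite coefC; case: eqP => // _; exact: subring_set0.
Qed.

Lemma mem_adjoin x : adjoin_set x x.
Proof.
exists 'X; last by rewrite hornerX.
by move=> i; rewrite coefX; case: eqP => _; [exact: subring_set1|exact: subring_set0].
Qed.

End SubringSet.

(* A maximal subring B of E without the inverse of the uniformizer is a
   valuation ring. *)
Lemma valuation_ring_exists (A : set E) (p : E) : subring_set A -> p != 0 -> A p ->
  ~ A p^-1 ->
  exists B : set E, [/\ subring_set B, (A `<=` B)%classic, ~ B p^-1 &
    forall x, B x \/ B x^-1].
Proof.
move=> AP p0 Ap Anp.
(* Adding A inside the predicate, instead of asking B to contain A, lets the empty chain pass: its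
   union is empty. *)
pose P (B : set E) := subring_set (B `|` A)%classic /\ ~ (B `|` A)%classic p^-1.
have [] := @Zorn_bigcup E P.
  move=> F FP Ftot.
  have [F0|nF0] := pselect (exists B, F B); last first.
    suff -> : (\bigcup_(X in F) X)%classic = set0.
      by rewrite /P set0U.
    by rewrite -subset0 => x [B FB _]; apply: nF0; exists B.
  have [B0 FB0] := F0.
  have two x y : (\bigcup_(X in F) X `|` A)%classic x ->
      (\bigcup_(X in F) X `|` A)%classic y ->
      exists B, [/\ F B, (B `|` A)%classic x & (B `|` A)%classic y].
    case=> [[X FX Xx]|Ax]; case=> [[Y FY Yy]|Ay].
    - have [XY|YX] := Ftot _ _ FX FY.
        by exists Y; split=> //; left=> //; apply: XY.
      by exists X; split=> //; left=> //; apply: YX.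
    - by exists X; split=> //; [left|right].
    - by exists Y; split=> //; [right|left].
    - by exists B0; split=> //; right.
  have emb B x : F B -> (B `|` A)%classic x -> (\bigcup_(X in F) X `|` A)%classic x.
    by move=> FB [Bx|Ax]; [left; exists B|right].
  split.
    split.
    - by right; case: AP.
    - move=> x y /two /[apply] -[B [FB Bx By]]; apply: (emb B) => //.
      by apply: subring_setB; first by case: (FP _ FB).
    - move=> x y /two /[apply] -[B [FB Bx By]]; apply: (emb B) => //.
      by apply: subring_setM; first by case: (FP _ FB).
  move=> /[dup] /two /[apply] -[B [FB Bp _]]; exact: (FP _ FB).2.
move=> B0 [[BP Bnp] Bmax]; set B := (B0 `|` A)%classic in BP Bnp.
have BA : (A `<=` B)%classic by move=> x Ax; right.
exists B; split=> //.
have maxB C : subring_set C -> (B `<=` C)%classic -> ~ C p^-1 -> (C `<=` B)%classic.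
  move=> CP BC Cnp x Cx; apply: contrapT => nBx.
  apply: (Bmax C); last first.
    have CA : (C `|` A)%classic = C.
      by rewrite eqEsubset; split=> y; [case=> // /BA /BC|left].
    by rewrite /P CA.
  split; last by move=> CB0; apply: nBx; left; apply: CB0.
  by move=> y By; apply: BC; left.
have Bp : B p by apply: BA.
have Bunit b : B b -> B (1 - p * b)^-1.
  move=> Bb; set s := 1 - p * b.
  apply: (maxB (adjoin_set B s^-1)); [exact: adjoin_subring|exact: sub_adjoin| |exact: mem_adjoin].
  case=> q Bq qE; suff: B p^-1 by [].
  have s0 : s != 0.
    rewrite /s subr_eq0; apply: (contra_notN _ Bnp) => /eqP pb.
    by rewrite -[p^-1]mulr1 pb mulKf.
  have [c Bc sE] : exists2 c, B c & s ^+ (size q).-1 = 1 - p * c.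
    elim: (size q).-1 => [|n [c Bc sE]].
      by exists 0; [exact: subring_set0|rewrite mulr0 subr0].
    exists (c + b - p * c * b); last by rewrite exprS sE /s; ring.
    apply: subring_setB => //; first exact: subring_setD.
    by do 2!apply: subring_setM => //.
  pose t := \sum_(i < size q) q`_i * s ^+ ((size q).-1 - i).
  have Bs : B s by apply: subring_setB => //; [exact: subring_set1|exact: subring_setM].
  have Bt : B t.
    apply: big_ind => [|x y|i _]; [exact: subring_set0|exact: subring_setD|].
    by apply: subring_setM => //; apply: subring_setX.
  have tE : t = s ^+ (size q).-1 * p^-1.
    rewrite qE horner_coef mulr_sumr; apply: eq_bigr => i _.
    rewrite mulrCA; congr (_ * _); rewrite exprVn expfB_cond ?(negPf s0) //.
    by rewrite add0n -ltnS (leq_trans (ltn_ord i)) ?leqSpred.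
  have -> : p^-1 = t + c.
    by rewrite tE sE mulrBl mul1r mulrC mulrA mulVf // mul1r subrK.
  exact: subring_setD.
move=> x; apply: contrapT => /not_orP[nx nxV].
have x0 : x != 0 by apply: (contra_notN _ nx) => /eqP ->; exact: subring_set0.
have ex y : ~ B y -> exists2 q : {poly E}, forall i, B q`_i & p^-1 = q.[y].
  move=> nBy; apply: contrapT => nq; apply: nBy.
  apply: (maxB (adjoin_set B y)); [exact: adjoin_subring|exact: sub_adjoin| |exact: mem_adjoin].
  by case=> q Bq qE; apply: nq; exists q.
have min y : ~ B y -> exists q : {poly E}, [/\ forall i, B q`_i, p^-1 = q.[y] &
    forall r : {poly E}, (forall i, B r`_i) -> p^-1 = r.[y] -> (size q <= size r)%N].
  move=> /ex[q0 Bq0 q0E].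
  have exn : exists n, `[< exists q : {poly E}, [/\ forall i, B q`_i, p^-1 = q.[y] & size q = n] >].
    by exists (size q0); apply/asboolP; exists q0.
  case: (ex_minnP exn) => n /asboolP[q [Bq qE <-]] qmin.
  exists q; split=> // r Br rE; apply: qmin; apply/asboolP; by exists r.
(* The inverse relation of lower degree rewrites the leading term of the other. *)
have main y (q r : {poly E}) : y != 0 -> (forall i, B q`_i) -> p^-1 = q.[y] ->
    (forall r : {poly E}, (forall i, B r`_i) -> p^-1 = r.[y] -> (size q <= size r)%N) ->
    (forall i, B r`_i) -> p^-1 = r.[y^-1] -> (size r <= size q)%N -> False.
  move=> y0 Bq qE qmin Br rE srq.
  have sr1 : (1 < size r)%N.
    rewrite ltnNge; apply/negP => /size1_polyC rC; apply: Bnp.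
    by rewrite rE rC hornerC.
  set s := (1 - p * r`_0)^-1.
  have Bs : B s by apply: Bunit.
  have s0 : 1 - p * r`_0 != 0.
    rewrite subr_eq0; apply: (contra_notN _ Bnp) => /eqP pb.
    by rewrite -[p^-1]mulr1 pb mulKf.
  set n := (size q).-1.
  have ynE : y ^+ n = \sum_(i < (size r).-1) s * p * r`_i.+1 * y ^+ (n - i.+1).
    have : (1 - p * r`_0) * y ^+ n = \sum_(i < (size r).-1) p * r`_i.+1 * y ^+ (n - i.+1).
      have -> : 1 - p * r`_0 = p * (r.[y^-1] - r`_0) by rewrite -rE mulrBr divff.
      rewrite horner_coef -(prednK (ltnW sr1)) big_ord_recl /= expr0 mulr1 addrC addKr.
      rewrite mulr_sumr mulr_suml; apply: eq_bigr => i _.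
      rewrite -!mulrA; congr (_ * (_ * _)).
      rewrite /bump /= add1n exprVn expfB_cond ?(negPf y0) 1?mulrC //.
      by rewrite add0n /n (leq_trans (ltn_ord i)) // -!subn1 leq_sub2r.
    move/(canRL (mulKf s0)) => ->; rewrite mulr_sumr; apply: eq_bigr => i _.
    by rewrite !mulrA.
  pose q' := (\poly_(i < n) q`_i) + \sum_(i < (size r).-1) (q`_n * (s * p * r`_i.+1)) *: 'X^(n - i.+1).
  have sq : (0 < size q)%N by lia.
  have q'E : p^-1 = q'.[y].
    rewrite hornerD horner_poly horner_sum.
    have -> : \sum_(i < (size r).-1) ((q`_n * (s * p * r`_i.+1)) *: 'X^(n - i.+1)).[y] =
        q`_n * y ^+ n.
      by rewrite ynE mulr_sumr; apply: eq_bigr => i _; rewrite hornerZ hornerXn -mulrA.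
    by rewrite qE horner_coef -(prednK sq) big_ord_recr.
  have Bq' i : B q'`_i.
    rewrite coefD coef_poly coef_sum; apply: subring_setD => //.
      by case: ifP => // _; exact: subring_set0.
    apply: big_ind => [|a b|k _]; [exact: subring_set0|exact: subring_setD|].
    rewrite coefZ coefXn; apply: subring_setM => //.
      by do 3?apply: subring_setM => //.
    by case: eqP => _; [exact: subring_set1|exact: subring_set0].
  have := qmin _ Bq' q'E; rewrite leqNgt => /negP; apply.
  apply: (@leq_ltn_trans n); last by rewrite /n; lia.
  apply: (leq_trans (size_polyD _ _)); rewrite geq_max size_poly /=.
  apply: (leq_trans (size_sum _ _ _)); apply/bigmax_leqP => i _.
  apply: (leq_trans (size_scale_leq _ _)); rewrite size_polyXn.
  have := ltn_ord i; rewrite /n; lia.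
have [q [Bq qE qmin]] := min _ nx; have [r [Br rE rmin]] := min _ nxV.
have [srq|sqr] := leqP (size r) (size q); first exact: (main x q r).
by apply: (main x^-1 r q); rewrite ?invr_eq0 ?invrK // ltnW.
Qed.

End Extension.

(** * Units and dominant terms in a valuation ring *)

Section ValuationRing.
Variables (E : fieldType) (B : set E).
Hypotheses (BP : subring_set B) (BV : forall x, B x \/ B x^-1).

Definition vr_unit (x : E) : Prop := [/\ x != 0, B x & B x^-1].
Definition vr_max (x : E) : Prop := B x /\ (x != 0 -> ~ B x^-1).

Lemma vr_unitM x y : vr_unit x -> vr_unit y -> vr_unit (x * y).
Proof.
case=> x0 Bx Bx' [y0 By By']; split; first exact: mulf_neq0.
  exact: subring_setM.
by rewrite invfM; exact: subring_setM.
Qed.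

Lemma vr_unitV x : vr_unit x -> vr_unit x^-1.
Proof. by case=> x0 Bx Bx'; split; rewrite ?invr_eq0 ?invrK. Qed.

Lemma vr_unit1 : vr_unit 1.
Proof. by split; rewrite ?invr1 ?oner_neq0 //; exact: subring_set1. Qed.

Lemma vr_unitX x n : vr_unit x -> vr_unit (x ^+ n).
Proof.
move=> ux; elim: n => [|n IH]; first by rewrite expr0; exact: vr_unit1.
by rewrite exprS; exact: vr_unitM.
Qed.

Lemma vr_unitP x : x != 0 -> vr_unit x \/ vr_max x \/ vr_max x^-1.
Proof.
move=> x0; have [Bx|nBx] := pselect (B x); have [Bx'|nBx'] := pselect (B x^-1).
- by left.
- by right; left.
- by right; right; split=> //; rewrite invrK.
- by case: (BV x).
Qed.

Lemma vr_max_unit x : vr_max x -> vr_unit (1 + x).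
Proof.
case=> Bx nBx; have B1x : B (1 + x).
  by apply: subring_setD => //; exact: subring_set1.
have [x0|x0] := eqVneq x 0; first by rewrite x0 addr0; exact: vr_unit1.
have nx1 : 1 + x != 0.
  rewrite addrC addr_eq0; apply/eqP => xE; apply: (nBx x0).
  rewrite xE invrN invr1; apply: subring_setN => //; exact: subring_set1.
split=> //; apply: contrapT => nB.
have [Bi|Bi] := BV (x / (1 + x)).
  have : B (1 - x / (1 + x)) by apply: subring_setB => //; exact: subring_set1.
  by rewrite -{1}(divff nx1) -mulrBl addrK mul1r.
by apply: (nBx x0); have : B ((x / (1 + x))^-1 - 1);
  [apply: subring_setB => //; exact: subring_set1|rewrite invf_div mulrDl divff // addrK mul1r].
Qed.

Lemma vr_maxM x y : vr_max x -> vr_unit y -> vr_max (x * y).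
Proof.
move=> [Bx nBx] [y0 By By']; split; first exact: subring_setM.
rewrite mulf_eq0 negb_or => /andP[x0 _] Bi; apply: (nBx x0).
have -> : x^-1 = y * (x * y)^-1 by rewrite invfM mulrCA divff // mulr1.
exact: subring_setM.
Qed.

(** Two elements have the same value when their quotient is a unit. If the values are pairwise
    distinct, the term of least value dominates: the rest only contributes a factor 1 + x with x in
    the maximal ideal. *)
Lemma vr_sum_unit (s : seq E) : all (fun x => x != 0) s -> s != [::] ->
  pairwise (fun x y => `[< ~ vr_unit (x / y) >]) s ->
  exists2 x, x \in s & vr_unit ((\sum_(y <- s) y) / x).
Proof.
elim: s => // t s IH /= /andP[t0 s0] _ /andP[/allP ts ps].
have [->|sn0] := eqVneq s [::].
  by exists t; rewrite ?mem_head // big_seq1 divff //; exact: vr_unit1.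
have [x xs ux] := IH s0 sn0 ps; have x0 : x != 0 by move/allP: s0; apply.
rewrite big_cons; set S := \sum_(y <- s) y in ux *.
have S0 : S != 0 by case: ux; rewrite mulf_eq0 negb_or => /andP[].
have ntx : ~ vr_unit (t / x) by apply/asboolP/ts.
have tx0 : t / x != 0 by rewrite mulf_neq0 ?invr_eq0.
have tS : t / S = t / x / (S / x) by field; rewrite x0 S0.
have [//|[mtx|mxt]] := vr_unitP tx0.
  exists x; first by rewrite inE xs orbT.
  have -> : (t + S) / x = (1 + t / S) * (S / x).
    by field; rewrite x0 S0.
  apply: vr_unitM => //; apply: vr_max_unit; rewrite tS; apply: vr_maxM => //.
  exact: vr_unitV.
exists t; first exact: mem_head.
rewrite mulrDl divff //; apply: vr_max_unit.
have -> : S / t = (t / x)^-1 * (S / x) by field; rewrite x0 t0.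
exact: vr_maxM.
Qed.

End ValuationRing.

Section ExtendValuation.
Variables (W E : fieldType) (j : {rmorphism W -> E}) (n : nat).
Hypothesis alg : forall x : E, exists p : {poly W},
  [/\ p != 0, (size p <= n.+1)%N & root (map_poly j p) x].

(** Zorn's lemma gives a valuation ring B of E above u, but not the discreteness of its value group.
    This comes from an equation of x of degree at most n: two of its terms must have the same value,
    so some x^k with 0 < k <= n is a unit of B times an element of W. The exponent n! then works for
    all x at once, and the value of x^(n!) is read in W. *)
Lemma dvaluation_extend (u : W -> int) : is_dvaluation u ->
  exists (e : int) (v : E -> int),
    [/\ 0 < e, is_dvaluation v & forall x, v (j x) = e * u x].
Proof.
move=> du; have uP := dvaluation_valuation du.
have [p p0 up] : exists2 p, p != 0 & u p = 1.
  by case: (dval_surj du) => p; rewrite unitfE; exists p.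
have vgeV x : x != 0 -> vge u 0 x \/ vge u 1 x^-1.
  by move=> x0; rewrite !(vgeP _ _) ?invr_eq0 // (valV uP); case: (leP 0 (u x)); [left|right; lia].
pose A : set E := [set x | exists2 y, vge u 0 y & x = j y]%classic.
have AP : subring_set A.
  split.
  - by exists 1; rewrite ?rmorph1 // (vge1 uP).
  - by move=> _ _ [x vx ->] [y vy ->]; exists (x - y); rewrite ?rmorphB // (vgeB uP).
  - by move=> _ _ [x vx ->] [y vy ->]; exists (x * y); rewrite ?rmorphM // (vgeM0 uP).
have Ap : A (j p) by exists p => //; rewrite vge_val // up.
have nAp : ~ A (j p)^-1.
  case=> y vy /eqP; rewrite -fmorphV fmorph_eq => /eqP yE; move: vy.
  by rewrite -yE vgeP ?invr_eq0 // (valV uP) up.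
have jp0 : j p != 0 by rewrite fmorph_eq0.
have [B [BP AB nBp BV]] := valuation_ring_exists AP jp0 Ap nAp.
have Bj c : c != 0 -> B (j c) -> 0 <= u c.
  move=> c0 Bc; rewrite leNgt; apply/negP => uc; apply: nBp.
  have -> : (j p)^-1 = j c * j (p^-1 * c^-1).
    by rewrite -rmorphM mulrCA divff // mulr1 fmorphV.
  apply: subring_setM => //; apply: AB; exists (p^-1 * c^-1) => //.
  by rewrite vgeP ?mulf_neq0 ?invr_eq0 // (valM uP) ?invr_eq0 // !(valV uP) up; lia.
have jB c : c != 0 -> 0 <= u c -> B (j c).
  by move=> c0 uc; apply: AB; exists c => //; rewrite vge_val.
have unitj c : c != 0 -> vr_unit B (j c) <-> u c = 0.
  move=> c0; split=> [[_ Bc Bc']|uc].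
    have := Bj _ c0 Bc; rewrite -fmorphV in Bc'.
    have := Bj c^-1; rewrite invr_eq0 (valV uP) => /(_ c0 Bc'); lia.
  split; rewrite ?fmorph_eq0 //; first by apply: jB; rewrite ?uc.
  by rewrite -fmorphV; apply: jB; rewrite ?invr_eq0 // (valV uP) uc.
have powk (x : E) : x != 0 -> exists (k : nat) (c : W),
    [/\ (0 < k <= n)%N, c != 0 & vr_unit B (x ^+ k / j c)].
  move=> x0; have [q [q0 sq rq]] := alg x.
  pose I := [seq i <- iota 0 (size q) | q`_i != 0].
  pose t i := j q`_i * x ^+ i.
  have I0 i : i \in I -> (i < size q)%N /\ q`_i != 0.
    by rewrite mem_filter mem_iota add0n => /and3P[].
  have t0 i : i \in I -> t i != 0.
    by case/I0 => _ qi; rewrite mulf_neq0 ?fmorph_eq0 ?expf_neq0.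
  have [pw|npw] := pselect (pairwise (fun x y => `[< ~ vr_unit B (x / y) >]) (map t I)).
    have [] := vr_sum_unit BP BV _ _ pw.
    - by apply/allP => _ /mapP[i iI ->]; exact: t0.
    - have : (size q).-1 \in I.
        rewrite mem_filter mem_iota /= -lead_coefE lead_coef_eq0 q0 add0n prednK ?leqnn //.
        by rewrite size_poly_gt0.
      by case: (I).
    - move=> y _ []; suff -> : \sum_(z <- map t I) z = 0 by rewrite mul0r eqxx.
      rewrite big_map big_filter -[RHS](rootP rq) horner_coef size_map_poly.
      rewrite -(big_mkord xpredT (fun i => (map_poly j q)`_i * x ^+ i)).
      rewrite [RHS](bigID (fun i => q`_i != 0)) /= [X in _ + X]big1 ?addr0.
        by rewrite /index_iota subn0; apply: eq_bigr => i _; rewrite coef_map.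
      by move=> i; rewrite negbK coef_map /= => /eqP ->; rewrite rmorph0 mul0r.
  move: npw => /negP; rewrite pairwise_map.
  have sI : sorted ltn I by apply: sorted_filter (iota_ltn_sorted _ _); exact: ltn_trans.
  move=> npw; have [i [i' [iI i'I ltii' uii']]] : exists i i',
      [/\ i \in I, i' \in I, (i < i')%N & vr_unit B (t i / t i')].
    apply: contrapT => none; move/negP: npw; apply.
    have := sI; rewrite (sorted_pairwise ltn_trans).
    have sub : {subset I <= I} by [].
    elim: {1 3 4}I sub => //= a s IH sub /andP[/allP ha hs].
    rewrite IH ?andbT //; last by move=> b bs; apply: sub; rewrite inE bs orbT.
    apply/allP => b bs; apply/asboolP => u'; apply: none; exists a, b; split=> //.
    - by apply: sub; rewrite mem_head.
    - by apply: sub; rewrite inE bs orbT.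
    - exact: ha.
  have [i'q qi'] := I0 _ i'I; have [_ qi] := I0 _ iI.
  exists (i' - i)%N, (q`_i / q`_i'); split.
  - rewrite subn_gt0 ltii' (leq_trans (leq_subr _ _)) //.
    by rewrite -ltnS (leq_trans i'q).
  - by rewrite mulf_neq0 ?invr_eq0.
  - have -> : x ^+ (i' - i) / j (q`_i / q`_i') = (t i / t i')^-1.
    rewrite /t rmorphM fmorphV /= expfB_cond ?(negPf x0) //; last by rewrite add0n ltnW.
    have xi0 m : x ^+ m != 0 by rewrite expf_neq0.
    rewrite -(fmorph_eq0 j) in qi; rewrite -(fmorph_eq0 j) in qi'.
    move: (xi0 i) (xi0 i') qi qi'; move: (x ^+ i) (x ^+ i') (j _) (j _) => a b c d a0 b0 c0 d0.
    by field; rewrite a0 b0 c0 d0.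
  exact: vr_unitV.
pose N := n`!.
have N0 : (0 < N)%N by exact: fact_gt0.
have powN (x : E) : x != 0 -> exists c : W, c != 0 /\ vr_unit B (x ^+ N / j c).
  move=> /powk[k [c [/andP[k0 kn] c0 uc]]].
  have /dvdnP[m Nm] : (k %| N)%N by rewrite dvdn_fact // k0.
  exists (c ^+ m); rewrite expf_neq0 //; split=> //.
  by rewrite Nm mulnC exprM rmorphXn -expr_div_n; exact: vr_unitX.
have powN' x : exists y : W, x != 0 -> y != 0 /\ vr_unit B (x ^+ N / j y).
  have [->|x0] := eqVneq x 0; first by exists 0.
  by have [y yP] := powN x x0; exists y.
have [c cP] := choice powN'.
pose v' (x : E) : int := if x == 0 then 0 else u (c x).
have v'E x y : x != 0 -> y != 0 -> vr_unit B (x ^+ N / j y) -> v' x = u y.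
  move=> x0 y0 uy; rewrite /v' (negPf x0); have [c0 uc] := cP x x0.
  have : vr_unit B (j (c x / y)).
    have -> : j (c x / y) = (x ^+ N / j (c x))^-1 * (x ^+ N / j y).
      have xN0 : x ^+ N != 0 by rewrite expf_neq0.
      by rewrite invf_div mulrA divfK // rmorphM fmorphV.
    by apply: vr_unitM => //; exact: vr_unitV.
  by rewrite unitj ?mulf_neq0 ?invr_eq0 // (valF uP) // => /eqP; rewrite subr_eq0 => /eqP.
(* The ring of v' is B, so the ultrametric inequality for v' reduces to the closure of B under
   addition. *)
have v'ge x : x != 0 -> (0 <= v' x) <-> B x.
  move=> x0; have [c0 uc] := cP x x0; rewrite (v'E x (c x)) //.
  have xN0 : x ^+ N != 0 by rewrite expf_neq0.
  have jc0 : j (c x) != 0 by rewrite fmorph_eq0.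
  split=> [ucx|Bx].
    have BxN : B (x ^+ N).
      by rewrite -(divfK jc0 (x ^+ N)); apply: subring_setM => //; [case: uc|exact: jB].
    have [//|Bx'] := BV x.
    rewrite -(prednK N0) exprSr in BxN.
    have -> : x = x ^+ N.-1 * x * x^-1 ^+ N.-1.
      by rewrite mulrAC -exprMn divff // expr1n mul1r.
    by apply: subring_setM => //; exact: subring_setX.
  apply: Bj => //; have -> : j (c x) = x ^+ N * (x ^+ N / j (c x))^-1.
    by rewrite invf_div mulrCA divff // mulr1.
  by apply: subring_setM => //; [exact: subring_setX|case: uc].
have v'M x y : x != 0 -> y != 0 -> v' (x * y) = v' x + v' y.
  move=> x0 y0; have [cx0 ucx] := cP x x0; have [cy0 ucy] := cP y y0.
  rewrite (v'E _ _ x0 cx0 ucx) (v'E _ _ y0 cy0 ucy) -(valM uP) //.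
  apply: v'E; rewrite ?mulf_neq0 //.
  by rewrite exprMn rmorphM invfM mulrACA; exact: vr_unitM.
have v'j x : v' (j x) = N%:Z * u x.
  have [->|x0] := eqVneq x 0; first by rewrite /v' rmorph0 eqxx (val0 uP) mulr0.
  rewrite (v'E _ (x ^+ N)) ?fmorph_eq0 ?expf_neq0 //.
    have e1 : (N%:Z * u x = u x *+ N) by rewrite -mulr_natl natz.
    by rewrite (valX uP) e1.
  by rewrite rmorphXn divff ?expf_neq0 ?fmorph_eq0 //; exact: vr_unit1.
have v'P : is_valuation v'.
  split=> //; first by rewrite /v' eqxx.
  - have wlog_le x y : x != 0 -> y != 0 -> x + y != 0 -> v' y <= v' x -> v' y <= v' (x + y).
      move=> x0 y0 xy0 le_v; have Bxy : B (x / y).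
        apply/v'ge; first by rewrite mulf_neq0 ?invr_eq0.
        by have := v'M (x / y) y; rewrite divfK // mulf_neq0 ?invr_eq0 // => /(_ isT y0); lia.
      have nz : (x + y) / y != 0 by rewrite mulf_neq0 ?invr_eq0.
      have : 0 <= v' ((x + y) / y).
        apply/v'ge => //; rewrite mulrDl divff //.
        by apply: subring_setD => //; exact: subring_set1.
      by have := v'M ((x + y) / y) y nz y0; rewrite divfK //; lia.
    move=> x y x0 y0 xy0; case: (leP (v' x) (v' y)) => [le_v|/ltW le_v].
      by rewrite addrC; apply: wlog_le => //; rewrite addrC.
    exact: wlog_le.
  - by exists (j p); rewrite ?fmorph_eq0 // v'j up; lia.
have [e [v [e0 dv ve]]] := valuation_normalize v'P.
have vp : e * v (j p) = N%:Z by rewrite -ve v'j up mulr1.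
exists (v (j p)), v; split=> // [|x]; first by rewrite -(pmulr_rgt0 _ e0) vp; lia.
have := ve (j x); rewrite v'j -vp; have e00 : e != 0 by lia.
by rewrite -mulrA => /(mulfI e00).
Qed.

End ExtendValuation.

(** * Weak approximation and unramified quadratic extensions *)

Section WeakApproximation.
Variable W : fieldType.
Local Notation valT := {classic (W -> int)}.

(** An inclusion of valuation rings makes every unit for u a unit for v, so v is a multiple of u;
    both being normalized, the factor is 1. *)
Lemma dvaluation_sub (u v : W -> int) : is_dvaluation u -> is_dvaluation v ->
  (forall x, x != 0 -> 0 <= u x -> 0 <= v x) -> v = u.
Proof.
move=> du dv sub; have uP := dvaluation_valuation du; have vP := dvaluation_valuation dv.
have unit x : x != 0 -> u x = 0 -> v x = 0.
  move=> x0 ux; have := sub x x0; rewrite ux => /(_ isT) v1.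
  have := sub x^-1; rewrite invr_eq0 (valV uP) (valV vP) ux => /(_ x0 isT); lia.
have [p p0 up] : exists2 p, p != 0 & u p = 1.
  by case: (dval_surj du) => p; rewrite unitfE; exists p.
have vE x : v x = v p * u x.
  have [->|x0] := eqVneq x 0; first by rewrite (val0 uP) (val0 vP) mulr0.
  have pn0 : p ^ u x != 0 by rewrite expfz_neq0.
  have valZ w (wP : is_valuation w) (k : int) : w (p ^ k) = w p * k.
    by case: k => k; rewrite /exprz ?(valV wP) (valX wP); lia.
  have := unit (x / p ^ u x); rewrite mulf_neq0 ?invr_eq0 // (valF uP) // (valF vP) // !valZ // up.
  by move=> /(_ isT); lia.
have [x _ vx] := dval_surj dv; have vp0 := sub p p0; rewrite up in vp0.
have vp1 : v p = 1.
  have := vE x; have := vp0 isT; rewrite vx.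
  by move: (v p) (u x) => a b; case: (ltP 0 b) => hb; nia.
by apply/funext => y; rewrite vE vp1 mul1r.
Qed.

Lemma dvaluation_sep2 (u v : W -> int) : is_dvaluation u -> is_dvaluation v ->
  v <> u -> exists2 x, x != 0 & u x < 0 < v x.
Proof.
move=> du dv vu; have uP := dvaluation_valuation du; have vP := dvaluation_valuation dv.
have nsub (a b : W -> int) : is_dvaluation a -> is_dvaluation b -> b <> a ->
    exists2 x, x != 0 & 0 <= a x /\ b x < 0.
  move=> da db ba; apply: contrapT => none; apply: ba; apply: dvaluation_sub => // x x0 ax.
  by rewrite leNgt; apply/negP => bx; apply: none; exists x.
have [x x0 [ux vx]] := nsub u v du dv vu.
have [y y0 [vy uy]] := nsub v u dv du (fun e => vu (esym e)).
by exists (y / x); rewrite ?mulf_neq0 ?invr_eq0 // (valF uP) // (valF vP) //; lia.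
Qed.

(** Induction on the list: an element x suitable for s is corrected at the new valuation w by an
    element z that separates u from w. *)
Lemma dvaluation_sep (u : valT) (s : seq valT) : is_dvaluation u ->
  (forall v : valT, v \in s -> is_dvaluation v) -> u \notin s ->
  exists x : W, [/\ x != 0, u x < 0 & forall v : valT, v \in s -> 0 < v x].
Proof.
move=> du; have uP := dvaluation_valuation du.
have [y0 _ uy0] := dval_surj du.
elim: s => [|w s IH] ds us.
  exists y0^-1; split=> //; last by rewrite (valV uP) uy0.
  by rewrite invr_eq0; apply: contra_eq_neq uy0 => ->; rewrite (val0 uP).
have [|x [x0 ux sx]] := IH (fun v vs => ds v (@mem_behead _ (w :: s) v vs)).
  by apply: contra us => us; rewrite inE us orbT.
have dw : is_dvaluation w by apply: ds; rewrite mem_head.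
have wP := dvaluation_valuation dw.
have [z z0 /andP[uz wz]] : exists2 z, z != 0 & u z < 0 < w z.
  apply: dvaluation_sep2 => // wu; move/negP: us; apply; rewrite -wu; exact: mem_head.
have [k kP] : exists k : nat, forall v : valT, v \in s -> - v z < k%:Z.
  elim: (s) => [|v t [k kP]]; first by exists 0%N.
  exists (k + `|v z| + 1)%N => v'; rewrite inE => /predU1P[->|/kP]; lia.
have dX v (vs : v \in s) : is_valuation v.
  by apply/dvaluation_valuation/ds; rewrite inE vs orbT.
have xk0 m : x ^+ m != 0 by rewrite expf_neq0.
have [wx|wx|wx] := ltrgtP 0 (w x).
- by exists x; split=> // v; rewrite inE => /predU1P[->|/sx].
(* Here x has a pole at w as well as at u. The fraction is a unit at both, so z decides there, while
   on s it vanishes to an order that outweighs any pole of z. *)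
- exists (x ^+ k.+1 / (1 + x ^+ k.+1) * z).
  have big (v : W -> int) (vP : is_valuation v) : v x < 0 ->
      1 + x ^+ k.+1 != 0 /\ v (1 + x ^+ k.+1) = v (x ^+ k.+1).
    by move=> vx; rewrite addrC; apply: valDl => //; rewrite vgeP ?oner_neq0 // (val1 vP) (valX vP); nia.
  have [d0 wd] := big w wP wx; have [_ ud] := big u uP ux.
  have n0 : x ^+ k.+1 / (1 + x ^+ k.+1) != 0 by rewrite mulf_neq0 ?invr_eq0.
  split; first by rewrite mulf_neq0.
    by rewrite (valM uP) // (valF uP) // ud; lia.
  move=> v; rewrite inE => /predU1P[->|vs].
    by rewrite (valM wP) // (valF wP) // wd; lia.
  have vP := dX v vs; have vx := sx v vs.
  have [_ vd] : 1 + x ^+ k.+1 != 0 /\ v (1 + x ^+ k.+1) = 0.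
    by apply: val1D; rewrite // vgeP // (valX vP); nia.
  by rewrite (valM vP) // (valF vP) // vd (valX vP); have := kP v vs; nia.
- exists (x ^+ k.+1 * z); split; first by rewrite mulf_neq0.
    by rewrite (valM uP) // (valX uP); nia.
  move=> v; rewrite inE => /predU1P[->|vs].
    by rewrite (valM wP) // (valX wP) -wx; lia.
  by have vP := dX v vs; rewrite (valM vP) // (valX vP); have := kP v vs; have := sx v vs; nia.
Qed.

(** Closeness is measured multiplicatively, by x / d v - 1, to match [unramified_at_near]. *)
Lemma weak_approximation (s : seq valT) (N : nat) (d : valT -> W) :
  (forall v : valT, v \in s -> is_dvaluation v /\ d v != 0) ->
  exists x, forall v : valT, v \in s -> vge v N%:Z (x / d v - 1).
Proof.
move=> ds; have vP v (vs : v \in s) := dvaluation_valuation (ds v vs).1.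
pose B := (\sum_(u <- s) \sum_(v <- s) `|(u : valT) (d v)|)%N.
have B_le (u v : valT) : u \in s -> v \in s -> (`|u (d v)| <= B)%N.
  move=> us vs; rewrite /B (big_rem u us) (big_rem v vs) /= -addnA leq_addr //.
(* The term e u * d u with u <> v gets divided by d v; this changes its value at v by at least -2
   B. *)
pose M := (N + B + B).+1.
have sep (u : valT) : exists y : W, u \in s -> vge u M%:Z (y - 1) /\
    forall v : valT, v \in s -> v != u -> vge v M%:Z y.
  have [us|] := boolP (u \in s); last by exists 0.
  have [] := @dvaluation_sep u [seq v <- s | v != u] (ds u us).1.
  - by move=> v; rewrite mem_filter => /andP[_ /ds[]].
  - by rewrite mem_filter eqxx.
  (* The fraction is close to 1 where x has a pole and close to 0 where x has a zero. *)
  move=> x [x0 ux sx]; have uP := vP u us; exists (x ^+ M / (x ^+ M + 1)) => _.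
  have xM0 : x ^+ M != 0 by rewrite expf_neq0.
  have uxM : u (x ^+ M) <= - M%:Z by rewrite (valX uP); nia.
  have [d0 ud] : x ^+ M + 1 != 0 /\ u (x ^+ M + 1) = u (x ^+ M).
    by apply: valDl => //; rewrite vgeP ?oner_neq0 // (val1 uP); lia.
  split.
    have -> : x ^+ M / (x ^+ M + 1) - 1 = - (x ^+ M + 1)^-1 by field.
    by rewrite vgeN // vgeP ?invr_eq0 // (valV uP) ud; lia.
  move=> v vs vu; have vP' := vP v vs; have vx : 0 < v x by apply: sx; rewrite mem_filter vu.
  have vxM : M%:Z <= v (x ^+ M) by rewrite (valX vP'); nia.
  have [_ vd] : x ^+ M + 1 != 0 /\ v (x ^+ M + 1) = 0.
    by rewrite addrC; apply: val1D; rewrite // vgeP //; lia.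
  by rewrite vgeP ?mulf_neq0 ?invr_eq0 // (valF vP') // vd; lia.
have [e eP] := choice sep.
exists (\sum_(u <- undup s) e u * d u) => v vs.
have [_ dv0] := ds v vs; have vP' := vP v vs.
rewrite (bigD1_seq v) ?mem_undup ?undup_uniq //= mulrDl mulfK // addrAC vgeD //.
  by apply: (vge_le _ (eP v vs).1); lia.
rewrite mulr_suml big_seq_cond; apply: vge_sum => // u /andP[]; rewrite mem_undup => us uv.
have [_ du0] := ds u us.
have : vge v (M%:Z + (v (d u) - v (d v))) (e u * (d u / d v)).
  have [_ /(_ v vs) eu] := eP u us; apply: vgeM => //; first by apply: eu; rewrite eq_sym.
  by rewrite vgeP ?mulf_neq0 ?invr_eq0 // (valF vP').
rewrite mulrA; apply: vge_le; have := B_le v u vs us; have := B_le v v vs vs.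
by rewrite /M; lia.
Qed.

End WeakApproximation.

Definition subfield_set (E : fieldType) (A : set E) : Prop :=
  subring_set A /\ forall x, A x -> A x^-1.

(* The quadratic extension E(sqrt a) is unramified at v when a = d^2 (1 + 4 e)
   with e integral and 1 + 4 e a unit. *)
Definition unramified_at (E : fieldType) (v : E -> int) (d a : E) : Prop :=
  [/\ d != 0, v (a / d ^+ 2) = 0 & vge v 0 ((a / d ^+ 2 - 1) / 4%:R)].

Section UnramifiedAt.
Variables (E : fieldType) (v : E -> int).
Hypotheses (vP : is_valuation v) (E2 : (2%:R : E) != 0).

Lemma four_neq0 : (4%:R : E) != 0.
Proof. by rewrite (natrM E 2 2) mulf_neq0. Qed.
Let E4 := four_neq0.

Lemma val_nat_ge0 n : 0 <= v n%:R.
Proof.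
have [->|n0] := eqVneq (n%:R : E) 0; first by rewrite (val0 vP).
by have := vge_nat vP n; rewrite vgeP.
Qed.

Lemma unramified_atM (d d' a a' : E) : a != 0 -> a' != 0 ->
  unramified_at v d a -> unramified_at v d' a' -> unramified_at v (d * d') (a * a').
Proof.
move=> a0 a'0 [d0 vd ed] [d'0 vd' ed'].
have n0 : a / d ^+ 2 != 0 by rewrite mulf_neq0 ?invr_eq0 ?expf_neq0.
have n'0 : a' / d' ^+ 2 != 0 by rewrite mulf_neq0 ?invr_eq0 ?expf_neq0.
have -> : a * a' = (a / d ^+ 2 * (a' / d' ^+ 2)) * (d * d') ^+ 2.
  by field; rewrite d0 d'0.
move: (a / d ^+ 2) (a' / d' ^+ 2) n0 n'0 vd ed vd' ed' => x y x0 y0 vx ex vy ey.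
have dd0 : d * d' != 0 by rewrite mulf_neq0.
split=> //; rewrite mulfK ?expf_neq0 //; first by rewrite (valM vP) // vx vy.
have -> : (x * y - 1) / 4%:R = (x - 1) / 4%:R * y + (y - 1) / 4%:R by field.
by apply: vgeD => //; apply: vgeMr => //; rewrite vgeP ?vy.
Qed.

Lemma unramified_at_sqr d : d != 0 -> unramified_at v d (d ^+ 2).
Proof.
move=> d0; split=> //; rewrite divff ?expf_neq0 ?(val1 vP) //.
by rewrite subrr mul0r vge0.
Qed.

Lemma unramified_at_prod I (r : seq I) (P : pred I) (d a : I -> E) :
  (forall i, P i -> a i != 0 /\ unramified_at v (d i) (a i)) ->
  unramified_at v (\prod_(i <- r | P i) d i) (\prod_(i <- r | P i) a i).
Proof.
move=> H; suff [] : \prod_(i <- r | P i) a i != 0 /\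
  unramified_at v (\prod_(i <- r | P i) d i) (\prod_(i <- r | P i) a i) by [].
elim: r => [|i r [IH0 IH]].
  by rewrite !big_nil oner_neq0; split=> //; have := unramified_at_sqr (oner_neq0 E); rewrite expr1n.
rewrite !big_cons; case: ifP => // /H[a0 da]; split; first exact: mulf_neq0.
exact: unramified_atM.
Qed.

(** The condition is open in d, which allows a single d to serve several valuations. With t = d' /
    d, the precision v 4 + 1 makes t a unit and (t - 1) / 4 integral, so dividing by t^2 preserves
    the form 1 + 4 e. *)
Lemma unramified_at_near (d d' a : E) : a != 0 ->
  unramified_at v d a -> vge v (v 4%:R + 1) (d' / d - 1) -> unramified_at v d' a.
Proof.
move=> a0 [d0 vd ed] dd; have v4 := val_nat_ge0 4.
have [t0 vt] : 1 + (d' / d - 1) != 0 /\ v (1 + (d' / d - 1)) = 0.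
  by apply: val1D => //; apply: (vge_le _ dd); lia.
rewrite addrC subrK in t0 vt; set t := d' / d in t0 vt dd.
have d'E : d' = t * d by rewrite divfK.
clearbody t.
have d'0 : d' != 0 by rewrite d'E mulf_neq0.
have x0 : a / d ^+ 2 != 0 by rewrite mulf_neq0 ?invr_eq0 ?expf_neq0.
have -> : a = (a / d ^+ 2 / t ^+ 2) * d' ^+ 2.
  by rewrite d'E; field; rewrite d0 t0.
move: (a / d ^+ 2) x0 vd ed => x x0 vx ex.
split=> //; rewrite mulfK ?expf_neq0 //; first by rewrite (valF vP) ?expf_neq0 // (valX vP) vx vt.
have -> : (x / t ^+ 2 - 1) / 4%:R =
    ((x - 1) / 4%:R - (t - 1) / 4%:R * ((t - 1) + 2%:R)) / t ^+ 2.
  by field; rewrite t0.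
rewrite vge_div ?expf_neq0 // (valX vP) vt mul0rn addr0.
apply: vgeB => //; apply: vgeM0 => //.
  by rewrite vge_div //; apply: (vge_le _ dd); rewrite add0r lerDl.
by apply: vgeD => //; [apply: (vge_le _ dd); lia|exact: vge_nat].
Qed.

(* With z = (1 + y / d) / 2, a root of z^2 - z - e, every element r + z with r
   in A has the value of 1, of r, or of its norm r^2 + r - e. *)
Lemma unramified_values (A : set E) (y d p q : E) : subfield_set A ->
  A (y ^+ 2) -> y != 0 -> A d -> unramified_at v d (y ^+ 2) ->
  A p -> A q -> p + q * y != 0 ->
  exists c, [/\ A c, c != 0 & v c = v (p + q * y)].
Proof.
move=> [AP AV] Aa y0 Ad [d0 vd]; set e := (_ - 1) / _ => ve Ap Aq x0.
have A2 : A 2%:R by rewrite mulr2n; apply: subring_setD => //; exact: subring_set1.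
have [q0|q0] := eqVneq q 0; first by exists p; move: x0; rewrite q0 mul0r addr0.
have [z zdef] : exists z, z = (1 + y / d) / 2%:R by eexists.
have zE : z * z = z + e by rewrite zdef /e; field; rewrite E4 d0 E2.
have vz : vge v 0 z.
  have [->|z0] := eqVneq z 0; first exact: vge0.
  rewrite vgeP // leNgt; apply/negP => vz.
  have : vge v (v z) (z * z).
    by rewrite zE; apply: vgeD => //; [exact: vge_val|apply: (vge_le _ ve); lia].
  by rewrite vgeP ?mulf_neq0 // (valM vP) //; lia.
have Ae : A e.
  have A4 : A 4%:R by rewrite (natrM E 2 2); exact: subring_setM.
  apply: subring_setM => //; last exact: AV.
  apply: subring_setB => //; last exact: subring_set1.
  by apply: subring_setM => //; apply: AV; rewrite expr2; exact: subring_setM.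
pose k := 2%:R * q * d; pose r := (p - q * d) / k.
have k0 : k != 0 by rewrite !mulf_neq0.
have Ak : A k by do 2?apply: subring_setM => //.
have Ar : A r.
  apply: subring_setM => //; last exact: AV.
  by apply: subring_setB => //; exact: subring_setM.
have xE : p + q * y = k * (r + z) by rewrite /r /k zdef; field; rewrite d0 q0 E2.
rewrite xE in x0 *; have rz0 : r + z != 0 by apply: contraNneq x0 => ->; rewrite mulr0.
suff [c [Ac c0 vc]] : exists c, [/\ A c, c != 0 & v c = v (r + z)].
  exists (k * c); split; first exact: subring_setM.
    exact: mulf_neq0.
  by rewrite (valM vP k0 c0) (valM vP k0 rz0) vc.
have [vr|nvr] := boolP (vge v 0 r); last first.
  have r0 : r != 0 by apply: contraNneq nvr => ->; exact: vge0.
  exists r; split=> //; move: nvr; rewrite vgeP // -ltNge => vr.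
  by have [||_ ->] := @valDl _ v vP r z => //; apply: (vge_le _ vz); rewrite lezD1.
have vrz : 0 <= v (r + z) by rewrite -(vgeP _ _ rz0) vgeD.
have [vrz0|vrz1] := eqVneq (v (r + z)) 0.
  by exists 1; split; [exact: subring_set1|exact: oner_neq0|rewrite (val1 vP) vrz0].
have yd0 : y / d != 0 by rewrite mulf_neq0 ?invr_eq0.
have vyd : v (y / d) = 0.
  by move/eqP: vd; rewrite -expr_div_n (valX vP) mulrn_eq0 => /eqP.
(* This is the conjugate r + (1 - y / d) / 2 of r + z. It is a unit because y / d is one and r + z
   is not, so r + z has the value of its norm. *)
have [r'0 vr'] : - (y / d) + (r + z) != 0 /\ v (- (y / d) + (r + z)) = 0.
  have := @valDl _ v vP (- (y / d)) (r + z); rewrite oppr_eq0 (valN vP) vyd; apply=> //.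
  by rewrite vgeP // add0r -gtz0_ge1 lt_neqAle eq_sym vrz1.
have r'E : (r + z) * (- (y / d) + (r + z)) = r * r + r - e.
  by rewrite zdef /e; field; rewrite E4 d0 E2.
exists (r * r + r - e); split.
- by apply: subring_setB => //; apply: subring_setD => //; exact: subring_setM.
- by rewrite -r'E mulf_neq0.
- by rewrite -r'E (valM vP) // vr' addr0.
Qed.

End UnramifiedAt.

Lemma char0_embed (W : fieldType) (i : {rmorphism W -> algC}) n : (n.+1%:R : W) != 0.
Proof. by rewrite -(fmorph_eq0 i) rmorph_nat pnatr_eq0. Qed.

Lemma algC_int_poly (x : algC) : exists2 p : {poly int}, p != 0 &
  root (map_poly intr p) x.
Proof.
have [q [_ qmon _]] := minCpolyP x; have := root_minCpoly x.
case: (minCpolyP x) => {}q [-> {}qmon _] rq.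
have [r [a a0 qE]] := rat_poly_scale q; exists r.
  by apply: contraTneq (monic_neq0 qmon) => r0; rewrite qE r0 rmorph0 scaler0 eqxx.
move: rq; rewrite qE map_polyZ /= rootZ; last first.
  by rewrite fmorph_eq0 invr_eq0 intr_eq0.
by rewrite -map_poly_comp; under eq_map_poly => z do rewrite /= ratr_int.
Qed.

(** An odd coefficient keeps p nonzero modulo 2; at a prime above 2, p therefore makes the residue
    algebraic over F_2. *)
Lemma algC_primitive_int_poly (x : algC) : exists p : {poly int},
  (exists k, ~~ (2 %| p`_k)%Z) /\ root (map_poly intr p) x.
Proof.
have [p p0 rp] := algC_int_poly x; exists (zprimitive p); split.
  apply: contrapT => none.
  have : (2 %| zcontents (zprimitive p))%Z.
    rewrite dvdz_contents; apply/polyOverP => k; apply: contrapT => /negP nk.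
    by apply: none; exists k.
  by rewrite zcontents_primitive p0.
move: rp; rewrite {1}(zpolyEprim p) map_polyZ rootZ // intr_eq0 zcontents_eq0 //.
Qed.

(** * Square roots in residue fields of characteristic 2 *)

Section PerfectResidue.
Variables (W : fieldType) (u : W -> int).
Hypotheses (uP : is_valuation u) (u2 : vge u 1 2%:R).

Lemma vge_int z : vge u 0 (z%:~R : W).
Proof. by case: z => n; rewrite ?NegzE ?mulrNz ?vgeN // vge_nat. Qed.

Lemma vge_int_even z : (2 %| z)%Z -> vge u 1 (z%:~R : W).
Proof. by case/dvdzP => k ->; rewrite intrM vgeMl // vge_int. Qed.

Lemma vge_int_odd z : ~~ (2 %| z)%Z -> ~~ vge u 1 (z%:~R : W).
Proof.
move=> z2; apply/negP => uz; have : vge u 1 ((z - 2 * (z %/ 2)%Z)%:~R : W).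
  by rewrite intrB vgeB // vge_int_even // dvdz_mulr.
have -> : z - 2 * (z %/ 2)%Z = 1.
  have := divz_eq z 2; have : (z %% 2)%Z != 0 by apply: contra z2 => /eqP/dvdz_mod0P.
  by have := ltz_pmod z (isT : 0 < 2 :> int); have := modz_ge0 z (isT : 2 != 0 :> int); lia.
by rewrite vgeP ?oner_neq0 // (val1 uP).
Qed.

Lemma vge_horner (p : {poly int}) A : vge u 0 A -> vge u 0 (map_poly intr p).[A].
Proof.
move=> uA; rewrite horner_coef; apply: vge_sum => // i _.
by rewrite coef_map vgeM0 ?vge_int ?vgeX.
Qed.

(** Modulo 2, squaring is additive and fixes the integer coefficients. *)
Lemma horner_frobenius (p : {poly int}) A : vge u 0 A ->
  vge u 1 ((map_poly intr p).[A ^+ 2] - (map_poly intr p).[A] ^+ 2).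
Proof.
move=> uA; elim/poly_ind: p => [|p c IH].
  by rewrite rmorph0 !horner0 expr0n subr0 vge0.
rewrite !rmorphD !rmorphM /= map_polyX map_polyC !hornerMXaddC.
move: (vge_horner p uA) IH; set a := _.[A]; set b := _.[A ^+ 2] => ua IH.
have -> : b * A ^+ 2 + c%:~R - (a * A + c%:~R) ^+ 2 =
    (b - a ^+ 2) * A ^+ 2 - 2%:R * (a * A * c%:~R) - (c ^+ 2 - c)%:~R.
  by rewrite intrB rmorphXn /=; ring.
apply: vgeB => //; last first.
  apply: vge_int_even; rewrite expr2 -[X in _ * _ - X]mulr1 -mulrBr.
  have := divz_eq c 2; have := ltz_pmod c (isT : 0 < 2 :> int).
  have := modz_ge0 c (isT : 2 != 0 :> int); move: (c %% 2)%Z (c %/ 2)%Z => r k r0 r1 cE.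
  have [r0'|r1'] : r = 0 \/ r = 1 by lia.
    by rewrite dvdz_mulr //; apply/dvdzP; exists k; lia.
  by rewrite dvdz_mull //; apply/dvdzP; exists k; lia.
apply: vgeB => //; first by rewrite vgeMr ?vgeX.
by rewrite vgeMr ?vgeM0 ?vge_int.
Qed.

(* In characteristic 2 an equation E(x^2) + x O(x^2) = 0 over F_2 reads
   E(x)^2 = x O(x)^2. *)
Lemma residue_sqrt (i : {rmorphism W -> algC}) A : vge u 0 A ->
  exists2 q, vge u 0 q & vge u 1 (q ^+ 2 - A).
Proof.
have half_lt m n : (0 < m)%N -> (m < n.+1)%N -> (m./2 < n)%N by lia.
have uphalf_lt m n : (0 < m)%N -> m != 1%N -> (m < n.+1)%N -> (uphalf m < n)%N by lia.
have pos (k : int) : 1 <= k *+ 2 -> 1 <= k by lia.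
move=> uA; have [p [pk rp]] := algC_primitive_int_poly (i A).
have {rp} : vge u 1 (map_poly intr p).[A].
  suff -> : (map_poly intr p).[A] = 0 by exact: vge0.
  apply: (fmorph_inj i); rewrite rmorph0 -horner_map -map_poly_comp /=.
  rewrite (eq_map_poly (g := intr)); first exact/eqP.
  by move=> z; rewrite /= rmorph_int.
have [n] := ubnP (size p); elim: n p pk => // n IH p [k pk] sp up.
set O := odd_poly p; set E := even_poly p.
have pE : p = E \Po 'X^2 + (O \Po 'X^2) * 'X by rewrite poly_even_odd.
have hor (q : {poly int}) : (map_poly intr (q \Po 'X^2)).[A] = (map_poly intr q).[A ^+ 2].
  by rewrite map_comp_poly map_polyXn horner_comp hornerXn.
have up' : vge u 1 ((map_poly intr E).[A] ^+ 2 + (map_poly intr O).[A] ^+ 2 * A).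
  have uE := horner_frobenius E uA; have uO := horner_frobenius O uA.
  move: up; rewrite {1}pE rmorphD rmorphM /= map_polyX hornerD hornerMX !hor.
  move: uE uO; set a := _.[A ^+ 2]; set b := _.[A]; set c := _.[A ^+ 2]; set e := _.[A].
  move=> uE uO up; have -> : b ^+ 2 + e ^+ 2 * A = a + c * A - (a - b ^+ 2) - (c - e ^+ 2) * A by ring.
  by apply: vgeB => //; [exact: vgeB|exact: vgeMr].
have uOA := vge_horner O uA; have uEA := vge_horner E uA.
(* If O(A) is a unit, E(A) / O(A) is the root sought, signs being irrelevant modulo 2. Otherwise
   E(A) and O(A) both vanish in the residue field, and whichever of E and O has an odd coefficient
   is a shorter equation for A. *)
have [uO|uO] := boolP (vge u 1 (map_poly intr O).[A]); last first.
  have O0 : (map_poly intr O).[A] != 0 by apply: contraNneq uO => ->; exact: vge0.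
  have uO0 : u (map_poly intr O).[A] = 0.
    by move: uO uOA; rewrite !vgeP //; lia.
  exists ((map_poly intr E).[A] / (map_poly intr O).[A]).
    by rewrite vge_div // uO0.
  move: up'; set e := _.[A]; set o := (map_poly intr O).[A] in O0 uO0 * => up'.
  have -> : (e / o) ^+ 2 - A = (e ^+ 2 + o ^+ 2 * A) / o ^+ 2 - 2%:R * A by field.
  apply: vgeB => //; last exact: vgeMr.
  by rewrite vge_div ?expf_neq0 // (valX uP) uO0 mul0rn addr0.
have uE : vge u 1 (map_poly intr E).[A].
  have : vge u 1 ((map_poly intr E).[A] ^+ 2).
    have := vgeB uP up' (vgeMr uP (vgeMr uP uO (vge_horner O uA)) uA).
    by rewrite expr2 addrK.
  have [->|e0] := eqVneq (map_poly intr E).[A] 0; first by rewrite vge0.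
  by rewrite !vgeP ?expf_neq0 // (valX uP); exact: pos.
have p0 : (0 < size p)%N by rewrite lt0n size_poly_eq0; apply: contraNneq pk => ->; rewrite coef0.
have [/eqP sp1|sp1] := eqVneq (size p) 1%N.
  move/eqP/eq_leq/size1_polyC: sp1 => pC; move: up pk; rewrite pC map_polyC hornerC /=.
  case: k => [|k]; rewrite coefC //= => up pk.
  by have := vge_int_odd pk; rewrite up.
case kodd: (odd k).
  apply: (IH O) => //; last by rewrite (leq_ltn_trans (size_odd_poly _)) // half_lt.
  exists k./2; rewrite coef_odd_poly -[k./2.*2.+1]/(1 + k./2.*2)%N.
  by have := odd_double_half k; rewrite kodd => ->.
apply: (IH E) => //; last by rewrite (leq_ltn_trans (size_even_poly _)) // uphalf_lt.
exists k./2; rewrite coef_even_poly.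
by have := odd_double_half k; rewrite kodd add0n => ->.
Qed.

End PerfectResidue.

Section UnramifiedSquareRoot.
Variables (W E : fieldType) (i : {rmorphism W -> algC}) (j : {rmorphism W -> E}).
Variable v : E -> int.
Hypotheses (dv : is_dvaluation v) (du : is_dvaluation (v \o j)).

(** Ramification index 1 provides a uniformizer in W: y can be made a unit, and then approximated
    from W one order at a time. Once y = q modulo 2, both y - q and y + q = (y - q) + 2 q are
    divisible by 2, so 4 divides y^2 - q^2 and d = q works. *)
Lemma unramified_sqrt (a : W) (y : E) : a != 0 -> y ^+ 2 = j a ->
  exists d, unramified_at (v \o j) d a.
Proof.
have natp (n : nat) : 0 <= n%:Z by [].
have leS (n : nat) : 1 + n%:Z <= n.+1%:Z by lia.
have leSm (n : nat) (k : int) : n.+1%:Z <= k -> n%:Z <= k by lia.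
have ge1 (k : int) : k != 0 -> 0 <= k -> 1 <= k by lia.
have nge (n : nat) (k : int) : n%:Z <= k -> ~~ (n.+1%:Z <= k) -> k = n%:Z by lia.
have pos (k : int) : 1 <= k *+ 2 -> 1 <= k by lia.
have vP := dvaluation_valuation dv; have uP := dvaluation_valuation du.
have W2 := char0_embed i 1; have W4 : (4%:R : W) != 0 := char0_embed i 3.
have [p p0 up] : exists2 p, p != 0 & v (j p) = 1.
  by case: (dval_surj du) => p; rewrite unitfE; exists p.
have pz0 k : p ^ k != 0 by rewrite expfz_neq0.
have upz k : v (j (p ^ k)) = k.
  rewrite -[LHS]/((v \o j) (p ^ k)).
  by case: k => k; rewrite /exprz ?(valV uP) (valX uP) /= up; lia.
wlog vy : a y / v y = 0.
  move=> wl a0 ya; have y0 : y != 0.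
    by apply: contraNneq a0 => y0; rewrite -(fmorph_eq0 j) -ya y0 expr0n.
  set k := v y; have [] := wl (a / (p ^ k) ^+ 2) (y / j (p ^ k)).
  - by rewrite (valF vP) ?fmorph_eq0 // upz subrr.
  - by rewrite mulf_neq0 ?invr_eq0 ?expf_neq0.
  - by rewrite expr_div_n ya rmorphM fmorphV rmorphXn.
  move=> d [d0 vd ed]; exists (d * p ^ k).
  have e : a / (d * p ^ k) ^+ 2 = a / (p ^ k) ^+ 2 / d ^+ 2.
    by field; rewrite d0 pz0.
  by split; rewrite ?e // mulf_neq0.
move=> a0 ya; have y0 : y != 0.
  by apply: contraNneq a0 => y0; rewrite -(fmorph_eq0 j) -ya y0 expr0n.
have ua : v (j a) = 0 by rewrite -ya (valX vP) vy.
set m := v (j 2%:R).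
have m0 : 0 <= m by have := val_nat_ge0 uP 2.
have u4 : v (j 4%:R) = m + m.
  by rewrite (natrM W 2 2) rmorphM (valM vP) ?fmorph_eq0.
have jge n x : vge (v \o j) n x = vge v n (j x) by rewrite /vge fmorph_eq0.
have vy0 : vge v 0 y by rewrite vgeP ?vy.
have jge0 x : v (j x) = 0 -> vge v 0 (j x) by move=> h; rewrite vge_val ?h.
have [m_eq0|m_neq0] := eqVneq m 0.
  exists 1; split; rewrite ?oner_neq0 // expr1n divr1 //.
  rewrite vge_div // /= u4 m_eq0 jge rmorphB rmorph1 vgeB // ?vge1 //.
  exact: jge0.
(* Write y = q + c t with c of value n < m. Then A = t^2 + (2 q / c) t lies in W and 2 q / c has
   positive value; if r^2 = A in the residue field then (t - r)^2 = 0 there, and q + c r is better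
   by one order. *)
have close (n : nat) : n%:Z <= m -> exists p, vge v n%:Z (y - j p).
  elim: n => [|n IH] nm; first by exists 0; rewrite rmorph0 subr0.
  have [q vq] := IH (leSm _ _ nm).
  have [vq1|nvq] := boolP (vge v n.+1%:Z (y - j q)); first by exists q.
  have yq0 : y - j q != 0 by apply: contraNneq nvq => ->; exact: vge0.
  have vyq : v (y - j q) = n%:Z by move: vq nvq; rewrite !vgeP //; exact: nge.
  have vq0 : vge v 0 (j q).
    rewrite -[j q](subKr y); apply: vgeB => //.
    exact: (vge_le (natp n) vq).
  have jc0 : j (p ^ n%:Z) != 0 by rewrite fmorph_eq0 pz0.
  have vc : v (j (p ^ n%:Z)) = n%:Z by exact: upz.
  move: (p ^ n%:Z) jc0 vc => c jc0 vc.
  have [t tE] : exists t, t = (y - j q) / j c by eexists.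
  have vt : vge v 0 t by rewrite tE vge_div // vc add0r.
  have v2q : vge v n.+1%:Z (j 2%:R * j q).
    by apply: vgeMr => //; rewrite vgeP ?fmorph_eq0.
  pose A := (a - q ^+ 2) / c ^+ 2.
  have jA : j A = t ^+ 2 + (j 2%:R * j q / j c) * t.
    rewrite /A tE rmorphM fmorphV rmorphB !rmorphXn -ya rmorph_nat; field.
    by rewrite jc0.
  have v2qc : vge v 1 (j 2%:R * j q / j c).
    by rewrite vge_div // vc; exact: (vge_le (leS n) v2q).
  have uA : vge (v \o j) 0 A.
    rewrite jge jA; apply: vgeD => //; first exact: vgeX.
    by apply: vgeM0 => //; exact: (vge_le _ v2qc).
  have u2 : vge (v \o j) 1 2%:R by rewrite jge vgeP ?fmorph_eq0 // ge1.
  have [r ur urA] := residue_sqrt uP u2 i uA.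
  rewrite jge in ur; rewrite jge rmorphB rmorphXn in urA.
  exists (q + c * r).
  have -> : y - j (q + c * r) = j c * (t - j r).
    by rewrite tE rmorphD rmorphM; field.
  rewrite -addn1 PoszD; apply: vgeM => //; first by rewrite vge_val ?vc.
  have : vge v 1 ((t - j r) ^+ 2).
    have -> : (t - j r) ^+ 2 = (j r ^+ 2 - j A) +
        (j 2%:R * j q / j c) * t + j 2%:R * (t * (t - j r)).
      by rewrite jA rmorph_nat; ring.
    apply: vgeD => //; first by apply: vgeD => //; exact: vgeMr.
    apply: vgeMr => //; first by rewrite -jge.
    by apply: vgeM0 => //; exact: vgeB.
  have [->|n0] := eqVneq (t - j r) 0; first by rewrite vge0.
  by rewrite !vgeP ?expf_neq0 // (valX vP); exact: pos.
have jm : `|m|%N%:Z = m by rewrite gez0_abs.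
have [|q vq] := close `|m|%N; first by rewrite jm.
rewrite jm in vq; have m1 : 1 <= m by exact: ge1.
have [q0 vq0] : j q != 0 /\ v (j q) = 0.
  have [] := @valDl _ v vP y (- (y - j q)) y0.
    by rewrite vgeN // vy add0r; exact: (vge_le m1 vq).
  by rewrite subKr vy.
exists q; split; first by rewrite -(fmorph_eq0 j).
  have ja0 : j a != 0 by rewrite fmorph_eq0.
  have q20 : j q ^+ 2 != 0 by rewrite expf_neq0.
  by rewrite /= fmorph_div rmorphXn /= (valF vP ja0 q20) (valX vP) vq0 ua.
have qn0 : q != 0 by rewrite -(fmorph_eq0 j).
have -> : (a / q ^+ 2 - 1) / 4%:R = (a - q ^+ 2) / q ^+ 2 / 4%:R by field; rewrite W4 qn0.
rewrite vge_div // vge_div ?expf_neq0 // jge rmorphB rmorphXn -ya subr_sqr /=.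
rewrite u4 rmorphXn (valX vP) vq0 mul0rn addr0 add0r; apply: vgeM => //.
have -> : y + j q = (y - j q) + j 2%:R * j q by rewrite rmorph_nat; ring.
apply: vgeD => //; apply: vgeMr; rewrite ?vge_val ?vq0 //.
Qed.

End UnramifiedSquareRoot.

Lemma unramified_at_restrict (W E : fieldType) (j : {rmorphism W -> E}) (v : E -> int)
    (u : W -> int) (e : int) (d a : W) : 0 < e -> (forall x, v (j x) = e * u x) ->
  unramified_at v (j d) (j a) <-> unramified_at u d a.
Proof.
move=> e0 vu; have jE : (j a / j d ^+ 2) = j (a / d ^+ 2) by rewrite fmorph_div rmorphXn.
have jE' : (j a / j d ^+ 2 - 1) / 4%:R = j ((a / d ^+ 2 - 1) / 4%:R).
  by rewrite jE [RHS]fmorph_div rmorphB rmorph1 rmorph_nat.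
have ve x : vge v 0 (j x) = vge u 0 x by rewrite /vge fmorph_eq0 vu pmulr_rge0.
have v0 x : v (j x) = 0 <-> u x = 0.
  by rewrite vu; split=> [/eqP|->]; rewrite ?mulr0 // mulf_eq0 gt_eqF // => /eqP.
rewrite /unramified_at jE' jE ve fmorph_eq0.
by split=> -[d0 vd ed]; split=> //; apply/v0.
Qed.

(** * Descent of unramified square classes along Galois sets *)

Section GaloisSets.
Variables (K : fieldType) (L : splittingFieldType K).
Local Notation gT := (gal_of {:L}).
Implicit Types (H T : {group gT}) (h : gT).

Definition gal_fixed (A : {set gT}) (x : L) : Prop := forall h, h \in A -> h x = x.

Lemma gal_fixedP (A : {set gT}) x : reflect (gal_fixed A x) (x \in fixedField A).
Proof. by apply: (iffP (fixedFieldP (memvf x))). Qed.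

Lemma galM_all (g h : gT) (x : L) : (g * h)%g x = h (g x).
Proof. exact: galM (memvf x). Qed.

Lemma gal1_all (x : L) : (1%g : gT) x = x. Proof. by rewrite gal_id ?memvf. Qed.

Lemma galVK (g : gT) (x : L) : (g^-1)%g (g x) = x.
Proof. by rewrite -galM_all mulgV gal1_all. Qed.

Lemma galKV (g : gT) (x : L) : g ((g^-1)%g x) = x.
Proof. by rewrite -galM_all mulVg gal1_all. Qed.

Section EquivariantChoice.
Variables (Y : finType) (to : {action gT &-> Y}) (H : {group gT}) (S : {set Y}).
Hypothesis HS : forall y h, y \in S -> h \in H -> to y h \in S.

Definition stab (y : Y) : {set gT} := [set h in H | to y h == y].

Fact stab_group_set y : group_set (stab y).
Proof.
apply/group_setP; split=> [|g h]; first by rewrite inE group1 act1 eqxx.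
rewrite !inE => /andP[gH /eqP gy] /andP[hH /eqP hy].
by rewrite groupM // actM gy hy eqxx.
Qed.
Canonical stab_group y := Group (stab_group_set y).

(** The choice is made at one representative of each orbit and transported by H; invariance under
    the stabilizer makes the result independent of the transporting element. *)
Lemma equivariant_choice (Q : Y -> L -> Prop) :
  (forall y x h, y \in S -> h \in H -> Q y x -> Q (to y h) (h x)) ->
  (forall y, y \in S -> exists x, Q y x /\ gal_fixed (stab y) x) ->
  exists F : Y -> L, forall y, y \in S ->
    Q y (F y) /\ forall h, h \in H -> F (to y h) = h (F y).
Proof.
move=> Qh ex; pose rep y := odflt y [pick z in orbit to H y].
have repP y : rep y \in orbit to H y.
  by rewrite /rep; case: pickP => //= _; exact: orbit_refl.
have rep_act y h : h \in H -> rep (to y h) = rep y.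
  move=> hH; have oE : orbit to H (to y h) = orbit to H y by apply: orbit_act.
  rewrite /rep; under eq_pick => z do rewrite oE.
  by case: pickP => //= /(_ y); rewrite orbit_refl.
have exg y : exists g, g \in H /\ to (rep y) g = y.
  have /orbitP[g gH gE] : y \in orbit to H (rep y) by rewrite orbit_sym.
  by exists g.
have [g gP] := choice exg.
have repS y : y \in S -> rep y \in S.
  by case/orbitP: (repP y) => h hH <- /HS; apply.
have exX y : exists x, y \in S -> Q y x /\ gal_fixed (stab y) x.
  have [/ex[x xP]|yS] := boolP (y \in S); first by exists x.
  by exists 0 => //; rewrite (negPf yS).
have [X XP] := choice exX.
exists (fun y => g y (X (rep y))) => y yS; have [gH gE] := gP y.
have [QX fX] := XP _ (repS _ yS); split.
  by rewrite -{1}gE; apply: Qh => //; exact: repS.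
move=> h hH; rewrite rep_act // -galM_all; have [gH' gE'] := gP (to y h).
rewrite rep_act // in gE'.
have : (g (to y h) * (g y * h)^-1)%g \in stab (rep y).
  rewrite inE groupM ?groupV ?groupM //= actM gE'.
  have -> : to y h = to (rep y) (g y * h)%g by rewrite actM gE.
  by rewrite actK.
move/fX => /(congr1 (g y * h)%g); rewrite -galM_all => <-.
by rewrite mulgKV.
Qed.

End EquivariantChoice.

(** For a generator z of L over L^H, the element t z is a root of the image under s of the minimal
    polynomial of z, and these roots are the s (c z) with c in H. With t the complex conjugate of s,
    this realizes complex conjugation inside H. *)
Lemma gal_embedding (H : {group gT}) (F : fieldType) (s t : {rmorphism L -> F}) :
  (forall x, gal_fixed H x -> s x = t x) ->
  exists2 c, c \in H & forall x, t x = s (c x).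
Proof.
move=> st; pose M := fixedField H.
have galM : galois M {:L} by exact: fixedField_galois.
have /and3P[sM sepM nM] := galM.
pose z := separable_generator M {:L}.
have genz : {:L}%VS = <<M; z>>%VS by exact: eq_adjoin_separable_generator.
have [r Hr pE] := normalField_factors sM nM z (memvf z).
have mapst : map_poly s (minPoly M z) = map_poly t (minPoly M z).
  apply/polyP => i; rewrite !coef_map; apply: st; apply/gal_fixedP.
  exact: (polyOverP (minPolyOver M z)).
have : root (map_poly t (minPoly M z)) (t z) by rewrite fmorph_root root_minPoly.
rewrite -mapst pE rmorph_prod /= (eq_bigr (fun x : gT => 'X - (s (x z))%:P)); last first.
  by move=> x _; rewrite map_polyXsubC.
rewrite -(big_map (fun x : gT => s (x z)) xpredT (fun a => 'X - a%:P)) root_prod_XsubC.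
case/mapP => c cr tz.
have cH : c \in H by have := fintype.subsetP Hr c cr; rewrite gal_fixedField.
exists c => //; have cfix x : x \in M -> c x = x by move/gal_fixedP; apply.
move=> x; have /Fadjoin_polyP[p Mp ->] : x \in <<M; z>>%VS by rewrite -genz memvf.
rewrite -!horner_map /= -tz; congr (_.[_]); apply/polyP=> i; rewrite !coef_map /=.
have Mi : p`_i \in M by apply: (polyOverP Mp).
by rewrite cfix //; apply/esym/st/gal_fixedP.
Qed.

(** Unramifiedness of the class of a over L^A, tested at the valuations of L. Requiring d in L^A,
    and positivity at embeddings that are real on L^A only, is what keeps track of the ramification
    of L over L^A. *)
Definition unramified_over (A : {set gT}) (a : L) : Prop :=
  [/\ gal_fixed A a, a != 0,
   forall w : L -> int, is_dvaluation w ->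
     exists d, gal_fixed A d /\ unramified_at w d a &
   forall s : {rmorphism L -> algC},
     (forall x, gal_fixed A x -> s x \is Num.real) -> 0 < s a].

Lemma unramified_overS (A B : {set gT}) a : A \subset B ->
  unramified_over B a -> unramified_over A a.
Proof.
move=> /fintype.subsetP AB [fa a0 fin inf].
have fx x : gal_fixed B x -> gal_fixed A x by move=> fB h /AB; apply: fB.
split=> // [|w /fin[d [fd ud]]|s sr]; first exact: fx.
  by exists d; split=> //; exact: fx.
by apply: inf => x /fx/sr.
Qed.

Lemma dvaluation_gal (w : L -> int) (g : gT) : is_dvaluation w ->
  is_dvaluation (fun x => w (g x)).
Proof.
move=> dw; have wP := dvaluation_valuation dw.
apply: valuation_dvaluation; first split.
- by rewrite rmorph0 (val0 wP).
- by move=> x y x0 y0; rewrite rmorphM (valM wP) ?fmorph_eq0.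
- move=> x y x0 y0 xy0; rewrite rmorphD; case: wP => _ _ + _; apply; rewrite -?rmorphD ?fmorph_eq0 //.
- by have [x ux wx] := dval_surj dw; exists (g^-1 x)%g; rewrite ?galKV ?wx // fmorph_eq0 -unitfE.
- by have [x ux wx] := dval_surj dw; exists (g^-1 x)%g; rewrite ?galKV ?wx // fmorph_eq0 -unitfE.
Qed.

Lemma unramified_at_gal (w : L -> int) (g : gT) d a :
  unramified_at (fun x => w (g x)) d a <-> unramified_at w (g d) (g a).
Proof.
apply: iff_sym; apply: (@unramified_at_restrict L L g w (fun x => w (g x)) 1) => // x.
by rewrite mul1r.
Qed.

End GaloisSets.

(** A point and its distinct image contribute together a squared modulus, so only fixed points need
    a sign condition. *)
Lemma prod_conj_gt0 (Y : finType) (t : Y -> Y) (S : {set Y}) (f : Y -> algC) :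
  (forall y, y \in S -> [/\ t y \in S, t (t y) = y, f (t y) = (f y)^* & f y != 0]) ->
  (forall y, y \in S -> t y = y -> 0 < f y) -> 0 < \prod_(y in S) f y.
Proof.
have [n] := ubnP #|S|; elim: n S => // n IH S Sn St Sf.
have [->|/set0Pn[y yS]] := eqVneq S finset.set0; first by rewrite big_set0 ltr01.
have [tyS tty fty fy0] := St y yS; pose A := [set y; t y].
have AS : A \subset S by rewrite finset.subUset !finset.sub1set yS.
rewrite (big_setID A) (finset.setIidPr AS) /= mulr_gt0 //.
  rewrite /A; have [tE|tE] := eqVneq (t y) y; first by rewrite tE finset.setUid big_set1 Sf.
  rewrite big_setU1 /=; last by rewrite inE eq_sym.
  by rewrite big_set1 fty -normCK exprn_gt0 // normr_gt0.
apply: IH.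
- rewrite -ltnS (leq_trans _ Sn) // ltnS; apply: proper_card.
  by apply/properP; split; [exact: finset.subsetDl|exists y; rewrite // !inE eqxx].
- move=> z /finset.setDP[zS]; rewrite !inE negb_or => /andP[zy zty]; have [tzS ttz ftz fz0] := St z zS.
  split=> //; rewrite tzS andbT negb_or.
  apply/andP; split; first by apply: contraNneq zty => <-; rewrite ttz.
  by apply: contraNneq zy => tzE; rewrite -ttz tzE tty.
- by move=> z; rewrite inE => /andP[_ zS]; exact: Sf.
Qed.

(** * Unramified elements under products over orbits *)

Section NormUnramified.
Variables (K : fieldType) (L : splittingFieldType K) (iL : {rmorphism L -> algC}).
Local Notation gT := (gal_of {:L}).

Lemma splitting_algebraic (W : fieldType) (j : {rmorphism W -> L}) :
  (forall k : K, exists w, j w = k%:A) -> forall x : L, exists p : {poly W},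
  [/\ p != 0, (size p <= (\dim {:L}).+1)%N & root (map_poly j p) x].
Proof.
move=> jK x; have [h hP] := choice jK.
pose m := minPoly 1%AS x.
have ex i : exists k : K, m`_i = k%:A.
  have /vlineP[k ->] : m`_i \in 1%VS by apply: (polyOverP (minPolyOver 1%AS x)).
  by exists k.
have [k kE] := choice ex.
pose p := \poly_(i < size m) h (k i).
have pE : map_poly j p = m.
  apply/polyP => i; rewrite coef_map coef_poly /=; case: ltnP => ltm; first by rewrite hP kE.
  by rewrite rmorph0 nth_default.
have sp : size p = size m by rewrite -(size_map_poly j) pE.
exists p; split.
- by rewrite -size_poly_eq0 sp size_minPoly.
- rewrite sp size_minPoly ltnS adjoin_degreeE dimv1 divn1.
  exact: dimvS (subvf _).
- by rewrite pE root_minPoly.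
Qed.

Section Product.
Variables (Y : finType) (to : {action gT &-> Y}) (H : {group gT}) (S : {set Y}).
Hypothesis HS : forall y h, y \in S -> h \in H -> to y h \in S.

(** The witness at w is a product of witnesses d y that H must permute like the F y, so each d y has
    to be good at w composed with every h in H. These valuations restrict to finitely many ones of
    the fixed field of the stabilizer of y, where weak approximation merges their witnesses. At an
    embedding that is real on L^H, complex conjugation is an involution in H that pairs the
    factors. *)
Lemma unramified_over_prod (F : Y -> L) :
  (forall y h, y \in S -> h \in H -> F (to y h) = h (F y)) ->
  (forall y, y \in S -> unramified_over (stab to H y) (F y)) ->
  unramified_over H (\prod_(y in S) F y).
Proof.
move=> FH FU.
have prodH (G : Y -> L) : (forall y h, y \in S -> h \in H -> G (to y h) = h (G y)) ->
    gal_fixed H (\prod_(y in S) G y).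
  move=> GH h hH; rewrite rmorph_prod /=.
  rewrite [RHS](reindex_inj (act_inj to h)) /=; apply: eq_big => y.
    apply/idP/idP => [yS|/HS]; first exact: HS.
    by move/(_ h^-1%g); rewrite groupV => /(_ hH); rewrite actK.
  by move=> yS; rewrite GH.
split; first exact: prodH.
- by apply/prodf_neq0 => y /FU[].
- move=> w dw; have wP := dvaluation_valuation dw.
  have [|y yS|d dP] := @equivariant_choice K L Y to H S HS
    (fun y d => forall h, h \in H -> unramified_at w (h d) (h (F y))).
  + move=> y x h yS hH Q k kH; rewrite FH // -!galM_all; apply: Q.
    exact: groupM.
  + have [fF F0 finF _] := FU y yS.
    pose M := fixedField (stab to H y).
    pose W : fieldType := subvs_of M.
    pose j : {rmorphism W -> L} := vsval.
    have fj x : gal_fixed (stab to H y) (j x) by apply/gal_fixedP; exact: subvsP.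
    have jf x : gal_fixed (stab to H y) x -> exists a, j a = x.
      by move/gal_fixedP => Mx; exists (Subvs Mx).
    have alg x : algebraicOver j x.
      have [k|p [p0 _ rp]] := @splitting_algebraic W j _ x; last by exists p.
      by apply: jf => h _; rewrite linearZ /= rmorph1.
    have exu (h : gT) : exists eu : int * (W -> int), [/\ 0 < eu.1, is_dvaluation eu.2 &
        forall x, w (h (j x)) = eu.1 * eu.2 x].
      have [e [u [e0 du we]]] := dvaluation_restrict alg (dvaluation_gal h dw).
      by exists (e, u).
    have [eu euP] := choice exu.
    have [a aE] := jf _ fF; have a0 : a != 0 by rewrite -(fmorph_eq0 j) aE.
    pose s : seq {classic (W -> int)} := [seq (eu h).2 | h <- enum H].
    have exd (u : {classic (W -> int)}) : exists d : W, u \in s -> is_dvaluation u /\ unramified_at u d a.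
      have [/mapP[h hH ->]|us] := boolP (u \in s); last by exists 0.
      have [e0 du we] := euP h.
      have [d [fd ud]] := finF _ (dvaluation_gal h dw); have [d' d'E] := jf _ fd.
      exists d' => _; split=> //.
      by apply/(@unramified_at_restrict W L j (fun x => w (h x)) _ _ d' a e0 we); rewrite d'E aE.
    have [d dP] := choice exd.
    (* This precision is at least u 4 + 1 for each u of the list, as [unramified_at_near]
       demands. *)
    have [x xP] := @weak_approximation W s (\sum_(u <- s) `|((u : {classic (W -> int)}) 4%:R + 1)%R|)%N d
      (fun u us => let: conj du (And3 d0 _ _) := dP u us in conj du d0).
    have W2 : (2%:R : W) != 0 by rewrite -(fmorph_eq0 (iL \o j)) rmorph_nat pnatr_eq0.
    exists (j x); split; last exact: fj.
    move=> h hH; apply/unramified_at_gal; have [e0 du we] := euP h.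
    rewrite -aE; apply/(@unramified_at_restrict W L j (fun x => w (h x)) _ _ x a e0 we).
    have us : ((eu h).2 : {classic (W -> int)}) \in s.
      by apply: map_f; rewrite mem_enum.
    have [_ ud] := dP _ us; have uP := dvaluation_valuation du.
    apply: (unramified_at_near uP W2 a0 ud); apply: (vge_le _ (xP _ us)).
    rewrite (big_rem _ us) /= PoszD; apply: (le_trans (ler_norm _)).
    by rewrite -abszE lerDl.
  exists (\prod_(y in S) d y); split.
    by apply: prodH => y h yS hH; case: (dP y yS) => _; apply.
  apply: unramified_at_prod => //; first by rewrite -(fmorph_eq0 iL) rmorph_nat pnatr_eq0.
  move=> y yS; have [_ F0 _ _] := FU y yS; split=> //.
  by have [/(_ 1%g (group1 H)) + _] := dP y yS; rewrite !gal1_all.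
- move=> s sr; rewrite rmorph_prod /=.
  pose conjs : {rmorphism L -> algC} := Num.conj \o s.
  have [x /sr/CrealP|c cH cE] := @gal_embedding K L H algC s conjs; first by [].
  have c2 x : c (c x) = x.
    by apply: (fmorph_inj s); rewrite -cE /= -cE /= conjCK.
  apply: (@prod_conj_gt0 _ (to^~ c)) => y yS.
    have [_ F0 _ _] := FU y yS.
    split; [exact: HS| |by rewrite FH // -cE|by rewrite fmorph_eq0].
    rewrite -actM; suff -> : (c * c)%g = 1%g by rewrite act1.
    by apply/eqP/gal_eqP => x _; rewrite galM_all c2 gal1_all.
  move=> yc; have [_ _ _] := FU y yS; apply=> x fx; apply/CrealP.
  by rewrite -[LHS]/(conjs x) cE fx // inE cH yc eqxx.
Qed.

End Product.
End NormUnramified.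

Section Descent.
Variables (K : fieldType) (L : splittingFieldType K) (iL : {rmorphism L -> algC}).
Local Notation gT := (gal_of {:L}).
Implicit Types (H T : {group gT}).

Lemma unramified_overM (A : {set gT}) a b :
  unramified_over A a -> unramified_over A b -> unramified_over A (a * b).
Proof.
case=> fa a0 fina infa [fb b0 finb infb]; split.
- by move=> h hA; rewrite rmorphM /= fa // fb.
- exact: mulf_neq0.
- move=> w dw; have [d [fd ud]] := fina w dw; have [e [fe ue]] := finb w dw.
  exists (d * e); split; first by move=> h hA; rewrite rmorphM /= fd // fe.
  apply: unramified_atM => //; first exact: dvaluation_valuation.
  by rewrite -(fmorph_eq0 iL) rmorph_nat pnatr_eq0.
- by move=> s sr; rewrite rmorphM mulr_gt0 ?infa ?infb.
Qed.

Lemma gal_fixedJ (A : {set gT}) g x : gal_fixed (A :^ g)%g x <-> gal_fixed A (g^-1 x)%g.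
Proof.
split=> fx h hA.
  have := fx (h ^ g)%g; rewrite memJ_conjg => /(_ hA).
  by rewrite conjgE !galM_all => /(congr1 (g^-1)%g); rewrite galVK.
have : (h ^ g^-1)%g \in A by rewrite -mem_conjg.
move/fx; rewrite conjgE invgK !galM_all => /(congr1 g); rewrite galKV.
by rewrite !galKV.
Qed.

Lemma unramified_over_conj (A : {set gT}) g a :
  unramified_over A a -> unramified_over (A :^ g)%g (g a).
Proof.
case=> fa a0 fin inf; split.
- by apply/gal_fixedJ; rewrite galVK.
- by rewrite fmorph_eq0.
- move=> w dw; have [d [fd ud]] := fin _ (dvaluation_gal g dw).
  exists (g d); split; first by apply/gal_fixedJ; rewrite galVK.
  exact/unramified_at_gal.
- move=> s sr; apply: (inf (s \o g)) => x fx /=; apply: sr.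
  by apply/gal_fixedJ; rewrite galVK.
Qed.

(** For T a subgroup of H and a T-fixed x, this is the norm from L^T to L^H. *)
Definition coset_prod (T H : {set gT}) (x : L) : L := \prod_(C in rcosets T H) (fingroup.repr C) x.

Section CosetProd.
Variables (T H : {group gT}) (x : L).
Hypotheses (TH : T \subset H) (fx : gal_fixed T x).

Lemma coset_repr_gal (C : {set gT}) (g : gT) : C \in rcosets T H -> g \in C -> g x = fingroup.repr C x.
Proof.
case/rcosetsP => k kH -> gC; have rC := mem_repr_rcoset T k.
case/rcosetP: gC => t tT ->; case/rcosetP: rC => t' t'T ->.
by rewrite !galM_all (fx tT) (fx t'T).
Qed.

Lemma coset_act_repr (C : {set gT}) h : C \in rcosets T H -> h \in H ->
  fingroup.repr (C :* h)%g x = h (fingroup.repr C x).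
Proof.
move=> CT hH; have CT' : (C :* h)%g \in rcosets T H.
  by case/rcosetsP: CT => k kH ->; apply/rcosetsP; exists (k * h)%g; rewrite ?groupM ?rcosetM.
rewrite -galM_all; apply/esym/coset_repr_gal => //.
apply/rcosetP; exists (fingroup.repr C) => //; case/rcosetsP: CT => k _ ->; exact: mem_repr_rcoset.
Qed.

Lemma coset_actS (C : {set gT}) h : C \in rcosets T H -> h \in H ->
  ('Rs%act C h) \in rcosets T H.
Proof.
case/rcosetsP => k kH -> hH; apply/rcosetsP; exists (k * h)%g; rewrite ?groupM //.
by rewrite /= rcosetE rcosetM.
Qed.

(** The norm is a product over the cosets of T, on which H acts by translation. The stabilizer of T
    g lies in the conjugate of T by g, over which g x is unramified. *)
Lemma coset_prod_unramified : unramified_over T x ->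
  unramified_over H (coset_prod T H x).
Proof.
move=> ux; apply: (unramified_over_prod iL (to := 'Rs%act)).
- exact: coset_actS.
- by move=> C h CT hH; rewrite /= rcosetE coset_act_repr.
- move=> C CT; apply: (@unramified_overS _ _ _ (T :^ fingroup.repr C)%g); last exact: unramified_over_conj.
  apply/fintype.subsetP => h; rewrite inE => /andP[hH /eqP]; rewrite /= rcosetE => Ch.
  have CE : C = (T :* fingroup.repr C)%g.
    by case/rcosetsP: CT => k kH ->; apply/esym/rcoset_eqP/mem_repr_rcoset.
  have rCh : (fingroup.repr C * h)%g \in (C :* h)%g.
    by apply/rcosetP; exists (fingroup.repr C) => //; case/rcosetsP: CT => k _ ->; exact: mem_repr_rcoset.
  by move: rCh; rewrite Ch mem_conjg conjgE invgK mulgA -mem_rcoset -CE.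
Qed.

Lemma coset_prod_fixed : gal_fixed H (coset_prod T H x).
Proof.
move=> h hH; rewrite /coset_prod rmorph_prod /=.
rewrite [RHS](reindex_inj (act_inj 'Rs%act h)) /=; apply: eq_big => C.
  apply/idP/idP => [CT|]; first exact: coset_actS.
  by move/coset_actS => /(_ h^-1%g); rewrite groupV => /(_ hH); rewrite /= -[X in X \in _ -> _]/('Rs%act ('Rs%act C h) h^-1%g) actK.
by move=> CT; rewrite /= rcosetE coset_act_repr.
Qed.

End CosetProd.
End Descent.

Definition sqeq (R : fieldType) (x y : R) : Prop := exists2 d, d != 0 & x = y * d ^+ 2.

Section SqEq.
Variable R : fieldType.
Implicit Types x y z : R.

Lemma sqeq_refl x : sqeq x x.
Proof. by exists 1; rewrite ?oner_neq0 // expr1n mulr1. Qed.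

Lemma sqeq_sym x y : sqeq x y -> sqeq y x.
Proof.
by case=> d d0 ->; exists d^-1; rewrite ?invr_eq0 // -mulrA -exprMn divff // expr1n mulr1.
Qed.

Lemma sqeq_trans y x z : sqeq x y -> sqeq y z -> sqeq x z.
Proof.
by case=> d d0 -> [e e0 ->]; exists (e * d); rewrite ?mulf_neq0 // -mulrA -exprMn.
Qed.

Lemma sqeqM x y x' y' : sqeq x y -> sqeq x' y' -> sqeq (x * x') (y * y').
Proof.
by case=> d d0 -> [e e0 ->]; exists (d * e); rewrite ?mulf_neq0 // mulrACA exprMn.
Qed.

Lemma sqeq_prod I (r : seq I) (P : pred I) (f g : I -> R) :
  (forall i, P i -> sqeq (f i) (g i)) ->
  sqeq (\prod_(i <- r | P i) f i) (\prod_(i <- r | P i) g i).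
Proof.
move=> fg; elim/big_rec2: _ => [|i x y Pi xy]; first exact: sqeq_refl.
by apply: sqeqM => //; exact: fg.
Qed.

Lemma sqeq_exp_odd x n : x != 0 -> odd n -> sqeq (x ^+ n) x.
Proof.
move=> x0 on; exists (x ^+ n./2); first exact: expf_neq0.
by rewrite -exprM muln2 -exprS -[X in _ ^+ X](odd_double_half n) on.
Qed.

End SqEq.

(** * Descent to the stabilizer of a root through an odd index *)

Section OddDescent.
Variables (K : fieldType) (L : splittingFieldType K) (iL : {rmorphism L -> algC}).
Local Notation gT := (gal_of {:L}).

Lemma sqeq_gal (g : gT) x y : sqeq x y -> sqeq (g x) (g y).
Proof. by case=> d d0 ->; exists (g d); rewrite ?fmorph_eq0 // rmorphM rmorphXn. Qed.

Lemma rcosets_repr (T H : {group gT}) (C : {set gT}) : T \subset H ->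
  C \in rcosets T H -> fingroup.repr C \in H.
Proof.
move=> TH /rcosetsP[k kH ->]; have /rcosetP[t tT ->] := mem_repr_rcoset T k.
by rewrite groupM // (fintype.subsetP TH).
Qed.

Variables (Y : finType) (to : {action gT &-> Y}).
Hypothesis Yodd : odd #|Y|.
Hypothesis free2 : forall (t : gT) (y z : Y), (2.-elt t)%g -> t != 1%g ->
  to y t = y -> to z t = z -> y = z.
Local Notation G := [set: gT]%G.

Section AtPoint.
Variables (a : Y) (T : {group gT}).
Hypothesis T_Syl : (2.-Sylow(stab to G a) T)%g.

Let TH : T \subset stab to G a. Proof. by case/and3P: T_Syl. Qed.

Lemma sylow_fix t : t \in T -> to a t = a.
Proof. by move/(fintype.subsetP TH); rewrite inE => /andP[_ /eqP]. Qed.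

Lemma sylow_stable y h : y \in [set~ a] -> h \in T -> to y h \in [set~ a].
Proof.
rewrite !inE => ya hT; apply: contra ya => /eqP e.
by rewrite -(inj_eq (act_inj to h)) e (sylow_fix hT).
Qed.

Lemma sylow_stab1 y : y \in [set~ a] -> stab to T y = 1%g.
Proof.
rewrite !inE => ya; apply/setP => t; rewrite !inE; apply/andP/eqP => [[tT /eqP ty]|->].
  apply/eqP; apply: contraTT isT => t1; move: ya; rewrite (@free2 t y a) ?eqxx //.
    by apply: mem_p_elt tT; case/and3P: T_Syl.
  exact: sylow_fix.
by rewrite group1 act1.
Qed.

Lemma gal_fixed1 x : gal_fixed (1%g : {set gT}) x.
Proof. by move=> h /set1gP ->; rewrite gal1_all. Qed.

Lemma sylow_index_odd : odd #|stab to G a : T|%g.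
Proof. by rewrite odd_2'nat; case/and3P: T_Syl. Qed.

Lemma prod_point (F : Y -> L) : \prod_y F y = F a * \prod_(y in [set~ a]) F y.
Proof. by rewrite (bigD1 a) //=; congr (_ * _); apply: eq_bigl => y; rewrite !inE. Qed.

(** Every factor is in the class of b, and the number of factors is odd. *)
Lemma coset_prod_sqeq (x b : L) : b != 0 -> (forall h, h \in stab to G a -> sqeq (h x) b) ->
  sqeq (coset_prod T (stab to G a) x) b.
Proof.
move=> b0 xb; apply: (@sqeq_trans _ (b ^+ #|stab to G a : T|%g)); last first.
  by apply: sqeq_exp_odd => //; exact: sylow_index_odd.
rewrite /indexg -prodr_const; apply: sqeq_prod => C CT; apply: xb.
exact: (@rcosets_repr T (stab_group to G a)).
Qed.

(** T acts freely off a, so square roots of the other F y can be chosen T-equivariantly; k divided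
    by their product is a T-fixed root of F a. Its norm to the field fixed by the stabilizer of a is
    a root of F a ^ m with m odd, and F a belongs to that field, so the surplus F a ^ (m - 1) can be
    divided out. *)
Lemma descend_square (F : Y -> L) (k : L) :
  (forall y h, F (to y h) = h (F y)) -> (forall y, F y != 0) ->
  (forall y, exists c, c ^+ 2 = F y) -> gal_fixed G k -> \prod_y F y = k ^+ 2 ->
  exists2 c, gal_fixed (stab to G a) c & c ^+ 2 = F a.
Proof.
move=> FH F0 Fsq fk Fk.
have [|y yS|c cP] := @equivariant_choice K L Y to T [set~ a] sylow_stable (fun y x => x ^+ 2 = F y).
- by move=> y x h _ _ xy; rewrite FH -xy rmorphXn.
- by have [x xP] := Fsq y; exists x; split=> //; rewrite sylow_stab1 //; exact: gal_fixed1.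
pose P := \prod_(y in [set~ a]) c y.
have fP : gal_fixed T P.
  move=> h hT; rewrite /P rmorph_prod /= [RHS](reindex_inj (act_inj to h)) /=.
  apply: eq_big => y; last by move=> yS; case: (cP y yS) => _ ->.
  apply/idP/idP => [yS|/sylow_stable]; first exact: sylow_stable.
  by move/(_ h^-1%g); rewrite groupV => /(_ hT); rewrite actK.
have P2 : P ^+ 2 = \prod_(y in [set~ a]) F y.
  by rewrite -prodrXl; apply: eq_bigr => y /cP[].
have P0 : P != 0.
  by apply/prodf_neq0 => y /cP[e _]; apply: contraNneq (F0 y) => c0; rewrite -e c0 expr0n.
pose x := k / P; have fx : gal_fixed T x.
  by move=> h hT; rewrite rmorphM fmorphV /= fP // fk ?inE.
have x2 : x ^+ 2 = F a.
  by rewrite expr_div_n -Fk prod_point -P2 mulfK ?expf_neq0.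
have fFa : gal_fixed (stab to G a) (F a).
  by move=> h; rewrite inE => /andP[_ /eqP ha]; rewrite -FH ha.
set m := #|stab to G a : T|%g; have om : odd m := sylow_index_odd.
exists (coset_prod T (stab to G a) x / F a ^+ m./2).
  move=> h hS; rewrite rmorphM fmorphV rmorphXn /= (fFa h hS); congr (_ / _).
  exact: (@coset_prod_fixed _ _ T (stab_group to G a) x fx).
rewrite expr_div_n -exprM muln2 /coset_prod -prodrXl.
rewrite (eq_bigr (fun=> F a)).
  rewrite prodr_const -/(indexg _ _) -/m -[X in _ ^+ X / _](odd_double_half m) om.
  by rewrite exprS mulfK ?expf_neq0.
move=> C CT; rewrite -rmorphXn /= x2 fFa //.
exact: (@rcosets_repr T (stab_group to G a)).
Qed.

Lemma descend_class (b : Y -> L) : (forall y, b y != 0) ->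
  (forall y h, sqeq (b (to y h)) (h (b y))) -> (forall y, unramified_over 1%g (b y)) ->
  sqeq (\prod_y b y) 1 ->
  exists x, unramified_over (stab to G a) x /\ sqeq x (b a).
Proof.
move=> b0 bH bU b1.
have [|y yS|c cP] := @equivariant_choice K L Y to T [set~ a] sylow_stable
  (fun y x => sqeq x (b y) /\ unramified_over 1%g x).
- move=> y x h _ _ [xy ux]; split; last by rewrite -(conjs1g h); exact: unramified_over_conj.
  by apply: (sqeq_trans (sqeq_gal h xy)); exact/sqeq_sym.
- exists (b y); split; first by split; [exact: sqeq_refl|].
  by rewrite sylow_stab1 //; exact: gal_fixed1.
pose x := \prod_(y in [set~ a]) c y.
have ux : unramified_over T x.
  apply: (unramified_over_prod iL sylow_stable) => [y h /cP[_]|y yS]; first by apply.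
  by rewrite sylow_stab1 //; case: (cP y yS) => -[].
have xb : sqeq x (b a).
  apply: (@sqeq_trans _ (\prod_(y in [set~ a]) b y)).
    by apply: sqeq_prod => y /cP[[]].
  have ba0 := b0 a; case: b1 => d d0; rewrite prod_point mul1r => dE.
  exists (d / b a); first by rewrite mulf_neq0 ?invr_eq0.
  by rewrite expr_div_n -dE; field.
exists (coset_prod T (stab to G a) x); split.
  apply: (@coset_prod_unramified _ _ iL T (stab_group to G a)) => //.
  by case: ux.
apply: coset_prod_sqeq => // h; rewrite inE => /andP[_ /eqP ha].
apply: (sqeq_trans (sqeq_gal h xb)); apply/sqeq_sym.
by rewrite -{1}ha; exact: bH.
Qed.

End AtPoint.

Lemma descend_classes (b : Y -> L) : (forall y, b y != 0) ->
  (forall y h, sqeq (b (to y h)) (h (b y))) -> (forall y, unramified_over 1%g (b y)) ->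
  sqeq (\prod_y b y) 1 ->
  exists F : Y -> L, [/\ forall y h, F (to y h) = h (F y),
    forall y, unramified_over (stab to G y) (F y) /\ sqeq (F y) (b y) &
    exists2 k, gal_fixed G k & \prod_y F y = k ^+ 2].
Proof.
move=> b0 bH bU b1.
have stable y h : y \in [set: Y] -> h \in G -> to y h \in [set: Y] by rewrite inE.
have [|y yS|c cP] := @equivariant_choice K L Y to G [set: Y] stable
  (fun y x => unramified_over (stab to G y) x /\ sqeq x (b y)).
- move=> y x h _ _ [ux xb]; split; last first.
    by apply: (sqeq_trans (sqeq_gal h xb)); exact/sqeq_sym.
  suff -> : stab to G (to y h) = (stab to G y :^ h)%g by exact: unramified_over_conj.
  apply/setP => g; rewrite mem_conjg !inE /= conjgE invgK !actM.
  by rewrite -[in RHS](inj_eq (act_inj to h)) actKV.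
- have [T T_Syl] := Sylow_exists 2 (stab_group to G y).
  have [x [ux xb]] := descend_class T_Syl b0 bH bU b1.
  by exists x; split=> //; case: ux.
pose N := \prod_y c y.
have NE : N = \prod_(y in [set: Y]) c y by apply: eq_bigl => y; rewrite inE.
have cP' y : [/\ unramified_over (stab to G y) (c y), sqeq (c y) (b y) &
    forall h, c (to y h) = h (c y)].
  by have [[ux xb] ch] := cP y (finset.in_setT y); split=> // h; apply: ch; rewrite inE.
have UN : unramified_over G N.
  rewrite NE; apply: (unramified_over_prod iL stable) => [y h _ _|y _].
    by case: (cP' y).
  by case: (cP' y).
have N1 : sqeq N 1.
  by apply: (sqeq_trans _ b1); apply: sqeq_prod => y _; case: (cP' y).
(* The factor N repairs the norm: the product of all c y * N is N^(|Y| + 1), an even power. The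
   classes do not change, because N is equivalent to the product of the b y and hence a square in
   L. *)
exists (fun y => c y * N); split.
- move=> y h; rewrite rmorphM /=; case: (cP' y) => _ _ ->.
  by case: UN => fN _ _ _; rewrite fN // inE.
- move=> y; case: (cP' y) => ux xb _; split; last by rewrite -[b y]mulr1; exact: sqeqM.
  apply: (unramified_overM iL) => //; apply: unramified_overS UN.
  exact: finset.subsetT.
- exists (N ^+ (uphalf #|Y|)).
    by move=> h hG; rewrite rmorphXn /=; case: UN => fN _ _ _; rewrite fN.
  rewrite big_split /= prodr_const -/N cardT -cardE -exprS -exprM muln2.
  by rewrite uphalf_half Yodd -{1}[#|Y|]odd_double_half Yodd.
Qed.

End OddDescent.

(** * Square classes and quadratic extensions *)

Section SquareClassTheory.
Variable R : comUnitRingType.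
Implicit Types x y d : R.

Lemma to_sqclass_eq x y : x \is a GRing.unit -> y \is a GRing.unit ->
  to_sqclass x = to_sqclass y <-> exists2 d, d \is a GRing.unit & x = y * d ^+ 2.
Proof.
move=> ux uy; split=> [|[d ud xE]].
  move/eqP; rewrite -Quotient.idealrBE => /asboolP[z].
  move/(congr1 val); rewrite /= !insubdK // => zE.
  exists (val z); first exact: valP.
  by rewrite expr2 -zE mulrCA divrr // mulr1.
apply/eqP; rewrite -Quotient.idealrBE; apply/asboolP; exists (insubd (mulgrp_one R) d).
by apply/val_inj; rewrite /= !insubdK // xE -expr2 mulrAC divrr // mul1r.
Qed.

Lemma to_sqclassM x y : x \is a GRing.unit -> y \is a GRing.unit ->
  to_sqclass (x * y) = to_sqclass x + to_sqclass y.
Proof.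
move=> ux uy; rewrite /to_sqclass -[RHS]Quotient.pi_add; congr (\pi_{ideal_quot _}%qT _).
by apply/val_inj; rewrite /= !insubdK // unitrM ux.
Qed.

Lemma sqclass_repr (c : sqclass R) : to_sqclass (val (generic_quotient.repr c)) = c.
Proof. by rewrite /to_sqclass valKd reprK. Qed.

Lemma to_sqclass_eq0 x : x \is a GRing.unit ->
  to_sqclass x = 0 <-> exists2 d, d \is a GRing.unit & x = d ^+ 2.
Proof.
move=> ux; have -> : (0 : sqclass R) = to_sqclass 1.
  apply: (addrI (to_sqclass (1 : R))); rewrite addr0 -to_sqclassM ?unitr1 //.
  by rewrite mulr1.
rewrite to_sqclass_eq ?unitr1 //.
by split=> -[d ud ->]; exists d; rewrite ?mul1r.
Qed.

End SquareClassTheory.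

Lemma sqclass_map_to (R S : comUnitRingType) (g : R -> S) x :
  {morph g : y z / y * z} -> g 1 = 1 -> x \is a GRing.unit ->
  sqclass_map g (to_sqclass x) = to_sqclass (g x).
Proof.
move=> gM g1 ux; rewrite /sqclass_map; set y := val _.
have gu z : z \is a GRing.unit -> g z \is a GRing.unit.
  by move=> uz; apply/unitrPr; exists (g z^-1); rewrite -gM divrr.
have uy : y \is a GRing.unit by exact: valP.
have /to_sqclass_eq [//|//|d ud yE] : to_sqclass y = to_sqclass x by exact: sqclass_repr.
apply/(to_sqclass_eq (gu _ uy) (gu _ ux)); exists (g d); first exact: gu.
by rewrite yE gM !expr2 gM.
Qed.

Section EmbeddingExtension.
Variables (W E : fieldType) (j : {rmorphism W -> E}) (y : E).
Hypotheses (alg : algebraicOver j y) (gen : forall e, exists p, e = (map_poly j p).[y]).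

(* Evaluation at y identifies E with W[X] / (m), m of least degree, and a root
   of the image of m extends the embedding. *)
Lemma embedding_extend (s : {rmorphism W -> algC}) :
  exists t : {rmorphism E -> algC}, forall x, t (j x) = s x.
Proof.
have exm : exists n, `[< exists m : {poly W}, [/\ m != 0, root (map_poly j m) y & size m = n] >].
  by have [p p0 rp] := alg; exists (size p); apply/asboolP; exists p.
case: (ex_minnP exm) => n /asboolP[m [m0 rm mn]] mmin.
have mdiv p : root (map_poly j p) y -> m %| p.
  move=> rp; rewrite /dvdp; apply: contraT => r0.
  have : (n <= size (p %% m)%R)%N.
    apply: mmin; apply/asboolP; exists (p %% m); split=> //.
    rewrite /root; have := congr1 (fun q => (map_poly j q).[y]) (divp_eq p m).
    by rewrite rmorphD rmorphM /= hornerD hornerM (rootP rm) (rootP rp) mulr0 add0r => <-.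
  by rewrite -mn leqNgt ltn_modp m0.
have sm : (1 < size m)%N.
  rewrite ltnNge; apply/negP => /size1_polyC mC; move: rm m0.
  by rewrite mC map_polyC /root hornerC fmorph_eq0 polyC_eq0 => /eqP ->; rewrite eqxx.
have [z rz] : exists z, root (map_poly s m) z.
  by apply/closed_rootP; rewrite size_map_poly neq_ltn sm orbT.
have [P PE] := choice gen.
have well (p q : {poly W}) : (map_poly j p).[y] = (map_poly j q).[y] ->
    (map_poly s p).[z] = (map_poly s q).[z].
  move=> pq; apply/eqP; rewrite -subr_eq0 -hornerN -hornerD -rmorphB.
  have /mdiv/dvdpP[r ->] : root (map_poly j (p - q)) y.
    by rewrite /root rmorphB hornerD hornerN pq subrr.
  by rewrite rmorphM /= hornerM (rootP rz) mulr0.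
pose t e := (map_poly s (P e)).[z].
have tE p : t (map_poly j p).[y] = (map_poly s p).[z] by apply: well; rewrite -PE.
have tB : zmod_morphism t.
  by move=> a b; rewrite {1}(PE a) {1}(PE b) -hornerN -hornerD -rmorphB tE rmorphB hornerD hornerN.
have tM : monoid_morphism t.
  split=> [|a b].
    by have := tE 1; rewrite !rmorph1 !hornerE.
  by rewrite {1}(PE a) {1}(PE b) -hornerM -rmorphM tE rmorphM hornerM.
pose tA := GRing.isZmodMorphism.Build E algC t tB.
pose tMM := GRing.isMonoidMorphism.Build E algC t tM.
pose tR : {rmorphism E -> algC} := HB.pack t tA tMM.
exists tR => x /=; have := tE x%:P; rewrite !map_polyC !hornerC /= => <-.
by [].
Qed.

End EmbeddingExtension.

Lemma sqr_ge0_real (z : algC) : 0 <= z ^+ 2 -> z \is Num.real.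
Proof.
move=> z2; have : sqrtC (z ^+ 2) \is Num.real by rewrite ger0_real // sqrtC_ge0.
have := sqrtCK (z ^+ 2) => /eqP; rewrite eqf_sqr => /orP[]/eqP -> //.
by rewrite realN.
Qed.

Section QuadraticExtension.
Variables (W : fieldType) (E : fieldExtType W) (s : E) (a : W).
Hypotheses (sE : s ^+ 2 = a%:A) (gen : <<1; s>>%VS = fullv).

Lemma fieldext_algebraic (e : E) : exists p : {poly W},
  [/\ p != 0, (size p <= (\dim {:E}).+1)%N & root (map_poly (in_alg E) p) e].
Proof.
have /polyOver1P[p pE] : minPoly 1%AS e \is a polyOver 1%VS by exact: minPolyOver.
have sp : size p = size (minPoly 1%AS e) by rewrite pE size_map_poly.
exists p; split.
- by rewrite -size_poly_eq0 sp size_minPoly.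
- by rewrite sp size_minPoly ltnS adjoin_degreeE dimv1 divn1; exact: dimvS (subvf _).
- by rewrite -pE root_minPoly.
Qed.

Lemma simple_generator (e : E) : exists p : {poly W}, e = (map_poly (in_alg E) p).[s].
Proof.
have /Fadjoin1_polyP[p ->] : e \in <<1%AS; s>>%VS by rewrite gen memvf.
by exists p.
Qed.

Lemma quadratic_span (e : E) : exists p q : W, e = p%:A + q%:A * s.
Proof.
have [p ->] := simple_generator e; elim/poly_ind: p => [|p c [u [v IH]]].
  by exists 0, 0; rewrite rmorph0 horner0 scale0r mul0r addr0.
rewrite rmorphD rmorphM /= map_polyX map_polyC hornerMXaddC IH /=.
exists (v * a + c), u; rewrite mulrDl -mulrA -expr2 sE.
by rewrite -[v%:A]/(in_alg E v) -[a%:A]/(in_alg E a) -rmorphM -[(v * a + c)%:A]/(in_alg E _) rmorphD /=; ring.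
Qed.

End QuadraticExtension.

Lemma quadratic_exists (W : fieldType) (a : W) :
  exists (E : fieldExtType W) (s : E), s ^+ 2 = a%:A /\ <<1; s>>%VS = fullv.
Proof.
have [[b bE]|nsq] := pselect (exists b, b ^+ 2 = a).
  (* If a is already a square, an extension of degree 1 serves. *)
  have [E dE [z _ _]] := irredp_FAdjoin (irredp_XsubC (0 : W)).
  exists E, (b%:A); split; first by rewrite -[b%:A]/(in_alg E b) -rmorphXn bE.
  apply/eqP; rewrite eqEdim subvf dE size_XsubC /=.
  by rewrite lt0n dimv_eq0; apply: contra (oner_neq0 E) => /eqP e; rewrite -memv0 -e mem1v.
have irr : irreducible_poly ('X^2 - a%:P).
  apply: cubic_irreducible => [|x]; first by rewrite size_XnsubC.
  by rewrite /root !hornerE subr_eq0; apply/eqP => xa; apply: nsq; exists x.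
have [E _ [s rs gen]] := irredp_FAdjoin irr; exists E, s; split=> //.
apply/eqP; rewrite -subr_eq0; move: rs.
by rewrite /root rmorphB /= map_polyXn map_polyC !hornerE.
Qed.

(** * Unramified classes over a fixed field of L *)

Section UnramifiedClass.
Variables (K : fieldType) (L : splittingFieldType K) (iL : {rmorphism L -> algC}).
Local Notation gT := (gal_of {:L}).
Variables (W : fieldType) (j : {rmorphism W -> L}) (A : {group gT}).
Hypothesis jA : forall x, gal_fixed A x <-> exists w, j w = x.

Lemma gal_alg (g : gT) (k : K) : g k%:A = k%:A.
Proof. by rewrite linearZ /= rmorph1. Qed.

Let jK (k : K) : exists w, j w = k%:A.
Proof. by apply/jA => h _; exact: gal_alg. Qed.

Let alg (x : L) : algebraicOver j x.
Proof. by have [p [p0 _ rp]] := splitting_algebraic jK x; exists p. Qed.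

Lemma unramified_over_sqr (B : {set gT}) d : gal_fixed B d -> d != 0 -> unramified_over B (d ^+ 2).
Proof.
move=> fd d0; split.
- by move=> h hB; rewrite rmorphXn /= fd.
- exact: expf_neq0.
- by move=> w dw; exists d; split=> //; apply: unramified_at_sqr => //; exact: dvaluation_valuation.
- move=> s sr; rewrite rmorphXn lt_def expf_neq0 ?fmorph_eq0 //=.
  by rewrite -realEsqr sr.
Qed.

Lemma unramified_over_sqeq (a b : W) : b != 0 -> sqeq a b ->
  unramified_over A (j b) -> unramified_over A (j a).
Proof.
move=> b0 [d d0 ->] ub; rewrite rmorphM rmorphXn; apply: (unramified_overM iL) => //.
by apply: unramified_over_sqr; rewrite ?fmorph_eq0 //; apply/jA; exists d.
Qed.

(** L and E are not placed in a common field, so valuations travel through W: w is restricted to u,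
    and u extended to v on E. As v takes the value 1 on W, its index over u is 1, and
    [unramified_sqrt] supplies the witness. *)
Lemma unramified_class_over (a : W) : a != 0 -> unramified_class (to_sqclass a) ->
  unramified_over A (j a).
Proof.
move=> a0 [x [x0 [xa [E [s [sE gen [fin inf]]]]]]].
have /sqeq_sym : sqeq x a.
  by move/to_sqclass_eq: xa; rewrite !unitfE => /(_ x0 a0)[d]; rewrite unitfE => d0 e; exists d.
move/(unramified_over_sqeq x0); apply.
have s0 : s != 0 by apply: contraNneq x0 => s0; rewrite -(fmorph_eq0 (in_alg E)) /= -sE s0 expr0n.
split.
- by apply/jA; exists x.
- by rewrite fmorph_eq0.
- move=> w dw; have [e [u [e0 du we]]] := dvaluation_restrict alg dw.
  have [e' [v [e'0 dv ve]]] := dvaluation_extend (@fieldext_algebraic W E) du.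
  have [c vc] := fin v dv.
  have e'1 : e' = 1.
    by have := ve c; rewrite /= vc; move: (u c) => k; case: (ltP 0 k) => hk; nia.
  have vu : v \o in_alg E = u by apply/funext => z /=; rewrite -[z%:A]/(in_alg E z) ve e'1 mul1r.
  have [d] := @unramified_sqrt W E (iL \o j) (in_alg E) v dv (eq_ind_r _ du vu) x s x0 sE.
  rewrite vu => ud; exists (j d); split; first by apply/jA; exists d.
  exact/(unramified_at_restrict d x e0 we).
- move=> t tr.
  have [t' t'E] := embedding_extend (let: ex_intro p (And3 p0 _ rp) := fieldext_algebraic s in ex_intro2 _ _ p p0 rp) (simple_generator gen) (t \o j).
  have t's : t' s \is Num.real.
    by apply: inf => z; rewrite -[z%:A]/(in_alg E z) t'E; apply: tr; apply/jA; exists z.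
  rewrite -[t (j x)]/((t \o j) x) -t'E /= -sE rmorphXn lt_def expf_neq0 ?fmorph_eq0 //=.
  by rewrite -realEsqr.
Qed.

(** A valuation of E is transferred through W to L, where a witness exists; [unramified_values] then
    finds in W an element with the value of a uniformizer of E. At an infinite prime that is real on
    W, the image of s has a positive square, hence is real. *)
Lemma unramified_over_class (a : W) : unramified_over A (j a) ->
  unramified_class (to_sqclass a).
Proof.
case=> _ ja0 fin inf; have a0 : a != 0 by rewrite -(fmorph_eq0 j).
have W2 : (2%:R : W) != 0 by rewrite -(fmorph_eq0 (iL \o j)) rmorph_nat pnatr_eq0.
have [E [s [sE gen]]] := quadratic_exists a.
exists a; split=> //; split=> //; exists E, s; split=> //.
have s0 : s != 0 by apply: contraNneq a0 => s0; rewrite -(fmorph_eq0 (in_alg E)) /= -sE s0 expr0n.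
split.
- move=> v dv; have vP := dvaluation_valuation dv.
  have [e [u [e0 du ve]]] := dvaluation_restrict (fun x : E => let: ex_intro p (And3 p0 _ rp) := fieldext_algebraic x in ex_intro2 _ _ p p0 rp) dv.
  have [e' [w [e'0 dw we]]] := dvaluation_extend (splitting_algebraic jK) du.
  have [_ [/jA[d <-] ud]] := fin w dw.
  have {}ud : unramified_at v (in_alg E d) (s ^+ 2).
    rewrite sE; apply/(unramified_at_restrict d a e0 ve).
    exact/(unramified_at_restrict d a e'0 we).
  have E2 : (2%:R : E) != 0 by rewrite -(rmorph_nat (in_alg E)) fmorph_eq0.
  pose B : set E := [set x | exists z, x = in_alg E z]%classic.
  have BP : subfield_set B.
    split; first split.
    - by exists 1; rewrite rmorph1.
    - by move=> _ _ [x ->] [y ->]; exists (x - y); rewrite rmorphB.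
    - by move=> _ _ [x ->] [y ->]; exists (x * y); rewrite rmorphM.
    - by move=> _ [x ->]; exists x^-1; rewrite fmorphV.
  have [x ux vx] := dval_surj dv; rewrite unitfE in ux.
  have [p [q xE]] := quadratic_span sE gen x.
  rewrite xE in ux vx.
  have [||||c [[z ->] c0 vc]] := @unramified_values E v vP E2 B s (in_alg E d) (in_alg E p) (in_alg E q) BP _ s0 _ ud _ _ ux.
  + by exists a.
  + by exists d.
  + by exists p.
  + by exists q.
  + by exists z; rewrite -[z%:A]/(in_alg E z) vc.
- move=> t tr.
  pose M := fixedField A; pose z := separable_generator M {:L}.
  have /and3P[sM sepM _] : galois M {:L} by exact: fixedField_galois.
  have genz : {:L}%VS = <<M; z>>%VS by exact: eq_adjoin_separable_generator.
  have genj e : exists p, e = (map_poly j p).[z].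
    have /Fadjoin_polyP[p /polyOverP Mp ->] : e \in <<M; z>>%VS by rewrite -genz memvf.
    have exq i : exists c, j c = p`_i by apply/jA/gal_fixedP.
    have [q qE] := choice exq; exists (\poly_(i < size p) q i); congr (_.[_]).
    apply/polyP => i; rewrite coef_map coef_poly /=; case: ltnP => [_|ip]; first by rewrite qE.
    by rewrite rmorph0 nth_default.
  have [t' t'E] := embedding_extend (alg z) genj (t \o in_alg E).
  have ts : t s \is Num.real.
    apply: sqr_ge0_real; rewrite -rmorphXn sE -[a%:A]/(in_alg E a) -[t _]/((t \o in_alg E) a) -t'E ltW //.
    by apply: inf => x /jA[y <-]; rewrite t'E /= tr.
  move=> x; have [p [q ->]] := quadratic_span sE gen x.
  by rewrite rmorphD rmorphM /= rpredD ?rpredM.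
Qed.

End UnramifiedClass.

Lemma galois_char0 (F : fieldType) (L : splittingFieldType F) (i : {rmorphism L -> algC})
  (M : {subfield L}) : galois M {:L}.
Proof.
have char0 : [pchar L] =i pred0.
  move=> p; apply/negbTE/negP => /andP[pp /eqP p0].
  have : i p%:R == 0 by rewrite p0 rmorph0.
  by rewrite rmorph_nat pnatr_eq0 => /eqP p00; rewrite p00 in pp.
by rewrite /galois subvf normalFieldf andbT /=; apply/separableP => x _; exact: pcharf0_separable.
Qed.

(** * Embeddings into algC *)

Section AlgCAutomorphisms.
Implicit Types (x z : algC).

Lemma splitting_number_field (s : seq algC) :
  exists (Q : splittingFieldType rat) (i : {rmorphism Q -> algC}),
    forall x, x \in s -> exists y, i y = x.
Proof.
pose toC := map_poly (ratr : rat -> algC).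
have exq x : exists q : {poly rat}, toC q = minCpoly x.
  by case: (minCpolyP x) => q [qE _] _; exists q; rewrite qE.
have [q qE] := choice exq; pose p := \prod_(x <- s) q x.
have pE : toC p = \prod_(x <- s) minCpoly x.
  by rewrite /toC rmorph_prod; apply: eq_bigr => x _; exact: qE.
have pmon : toC p \is monic by rewrite pE monic_prod // => x _; exact: minCpoly_monic.
have [r rE] := closed_field_poly_normal (toC p).
rewrite (monicP pmon) scale1r in rE.
have [Qs [i [s1 s1r gen]]] := num_field_exists r.
have ax : SplittingField.axiom Qs.
  exists (map_poly (in_alg Qs) p); first by apply/polyOver1P; exists p.
  exists s1 => //; suff -> : map_poly (in_alg Qs) p = \prod_(z <- s1) ('X - z%:P) by exact: eqpxx.
  apply: (map_poly_inj i); rewrite -map_poly_comp (eq_map_poly (g := ratr)); last first.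
    by move=> c /=; rewrite alg_num_field fmorph_rat.
  rewrite -/(toC p) rE -s1r big_map rmorph_prod; apply: eq_bigr => z _.
  by rewrite /= map_polyXsubC.
pose Qn : splittingFieldType rat := HB.pack Qs (FieldExt_isSplittingField.Build rat Qs ax).
exists Qn, (i : {rmorphism Qn -> algC}) => x xs.
have : root (toC p) x.
  rewrite pE (big_rem x xs) /= rootM root_minCpoly //.
by rewrite rE root_prod_XsubC -s1r => /mapP[y _ ->]; exists y.
Qed.

(** In a normal number field containing both numbers the Galois group moves x to z, and
    automorphisms of a number field extend to algC. *)
Lemma algC_conjugate x z : root (minCpoly x) z -> exists nu : {rmorphism algC -> algC}, nu x = z.
Proof.
move=> rz; have [Q [i iP]] := splitting_number_field [:: x; z].
have [y yx] := iP x (mem_head _ _); have [t tz] : exists t, i t = z by apply: iP; rewrite !inE eqxx orbT.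
have rt : root (minPoly 1%AS y) t.
  have /polyOver1P[p pE] : minPoly 1%AS y \is a polyOver 1%VS by exact: minPolyOver.
  have toC w : i (minPoly 1%AS y).[w] = (map_poly ratr p).[i w].
    rewrite pE -horner_map -map_poly_comp; congr (_.[_]).
    by apply: eq_map_poly => c /=; rewrite alg_num_field fmorph_rat.
  rewrite /root -(fmorph_eq0 i) toC tz.
  have [q [qE _] dvd] := minCpolyP x.
  have : root (map_poly ratr p) x by rewrite /root -yx -toC minPolyxx rmorph0.
  rewrite dvd => /dvdpP[r ->]; rewrite rmorphM hornerM.
  by move/rootP: rz; rewrite qE => ->; rewrite mulr0.
have [g _ gy] := normalField_root_minPoly (subvf _) (normalFieldf _) (memvf y) rt.
by have [nu nuP] := extend_algC_subfield_aut i g; exists nu; rewrite -yx -nuP /= gy.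
Qed.

Lemma algC_moved x z : (forall p : {poly rat}, z != (map_poly ratr p).[x]) ->
  exists nu : {rmorphism algC -> algC}, nu x = x /\ nu z <> z.
Proof.
move=> nz; have [Q [i iP]] := splitting_number_field [:: x; z].
have [y yx] := iP x (mem_head _ _); have [t tz] : exists t, i t = z by apply: iP; rewrite !inE eqxx orbT.
have /galois_fixedField fE := galois_char0 i <<1%AS; y>>%AS.
have nt : t \notin <<1; y>>%VS.
  apply/negP => /Fadjoin1_polyP[p tE]; move: (nz p); rewrite -tz tE -yx -horner_map -map_poly_comp.
  by rewrite (eq_map_poly (g := ratr)) ?eqxx // => c /=; rewrite alg_num_field fmorph_rat.
have [g gG gt] : exists2 g, g \in 'Gal({:Q} / <<1; y>>)%g & g t <> t.
  apply: contrapT => none; move/negP: nt; apply; rewrite -fE.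
  apply/fixedFieldP; rewrite ?memvf // => g gG; apply: contrapT => gt; apply: none; by exists g.
have [nu nuP] := extend_algC_subfield_aut i g; exists nu; split.
  by rewrite -yx -nuP /= (fixed_gal _ gG) ?subvf ?memv_adjoin.
by rewrite -tz -nuP => /fmorph_inj.
Qed.

End AlgCAutomorphisms.

(** Generation over the prime field, expressed by the only consequence in use: morphisms are
    determined on b. In this form it passes easily to finite extensions. *)
Definition field_generators (W : fieldType) (b : seq W) : Prop :=
  forall (F : fieldType) (s t : {rmorphism W -> F}), (forall x, x \in b -> s x = t x) -> s =1 t.

Lemma extension_generators (K : fieldType) (b : seq K) (L : fieldExtType K) :
  field_generators b -> exists c : seq L, field_generators c.
Proof.
move=> gb; exists ([seq x%:A | x <- b] ++ vbasis {:L}) => F s t st x.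
have sK : s \o in_alg L =1 t \o in_alg L.
  by apply: gb => y yb /=; apply: st; rewrite mem_cat; apply/orP; left; apply: (map_f (fun x => x%:A)).
have scal k v : s v = t v -> s (k *: v) = t (k *: v).
  by move=> e; rewrite -mulr_algl !rmorphM e; congr (_ * _); exact: sK.
rewrite (coord_vbasis (memvf x)) !rmorph_sum; apply: eq_bigr => i _.
apply: scal; apply: st; rewrite mem_cat; apply/orP; right.
by apply: mem_nth; rewrite size_tuple.
Qed.

Lemma number_field_generators (K : fieldExtType rat) : exists b : seq K, field_generators b.
Proof.
apply: (@extension_generators rat [::] K) => F s t _ x.
by rewrite -[x]divq_num_den !fmorph_div !rmorph_int.
Qed.

Section Embeddings.
Variables (W : fieldType) (b : seq W) (gen : field_generators b).

Lemma primitive_generator (i : {rmorphism W -> algC}) : exists y : W,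
  forall x, x \in b -> exists p : {poly rat}, x = (map_poly ratr p).[y].
Proof.
have [z [a zE] [ps psE]] := algC_PET (map i b); rewrite size_map in a zE.
pose y := \sum_(k < size b) b`_k *+ a k.
have iy : i y = z.
  rewrite zE rmorph_sum; apply: eq_bigr => k _.
  by rewrite rmorphMn /= (nth_map 0).
have iP (p : {poly rat}) : i (map_poly ratr p).[y] = (map_poly ratr p).[z].
  rewrite -iy -horner_map -map_poly_comp; congr (_.[_]).
  by apply: eq_map_poly => c; rewrite /= fmorph_rat.
exists y => x xb; have : i x \in map i b by exact: map_f.
rewrite psE => /mapP[p _ xE]; exists p; apply: (fmorph_inj i).
by rewrite iP.
Qed.

Lemma embeddings_conjugate (i j : {rmorphism W -> algC}) :
  exists nu : {rmorphism algC -> algC}, forall x, nu (i x) = j x.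
Proof.
have [y yP] := primitive_generator i.
have hP (k : {rmorphism W -> algC}) (p : {poly rat}) : k (map_poly ratr p).[y] = (map_poly ratr p).[k y].
  rewrite -horner_map -map_poly_comp; congr (_.[_]).
  by apply: eq_map_poly => c; rewrite /= fmorph_rat.
have rj : root (minCpoly (i y)) (j y).
  have [q [qE _] _] := minCpolyP (i y); rewrite qE /root -hP fmorph_eq0 -(fmorph_eq0 i) hP.
  by rewrite -qE; exact: root_minCpoly.
have [nu nuy] := algC_conjugate rj; exists nu.
suff: nu \o i =1 j by [].
apply: gen => x /yP[p ->] /=; rewrite !hP -nuy -horner_map -map_poly_comp.
by congr (_.[_]); apply: eq_map_poly => c; rewrite /= fmorph_rat.
Qed.

(** With y a primitive element of W, a number outside Q(i y) is moved by an automorphism of algC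
    that fixes i y, hence all of i W. *)
Lemma embedding_fixed (i : {rmorphism W -> algC}) (z : algC) :
  (forall nu : {rmorphism algC -> algC}, (forall x, nu (i x) = i x) -> nu z = z) ->
  exists x, i x = z.
Proof.
move=> zfix; have [y yP] := primitive_generator i.
have hP (p : {poly rat}) : i (map_poly ratr p).[y] = (map_poly ratr p).[i y].
  rewrite -horner_map -map_poly_comp; congr (_.[_]).
  by apply: eq_map_poly => c; rewrite /= fmorph_rat.
apply: contrapT => nz; have [|nu [nuy nuz]] := @algC_moved (i y) z.
  by move=> p; apply/eqP => zE; apply: nz; exists (map_poly ratr p).[y]; rewrite hP.
apply: nuz; apply: zfix; suff: nu \o i =1 i by [].
apply: gen => x /yP[p ->] /=.
rewrite hP -horner_map -map_poly_comp nuy; congr (_.[_]).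
by apply: eq_map_poly => c; rewrite /= fmorph_rat.
Qed.

End Embeddings.

(** * The groups Gal(algC / K) and Gal(algC / L) *)

Definition autover_of (k : fieldType) (i : {rmorphism k -> algC}) (nu : {rmorphism algC -> algC})
  (nui : forall x, nu (i x) = i x) : autover i :=
  @Autover k algC i nu (algC_invaut nu) (algC_autK nu) (algC_invautK nu) nui.

Section AutoverGroup.
Variables (k : fieldType) (i : {rmorphism k -> algC}).
Implicit Types s t : autover i.

Lemma aut_inv_fix s x : aut_inv s (i x) = i x.
Proof. by rewrite -{1}(aut_fix s) autK. Qed.

Definition autover_comp s t : autover i :=
  @autover_of k i (Defs.aut s \o Defs.aut t) (fun x => etrans (congr1 (Defs.aut s) (aut_fix t x)) (aut_fix s x)).

Definition autover_inv s : autover i := @autover_of k i (aut_inv s) (aut_inv_fix s).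

End AutoverGroup.

Section GaloisLift.
Variables (K : fieldExtType rat) (iK : {rmorphism K -> algC}).
Variables (L : splittingFieldType K) (iL : {rmorphism L -> algC}).
Hypothesis iLK : forall x : K, iL x%:A = iK x.
Local Notation gT := (gal_of {:L}).

Lemma gal_setT : 'Gal({:L} / 1)%g = [set: gT].
Proof. by apply/finset.setP => g; rewrite inE gal_kHom ?sub1v // k1AHom. Qed.

Lemma gal_fixedT x : gal_fixed [set: gT] x <-> exists k : K, x = k%:A.
Proof.
have /galois_fixedField fE := galois_char0 iL 1%AS.
split=> [/gal_fixedP|[k ->] h _]; last exact: gal_alg.
by rewrite -gal_setT fE => /vlineP.
Qed.

Lemma splitting_generators : exists b : seq L, field_generators b.
Proof.
by have [b bP] := number_field_generators K; exact: (@extension_generators K b L bP).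
Qed.

Lemma gal_lift (g : gT) : exists t : autover iK, forall x, t (iL x) = iL (g x).
Proof.
have [b bP] := splitting_generators.
have [nu nuP] := embeddings_conjugate bP iL (iL \o g).
have nuK x : nu (iK x) = iK x by rewrite -iLK nuP /= gal_alg.
by exists (autover_of nuK).
Qed.

Lemma gal_restrict (t : autover iK) : exists g : gT, forall x, t (iL x) = iL (g x).
Proof.
have [x /gal_fixedT[k ->]|g _ gP] := @gal_embedding K L [set: gT]%G algC iL (Defs.aut t \o iL).
  by rewrite /= iLK aut_fix.
by exists g => x; rewrite -gP.
Qed.

Lemma autover_fixed z : (forall s : autover iL, s z = z) -> exists x, iL x = z.
Proof.
move=> zfix; have [b bP] := splitting_generators.
by apply: (embedding_fixed bP) => nu nuL; apply: (zfix (autover_of nuL)).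
Qed.

(** L is normal over K, so t preserves its image and conjugation by t preserves Gal(algC / L). *)
Lemma autover_conj (t : autover iK) (s : autover iL) : exists s' : autover iL,
  s' \o t =1 t \o s.
Proof.
have [g gP] := gal_restrict t.
have fixL x : (Defs.aut t \o Defs.aut s \o aut_inv t) (iL x) = iL x.
  have tE : iL x = t (iL (g^-1 x)%g) by rewrite gP galKV.
  by rewrite /= tE autK aut_fix.
exists (@autover_of L iL (Defs.aut t \o Defs.aut s \o aut_inv t) fixL) => z /=.
by rewrite autK.
Qed.

End GaloisLift.

Lemma qpoly_eval (K E : fieldType) (j : {rmorphism K -> E}) (h : {poly K}) (x : E) (p : {poly K}) :
  root (map_poly j (mk_monic h)) x ->
  (map_poly j (in_qpoly h p)).[x] = (map_poly j p).[x].
Proof.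
move=> rx; rewrite /in_qpoly /= -Pdiv.IdomainMonic.modpE ?monic_mk_monic //.
rewrite [in RHS](divp_eq p (mk_monic h)) rmorphD rmorphM /= hornerD hornerM.
by rewrite (rootP rx) mulr0 add0r.
Qed.

(** * The algebra K[T] / (f) *)

Section RootAlgebra.
Variables (K : fieldType) (L : splittingFieldType K) (f : {poly K}) (rs : seq L).
Hypotheses (f_size : (1 < size f)%N) (rs_uniq : uniq rs).
Hypothesis f_split : map_poly (in_alg L) f = (lead_coef f)%:A *: \prod_(x <- rs) ('X - x%:P).
Local Notation gT := (gal_of {:L}).
Local Notation A := (root_alg f).

Let h := (lead_coef f)^-1 *: f.

Lemma lead_coef_f_neq0 : lead_coef f != 0.
Proof. by rewrite lead_coef_eq0 -size_poly_gt0 (ltn_trans _ f_size). Qed.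

Lemma mk_monic_root_alg : mk_monic h = h.
Proof.
have l0 := lead_coef_f_neq0.
by rewrite /mk_monic size_scale ?invr_eq0 // f_size /h monicE lead_coefZ mulVf // eqxx.
Qed.

Lemma size_mk_monic_root_alg : size (mk_monic h) = size f.
Proof. by rewrite mk_monic_root_alg size_scale ?invr_eq0 ?lead_coef_f_neq0. Qed.

Lemma map_root_alg_poly : map_poly (in_alg L) h = \prod_(x <- rs) ('X - x%:P).
Proof.
rewrite /h map_polyZ f_split scalerA /= -[X in X *: _]/(in_alg L _ * in_alg L _) -rmorphM.
by rewrite mulVf ?lead_coef_f_neq0 // rmorph1 scale1r.
Qed.

Lemma size_rs : size rs = (size f).-1.
Proof.
have := congr1 (fun p : {poly L} => size p) map_root_alg_poly.
rewrite size_prod_XsubC size_map_poly size_scale ?invr_eq0 ?lead_coef_f_neq0 //.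
by move=> ->.
Qed.

Definition root_eval (x : L) (u : A) : L := (map_poly (in_alg L) (val u)).[x].

Lemma root_rs x : x \in rs -> root (map_poly (in_alg L) (mk_monic h)) x.
Proof. by move=> xrs; rewrite mk_monic_root_alg map_root_alg_poly root_prod_XsubC. Qed.

Lemma root_evalD x u w : root_eval x (u + w) = root_eval x u + root_eval x w.
Proof. by rewrite /root_eval [val _]poly_of_qpolyD rmorphD hornerD. Qed.

Lemma root_evalZ x (k : K) u : root_eval x (k *: u) = k%:A * root_eval x u.
Proof. by rewrite /root_eval [val _]poly_of_qpolyZ map_polyZ hornerZ. Qed.

Lemma root_eval_in x p : x \in rs -> root_eval x (in_qpoly h p) = (map_poly (in_alg L) p).[x].
Proof. by move=> xrs; apply: qpoly_eval; exact: root_rs. Qed.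

Lemma root_evalM x u w : x \in rs -> root_eval x (u * w) = root_eval x u * root_eval x w.
Proof.
move=> xrs; rewrite -hornerM -rmorphM -root_eval_in //.
Qed.

Lemma root_eval1 x : root_eval x 1 = 1.
Proof. by rewrite /root_eval [val _]qpolyCE rmorph1 hornerC. Qed.

Lemma root_eval_inj u w : (forall x, x \in rs -> root_eval x u = root_eval x w) -> u = w.
Proof.
move=> uw; apply/val_inj/(map_poly_inj (in_alg L)); apply/eqP; rewrite -subr_eq0.
apply: contraT => n0; set p := (_ - _) in n0.
have : (size rs < size p)%N.
  apply: max_poly_roots => //; apply/allP => x xrs.
  by rewrite /root hornerD hornerN -/(root_eval x u) -/(root_eval x w) uw ?subrr.
have sv (v : A) : (size (map_poly (in_alg L) (val v)) <= size rs)%N.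
  rewrite size_map_poly size_rs -ltnS prednK; last by rewrite (ltn_trans _ f_size).
  by apply: (leq_trans (size_mk_monic v)); rewrite size_mk_monic_root_alg.
rewrite ltnNge => /negP[]; apply: (leq_trans (size_polyD _ _)).
by rewrite geq_max size_polyN !sv.
Qed.

Lemma root_alg_unit u : (u \is a GRing.unit) <-> forall x, x \in rs -> root_eval x u != 0.
Proof.
split=> [uu x xrs|nz].
  have := root_eval1 x; rewrite -(divrr uu) root_evalM // => e.
  by apply/eqP => e0; move/eqP: e; rewrite e0 mul0r eq_sym oner_eq0.
suff H (p : {poly K}) : (forall x, x \in rs -> (map_poly (in_alg L) p).[x] != 0) ->
  coprimep (mk_monic h) p by exact: H.
move=> {}nz; rewrite mk_monic_root_alg -(coprimep_map (in_alg L)) map_root_alg_poly.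
have : all (fun x => ~~ root (map_poly (in_alg L) p) x) rs by apply/allP => x /nz.
elim: rs => [|x r IH] /=; first by rewrite big_nil coprime1p.
by case/andP => rx /IH; rewrite big_cons coprimepMl [coprimep ('X - _) _]coprimep_sym coprimep_XsubC rx.
Qed.

(* The multiplication matrix of u is diagonalized by the matrix of the values of
   the basis at the roots, which is invertible since a multiple of it is a
   Vandermonde matrix. *)
Lemma root_alg_norm (u : A) : (alg_norm u)%:A = \prod_(x <- rs) root_eval x u.
Proof.
have dimA : \dim {:A} = size rs.
  by rewrite size_rs -size_mk_monic_root_alg; exact: dim_polyn.
set n := \dim {:A} in dimA *; pose e := vbasis {:A}.
pose M := passmx.mxof e e (amull u).
pose V := \matrix_(i < n, k < n) root_eval rs`_k e`_i.
pose D := diag_mx (\row_(k < n) root_eval rs`_k u).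
have rsk (k : 'I_n) : rs`_k \in rs by rewrite mem_nth // -dimA.
have evsum x (I : finType) (c : I -> K) (b : I -> A) :
    root_eval x (\sum_i c i *: b i) = \sum_i (c i)%:A * root_eval x (b i).
  elim/big_rec2: _ => [|i y z _ <-]; last by rewrite root_evalD root_evalZ.
  by rewrite /root_eval [val _]/(0 : {poly K}) rmorph0 horner0.
have MV : map_mx (in_alg L) M *m V = V *m D.
  apply/matrixP => i k; rewrite mul_mx_diag !mxE.
  have -> : root_eval rs`_k e`_i * root_eval rs`_k u = root_eval rs`_k (u * e`_i).
    by rewrite root_evalM ?rsk // mulrC.
  have -> : u * e`_i = \sum_l M i l *: e`_l.
    rewrite (coord_vbasis (memvf (u * e`_i))); apply: eq_bigr => l _; congr (_ *: _).
    by rewrite mxE /= passmx.vecof_delta lfunE /= mxE.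
  by rewrite evsum; apply: eq_bigr => l _; rewrite !mxE.
have V0 : \det V != 0.
  pose P := \matrix_(k < n, i < n) coord e i (in_qpoly h 'X^k : A).
  have PV : map_mx (in_alg L) P *m V = Vandermonde n (\row_(k < n) rs`_k).
    apply/matrixP => k l; rewrite !mxE.
    have <- : root_eval rs`_l (in_qpoly h 'X^k) = rs`_l ^+ k.
      by rewrite root_eval_in ?rsk // map_polyXn hornerXn.
    rewrite [in_qpoly _ _ in RHS](coord_vbasis (memvf (in_qpoly h 'X^k : A))) evsum.
    by apply: eq_bigr => i _; rewrite !mxE.
  have := congr1 (fun m => \det m) PV; rewrite det_mulmx det_Vandermonde => detE.
  apply/eqP => V0; move: detE; rewrite V0 mulr0 => /esym/eqP; apply/negP.
  rewrite prodf_seq_neq0; apply/allP => i _ /=.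
  rewrite prodf_seq_neq0; apply/allP => l _ /=; apply/implyP => il.
  by rewrite !mxE subr_eq0 nth_uniq ?rs_uniq -?dimA // neq_ltn il orbT.
have := congr1 (fun m => \det m) MV; rewrite !det_mulmx mulrC => /(mulfI V0).
rewrite det_map_mx det_diag -[(alg_norm u)%:A]/(in_alg L (\det M)) => ->.
rewrite (big_nth 0) big_mkord -dimA; apply: eq_bigr => k _.
by rewrite mxE.
Qed.

End RootAlgebra.

Section RootAction.
Variables (K : fieldType) (L : splittingFieldType K) (f : {poly K}) (rs : seq L).
Variable iL : {rmorphism L -> algC}.
Hypotheses (f_size : (1 < size f)%N) (rs_uniq : uniq rs).
Hypothesis f_split : map_poly (in_alg L) f = (lead_coef f)%:A *: \prod_(x <- rs) ('X - x%:P).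
Local Notation gT := (gal_of {:L}).
Local Notation A := (root_alg f).
Local Notation Y := (seq_sub rs).
Local Notation h := ((lead_coef f)^-1 *: f).

Lemma horner_gal (g : gT) (p : {poly K}) x :
  g (map_poly (in_alg L) p).[x] = (map_poly (in_alg L) p).[g x].
Proof.
rewrite -horner_map -map_poly_comp; congr (_.[_]).
by apply: eq_map_poly => c /=; rewrite gal_alg.
Qed.

Lemma root_f x : (x \in rs) = root (map_poly (in_alg L) f) x.
Proof.
rewrite f_split rootZ ?root_prod_XsubC //.
by rewrite -[_%:A]/(in_alg L _) fmorph_eq0 lead_coef_f_neq0.
Qed.

Lemma gal_rs (g : gT) x : x \in rs -> g x \in rs.
Proof. by rewrite !root_f /root -horner_gal fmorph_eq0. Qed.

Definition root_act (y : Y) (g : gT) : Y := SeqSub (gal_rs g (valP y)).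

Fact root_act1 : root_act^~ 1%g =1 id.
Proof. by move=> y; apply/val_inj; rewrite /= gal1_all. Qed.

Fact root_actM (y : Y) : act_morph root_act y.
Proof. by move=> g k; apply/val_inj; rewrite /= galM_all. Qed.

Definition root_action : {action gT &-> Y} := TotalAction root_act1 root_actM.

Lemma root_eval_gal (g : gT) x (u : A) : g (root_eval x u) = root_eval (g x) u.
Proof. exact: horner_gal. Qed.

Lemma lagrange_interpolation (F : Y -> L) : exists p : {poly L},
  (size p <= size rs)%N /\ forall y : Y, p.[val y] = F y.
Proof.
pose l (y : Y) := \prod_(z <- rs | z != val y) ('X - z%:P).
have l0 y : (l y).[val y] != 0.
  rewrite horner_prod prodf_seq_neq0; apply/allP => z _; apply/implyP => zy.
  by rewrite hornerXsubC subr_eq0 eq_sym.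
have sl y : size (l y) = size rs.
  rewrite /l -big_filter size_prod_XsubC size_filter.
  have := count_predC (pred1 (val y)) rs; rewrite (count_uniq_mem _ rs_uniq) (valP y).
  by move=> <-.
exists (\sum_y (F y / (l y).[val y]) *: l y); split.
  apply: (leq_trans (size_sum _ _ _)); apply/bigmax_leqP => y _.
  by apply: (leq_trans (size_scale_leq _ _)); rewrite sl.
move=> y; rewrite horner_sum (bigD1 y) //= hornerZ divfK // big1 ?addr0 // => z zy.
suff lz : (l z).[val y] = 0 by rewrite hornerZ lz mulr0.
apply/eqP; rewrite horner_prod prodf_seq_eq0; apply/hasP; exists (val y); first exact: (valP y).
by rewrite /= hornerXsubC subrr eqxx andbT (inj_eq val_inj) eq_sym.
Qed.

(** An interpolation polynomial of degree less than the number of roots is unique, so the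
    equivariance of F makes it Galois invariant, that is, defined over K. This turns families
    indexed by the roots into elements of K[T] / (f). *)
Lemma root_alg_interpolation (F : Y -> L) :
  (forall x, gal_fixed [set: gT] x <-> exists k : K, x = k%:A) ->
  (forall y g, F (root_action y g) = g (F y)) ->
  exists u : A, forall y : Y, root_eval (val y) u = F y.
Proof.
move=> fixK FG; have [p [sp pF]] := lagrange_interpolation F.
have pfix (g : gT) : map_poly g p = p.
  apply/eqP; rewrite -subr_eq0; apply: contraT => n0.
  have : (size rs < size (map_poly g p - p)%R)%N.
    apply: max_poly_roots => //; apply/allP => x xrs.
    pose y : Y := SeqSub (gal_rs g^-1%g xrs).
    have xE : x = g (val y) by rewrite galKV.
    rewrite /root hornerD hornerN subr_eq0 {1}xE; apply/eqP.
    transitivity (g p.[val y]); first exact: horner_map.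
    by rewrite pF -FG -pF; congr (_.[_]); rewrite -[LHS]/(g (val y)) -xE.
  rewrite ltnNge => /negP[]; apply: (leq_trans (size_polyD _ _)).
  by rewrite geq_max size_polyN size_map_poly sp.
have exk i : exists k : K, p`_i = k%:A.
  by apply/fixK => g _; rewrite -[in RHS](pfix g) coef_map.
have [c cP] := choice exk; exists (in_qpoly h (\poly_(i < size p) c i)) => y.
rewrite (root_eval_in f_size f_split) ?(valP y) // -pF; congr (_.[_]).
apply/polyP => i; rewrite coef_map coef_poly /=; case: ltnP => [_|ip]; first by rewrite cP.
by rewrite scale0r nth_default.
Qed.

Lemma stab_rootE (y : Y) : stab root_action [set: gT]%G y = 'Gal({:L} / <<1; val y>>)%g.
Proof.
apply/finset.setP => g; rewrite !inE /= gal_kHom ?subvf //.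
apply/eqP/kAHomP => [gy x /Fadjoin1_polyP[p ->]|gx].
  by rewrite -[LHS]/(g _) horner_gal -[g (val y)]/(val (root_act y g)) gy.
by apply/val_inj; rewrite /= -[RHS](gx (val y)) ?memv_adjoin.
Qed.

Section Factor.
Variables (p : {poly K}) (mi : monic_irreducible_poly p) (y : Y).
Hypothesis py : root (map_poly (in_alg L) p) (val y).

Definition factor_embed (w : {poly %/ p with mi}) : L := (map_poly (in_alg L) (val w)).[val y].

Let py' : root (map_poly (in_alg L) (mk_monic p)) (val y).
Proof. by rewrite mk_monicE. Qed.

Fact factor_embed_zmod : zmod_morphism factor_embed.
Proof. by move=> a b; rewrite /factor_embed (_ : val (a - b) = val a - val b :> {poly K}) // rmorphB hornerD hornerN. Qed.

Fact factor_embed_monoid : monoid_morphism factor_embed.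
Proof.
split=> [|a b]; first by rewrite /factor_embed [val _]qpolyCE rmorph1 hornerC.
by rewrite /factor_embed -hornerM -rmorphM -[RHS](qpoly_eval _ py').
Qed.

HB.instance Definition _ := GRing.isZmodMorphism.Build {poly %/ p with mi} L
  factor_embed factor_embed_zmod.
HB.instance Definition _ := GRing.isMonoidMorphism.Build {poly %/ p with mi} L
  factor_embed factor_embed_monoid.

Definition factor_morphism : {rmorphism {poly %/ p with mi} -> L} := factor_embed.

Lemma factor_embed_in q : factor_embed (in_qpoly p q) = (map_poly (in_alg L) q).[val y].
Proof. exact: qpoly_eval. Qed.

Lemma factor_embed_image x : gal_fixed (stab root_action [set: gT]%G y) x <->
  exists w, factor_morphism w = x.
Proof.
rewrite stab_rootE; split=> [/gal_fixedP|[w <-] g].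
  have /galois_fixedField -> := galois_char0 iL <<1%AS; val y>>%AS.
  case/Fadjoin1_polyP => q ->; exists (in_qpoly p q); exact: factor_embed_in.
move=> gG; rewrite horner_gal; congr (_.[_]).
by rewrite (fixed_gal _ gG) ?subvf ?memv_adjoin.
Qed.

End Factor.

(** Evaluation at a root y of p identifies K[T] / (p) with K(y), the fixed field of the stabilizer
    of y. Every irreducible factor of f has a root in rs, and every root occurs through its minimal
    polynomial. *)
Lemma unramified_root_classP (u : A) : u \is a GRing.unit ->
  unramified_root_class (to_sqclass u) <->
  forall y : Y, unramified_over (stab root_action [set: gT]%G y) (root_eval (val y) u).
Proof.
move=> uu.
have key (p : {poly K}) (mi : monic_irreducible_poly p) (y : Y) : p %| f ->
    root (map_poly (in_alg L) p) (val y) ->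
  @unramified_class {poly %/ p with mi}
      (sqclass_map (fun u : A => in_qpoly p (val u)) (to_sqclass u)) <->
  unramified_over (stab root_action [set: gT]%G y) (root_eval (val y) u).
  move=> pf py; pose g : A -> {poly %/ p with mi} := fun u => in_qpoly p (val u).
  have ge w : factor_embed y (g w) = root_eval (val y) w by exact: factor_embed_in.
  pose j := factor_morphism mi py.
  have jinj : injective j := @fmorph_inj ({poly %/ p with mi} : fieldType) L j.
  have gM : {morph g : a b / a * b}.
    move=> a b; apply: jinj.
    by rewrite rmorphM /= !ge (root_evalM f_size f_split) // (valP y).
  have g1 : g 1 = 1 by apply: jinj; rewrite rmorph1 /= ge root_eval1.
  rewrite -[sqclass_map _ _]/(sqclass_map g (to_sqclass u)) sqclass_map_to //.
  have gu0 : g u != 0.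
    rewrite -(@fmorph_eq0 ({poly %/ p with mi} : fieldType) L j) /= ge; have /root_alg_unit := uu.
    by move/(_ _ _ f_size f_split (val y) (valP y)).
  rewrite -ge; split=> [uc|uo].
    exact: (unramified_class_over iL (factor_embed_image mi py) gu0 uc).
  exact: (unramified_over_class iL (factor_embed_image mi py) uo).
split=> [uc y|uo p mi pf].
  have /polyOver1P[p pE] : minPoly 1%AS (val y) \is a polyOver 1%VS by exact: minPolyOver.
  have py : root (map_poly (in_alg L) p) (val y) by rewrite -pE root_minPoly.
  have mi : monic_irreducible_poly p.
    split; last by rewrite -(map_monic (in_alg L)) -pE monic_minPoly.
    split=> [|q q1 qp]; first by rewrite -(size_map_poly (in_alg L)) -pE size_minPoly.
    have /minPoly_irr : map_poly (in_alg L) q \is a polyOver 1%AS by apply/polyOver1P; exists q.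
    move/(_ (val y)); rewrite pE dvdp_map => /(_ qp)/orP[|]; first by rewrite eqp_map.
    by rewrite -size_poly_eq1 size_map_poly (negPf q1).
  have pf : p %| f.
    rewrite -(dvdp_map (in_alg L)) -pE minPoly_dvdp //; first by apply/polyOver1P; exists f.
    by rewrite -root_f (valP y).
  by apply/(key p mi y pf py)/uc.
have : map_poly (in_alg L) p %| \prod_(x <- rs) ('X - x%:P).
  have := pf; rewrite -(dvdp_map (in_alg L)) f_split dvdpZr //.
  by rewrite -[_%:A]/(in_alg L _) fmorph_eq0 lead_coef_f_neq0.
case/dvdp_prod_XsubC => m pE.
have [x xm] : exists x, x \in mask m rs.
  have : size (mask m rs) != 0%N.
    have := eqp_size pE; rewrite size_prod_XsubC size_map_poly => ps.
    by case: mi => -[sp _] _; move: sp; rewrite ps; case: (size _).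
  by case: (mask m rs) => // x r _; exists x; rewrite mem_head.
have py : root (map_poly (in_alg L) p) x by rewrite (eqp_root pE) root_prod_XsubC.
by apply/(key p mi (SeqSub (mem_mask xm)) pf py).
Qed.

End RootAction.

(** * Valuations of a quadratic extension *)

Section QuadraticValuations.
Variables (F E : fieldType) (i : {rmorphism F -> E}) (y : E) (phi : F).
Hypotheses (yE : y ^+ 2 = i phi) (F2 : (2%:R : F) != 0).
Hypothesis span : forall h, exists AB : F * F, h = i AB.1 + i AB.2 * y.
Hypothesis nsq : forall b, b ^+ 2 != phi.
Local Notation valT := {classic (E -> int)}.

Lemma quad_uniq A B A' B' : i A + i B * y = i A' + i B' * y -> A = A' /\ B = B'.
Proof.
move=> e; have e' : i (A - A') = i (B' - B) * y.
  rewrite !rmorphB mulrBl; have -> : i A = i A' + i B' * y - i B * y by rewrite -e addrK.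
  ring.
have [BB|BB] := eqVneq B' B.
  split=> //; move: e'; rewrite BB subrr rmorph0 mul0r => /eqP.
  by rewrite fmorph_eq0 subr_eq0 => /eqP.
have b0 : B' - B != 0 by rewrite subr_eq0.
have /eqP : i ((A - A') / (B' - B)) ^+ 2 = i phi.
  by rewrite fmorph_div e' mulrAC divff ?mul1r ?fmorph_eq0.
by rewrite -rmorphXn fmorph_eq (negPf (nsq _)).
Qed.

Lemma quad_conj_exists : exists s : {rmorphism E -> E},
  (forall a, s (i a) = i a) /\ s y = - y.
Proof.
have [c cE] := choice span.
pose s h := i (c h).1 - i (c h).2 * y.
have sE A B : s (i A + i B * y) = i A - i B * y.
  by rewrite /s; have [<- <-] := quad_uniq (cE (i A + i B * y)).
have sB : zmod_morphism s.
  move=> a b; rewrite {1}(cE a) {1}(cE b).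
  have -> : i (c a).1 + i (c a).2 * y - (i (c b).1 + i (c b).2 * y) =
      i ((c a).1 - (c b).1) + i ((c a).2 - (c b).2) * y by rewrite !rmorphB; ring.
  by rewrite sE !rmorphB /s; ring.
have sM : monoid_morphism s.
  split=> [|a b].
    have -> : 1 = i 1 + i 0 * y by rewrite rmorph1 rmorph0 mul0r addr0.
    by rewrite sE rmorph0 mul0r subr0 addr0.
  rewrite {1}(cE a) {1}(cE b).
  have -> : (i (c a).1 + i (c a).2 * y) * (i (c b).1 + i (c b).2 * y) =
      i ((c a).1 * (c b).1 + (c a).2 * (c b).2 * phi) + i ((c a).1 * (c b).2 + (c a).2 * (c b).1) * y.
    by rewrite !rmorphD !rmorphM /= -yE; ring.
  by rewrite sE !rmorphD !rmorphM /= -yE /s; ring.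
pose sA := GRing.isZmodMorphism.Build E E s sB.
pose sMM := GRing.isMonoidMorphism.Build E E s sM.
pose sR : {rmorphism E -> E} := HB.pack s sA sMM.
exists sR; split=> [a|] /=.
  by have := sE a 0; rewrite rmorph0 !mul0r subr0 addr0.
by have := sE 0 1; rewrite rmorph0 rmorph1 !mul1r sub0r add0r.
Qed.

Variable s : {rmorphism E -> E}.
Hypotheses (si : forall a, s (i a) = i a) (sy : s y = - y).

Lemma quad_conjE A B : s (i A + i B * y) = i A - i B * y.
Proof. by rewrite rmorphD rmorphM !si sy mulrN. Qed.

Lemma quad_conjK h : s (s h) = h.
Proof. by have [[A B] ->] := span h; rewrite quad_conjE rmorphB rmorphM !si sy /= mulrN opprK. Qed.

Lemma quad_norm_exists : exists N : E -> F, (forall h, h * s h = i (N h)) /\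
  (forall A B, N (i A + i B * y) = A ^+ 2 - B ^+ 2 * phi).
Proof.
have e A B : (i A + i B * y) * s (i A + i B * y) = i (A ^+ 2 - B ^+ 2 * phi).
  by rewrite quad_conjE rmorphB [i (B ^+ 2 * phi)]rmorphM !rmorphXn /= -yE; ring.
have ex h : exists n, h * s h = i n.
  by have [[A B] ->] := span h; exists (A ^+ 2 - B ^+ 2 * phi); exact: e.
have [N NE] := choice ex; exists N; split=> // A B.
by apply: (fmorph_inj i); rewrite -NE e.
Qed.

Variable N : E -> F.
Hypotheses (NE : forall h, h * s h = i (N h)).
Hypothesis NAB : forall A B, N (i A + i B * y) = A ^+ 2 - B ^+ 2 * phi.

Lemma quad_norm_neq0 h : h != 0 -> N h != 0.
Proof. by move=> h0; rewrite -(fmorph_eq0 i) -NE mulf_neq0 ?fmorph_eq0. Qed.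

Lemma quad_normM a b : N (a * b) = N a * N b.
Proof. by apply: (fmorph_inj i); rewrite rmorphM -!NE rmorphM mulrACA. Qed.

Lemma quad_norm_conj h : N (s h) = N h.
Proof. by apply: (fmorph_inj i); rewrite -!NE quad_conjK mulrC. Qed.

Lemma quad_norm_base a : N (i a) = a ^+ 2.
Proof. by have := NAB a 0; rewrite rmorph0 mul0r addr0 expr0n mul0r subr0. Qed.

Lemma quad_norm_y : N y = - phi.
Proof. by have := NAB 0 1; rewrite rmorph0 rmorph1 mul1r add0r expr0n expr1n mul1r sub0r. Qed.

Lemma dvaluation_conj (v : E -> int) : is_dvaluation v -> is_dvaluation (v \o s).
Proof.
move=> dv; have vP := dvaluation_valuation dv.
have [x ux vx] := dval_surj dv; rewrite unitfE in ux.
have ex : exists2 z, z != 0 & (v \o s) z = 1.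
  by exists (s x); rewrite ?fmorph_eq0 //= quad_conjK.
apply: valuation_dvaluation => //; split.
- by rewrite /= rmorph0 (val0 vP).
- by move=> a b a0 b0; rewrite /= rmorphM (valM vP) ?fmorph_eq0.
- move=> a b a0 b0 ab0; rewrite /= rmorphD; case: vP => _ _ + _.
  by apply; rewrite -?rmorphD ?fmorph_eq0.
- by have [z z0 vz] := ex; exists z; rewrite ?vz.
Qed.

Lemma val_norm (v : E -> int) (w : F -> int) (e : int) : is_dvaluation v ->
  (forall a, v (i a) = e * w a) -> forall h, h != 0 -> v h + v (s h) = e * w (N h).
Proof.
move=> dv vw h h0; have vP := dvaluation_valuation dv.
by rewrite -(valM vP) ?fmorph_eq0 // NE vw.
Qed.

Lemma approx_value (u : E -> int) (r : seq valT) : is_dvaluation u ->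
  (forall v : valT, v \in r -> is_dvaluation v) ->
  exists x, [/\ x != 0, u x = 1 & forall v : valT, v \in r -> v <> u -> v x = 0].
Proof.
move=> du dr; have [p up0 up] := dval_surj du; rewrite unitfE in up0.
pose d (v : valT) := if v == (u : valT) then p else 1.
have [v0 vr|x xP] := @weak_approximation E ((u : valT) :: r) 1 d.
  rewrite /d; split; last by case: ifP => _; rewrite ?oner_neq0.
  by move: vr; rewrite inE => /predU1P[->|/dr].
have val (v : valT) : v \in (u : valT) :: r -> is_dvaluation v -> x != 0 /\ v x = v (d v).
  move=> /xP vx dv; have vP := dvaluation_valuation dv.
  have d0 : d v != 0 by rewrite /d; case: ifP => _; rewrite ?oner_neq0.
  have [t0 vt] := val1D vP vx; rewrite addrC subrK in t0 vt.
  have xE : x = x / d v * d v by rewrite divfK.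
  by split; [rewrite xE mulf_neq0|rewrite {1}xE (valM vP) // vt add0r].
have [x0 ux] := val u (mem_head _ _) du; exists x; split=> //.
  by rewrite ux /d eqxx.
move=> v' v'r v'u; have [_ ->] := val v' (mem_behead (s := _ :: _) v'r) (dr _ v'r).
by rewrite /d (introF eqP v'u) (val1 (dvaluation_valuation (dr _ v'r))).
Qed.

(** Otherwise some x has value 1 at v' and 0 at v and at its conjugate. Its norm then has value 0
    when computed with v, and a positive value when computed with v'. *)
Lemma over_pair (v v' : E -> int) (w : F -> int) (e e' : int) :
  is_dvaluation v -> is_dvaluation v' -> 0 < e -> 0 < e' ->
  (forall a, v (i a) = e * w a) -> (forall a, v' (i a) = e' * w a) ->
  v' = v \/ v' = v \o s.
Proof.
move=> dv dv' e0 e'0 vw v'w; apply: contrapT => /not_orP[v'v v'vs].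
have [|x [x0 v'x xP]] := @approx_value v' [:: (v : valT); (v \o s : valT); (v' \o s : valT)] dv'.
  by move=> u; rewrite !inE => /or3P[]/eqP -> //; exact: dvaluation_conj.
have vx : v x = 0 by apply: (xP v); rewrite ?mem_head // => /esym.
have vsx : v (s x) = 0.
  by apply: (xP (v \o s)); rewrite ?inE ?eqxx ?orbT // => /esym.
have v'sx : 0 <= v' (s x).
  have [sv'|sv'] := pselect (v' \o s = v'); first by rewrite -[v' (s x)]/((v' \o s) x) sv' v'x.
  by rewrite -[v' (s x)]/((v' \o s) x) (xP (v' \o s)) // ?inE ?eqxx ?orbT.
have := val_norm dv vw x0; have := val_norm dv' v'w x0; rewrite vx vsx v'x addr0.
move: (w (N x)) => k h1 /esym/eqP; rewrite mulf_eq0 (gt_eqF e0) /= => /eqP k0.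
by move: h1; rewrite k0 mulr0; lia.
Qed.

(** For x of value 1 at v and 0 at the conjugate of v, the norm relation reads 1 = e * w (N x). *)
Lemma split_index1 (v : E -> int) (w : F -> int) (e : int) :
  is_dvaluation v -> 0 < e -> (forall a, v (i a) = e * w a) -> v \o s <> v -> e = 1.
Proof.
move=> dv e0 vw vs.
have [|x [x0 vx xP]] := @approx_value v [:: (v \o s : valT)] dv.
  by move=> u; rewrite inE => /eqP ->; exact: dvaluation_conj.
have := val_norm dv vw x0; rewrite vx -[v (s x)]/((v \o s) x) (xP (v \o s)) ?mem_head // addr0.
by move: (w (N x)) => k; case: (ltP 0 k) => hk; nia.
Qed.

Section Ramified.
Variable w : F -> int.
Hypotheses (dw : is_dvaluation w) (wphi : odd `|w phi|%N).

Let wP := dvaluation_valuation dw.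
Let phi0 : phi != 0.
Proof. by apply: contraTneq wphi => ->; rewrite (val0 wP). Qed.

(* The two summands of N (A + B y) = A^2 - B^2 phi have values of different
   parity. *)
Lemma vge_quad_norm n A B : vge w n (A ^+ 2 - B ^+ 2 * phi) <->
  (A == 0) || (n <= w A *+ 2) /\ (B == 0) || (n <= w B *+ 2 + w phi).
Proof.
have vA : A != 0 -> w (A ^+ 2) = w A *+ 2 by move=> _; rewrite (valX wP).
have vB : B != 0 -> w (- (B ^+ 2 * phi)) = w B *+ 2 + w phi.
  by move=> B0; rewrite (valN wP) (valM wP) ?expf_neq0 // (valX wP).
have [A0|A0] := eqVneq A 0.
  rewrite A0 expr0n sub0r vgeN //.
  have [B0|B0] := eqVneq B 0; first by rewrite B0 expr0n mul0r vge0; split.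
  rewrite vgeP ?mulf_neq0 ?expf_neq0 // -(valN wP) vB //; split=> //; by case.
have A20 : A ^+ 2 != 0 by rewrite expf_neq0.
have [B0|B0] := eqVneq B 0.
  rewrite B0 expr0n mul0r subr0 vgeP // vA //; split=> //; by case.
have B20 : - (B ^+ 2 * phi) != 0 by rewrite oppr_eq0 mulf_neq0 ?expf_neq0.
have [ltAB|leBA] := ltP (w A *+ 2) (w B *+ 2 + w phi).
  have [|n0 nE] := @valDl _ w wP (A ^+ 2) (- (B ^+ 2 * phi)) A20.
    by rewrite vgeP // vA // vB //; lia.
  by rewrite vgeP // nE vA //; split=> [|[]//] /=; lia.
have neq : w A *+ 2 != w B *+ 2 + w phi by apply/eqP; move: wphi; move: (w A) (w B) (w phi); lia.
have [|n0 nE] := @valDl _ w wP (- (B ^+ 2 * phi)) (A ^+ 2) B20.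
  by rewrite vgeP // vA // vB //; lia.
rewrite addrC vgeP // nE vB //; split=> [|[]//] /=; lia.
Qed.

(** By [vge_quad_norm] a lower bound on w (N h) is a separate bound on each coordinate of h, hence
    is stable under addition. *)
Lemma ramified_dvaluation : is_dvaluation (fun h => if h == 0 then 0 else w (N h)).
Proof.
have [p p0 wp] := dval_surj dw; rewrite unitfE in p0.
have y0 : y != 0 by apply: contraTneq phi0 => y0; rewrite -(fmorph_eq0 i) -yE y0 expr0n /= eqxx.
have wz (k : int) : w (p ^ k) = k.
  by case: k => k; rewrite /exprz ?(valV wP) (valX wP) wp; lia.
have ex : exists2 h, h != 0 & (if h == 0 then 0 else w (N h)) = 1.
  (* As w phi = 2 k + 1, the norm of p^(-k) y has value 1. *)
  pose k := (w phi %/ 2)%Z; have pk0 : p ^ (- k) != 0 by rewrite expfz_neq0.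
  exists (i (p ^ (- k)) * y); first by rewrite mulf_neq0 ?fmorph_eq0.
  rewrite mulf_eq0 fmorph_eq0 (negPf pk0) (negPf y0) /= quad_normM quad_norm_base quad_norm_y.
  rewrite (valM wP) ?expf_neq0 ?oppr_eq0 // (valX wP) (valN wP) wz /k.
  have := divz_eq (w phi) 2; have := ltz_pmod (w phi) (isT : 0 < 2 :> int).
  have := modz_ge0 (w phi) (isT : 2 != 0 :> int).
  move: wphi; move: (w phi) (_ %/ _)%Z (_ %% _)%Z => a b c; lia.
apply: valuation_dvaluation => //; split.
- by rewrite eqxx.
- move=> a b a0 b0; rewrite mulf_eq0 (negPf a0) (negPf b0) /= quad_normM.
  by rewrite (valM wP) // quad_norm_neq0.
- move=> a b a0 b0 ab0; rewrite (negPf a0) (negPf b0) (negPf ab0).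
  set n := Order.min _ _; rewrite -vgeP ?quad_norm_neq0 //.
  have va : vge w n (N a) by rewrite vgeP ?quad_norm_neq0 // ge_min lexx.
  have vb : vge w n (N b) by rewrite vgeP ?quad_norm_neq0 // ge_min lexx orbT.
  move: va vb; have [[A B] ->] := span a; have [[A' B'] ->] := span b.
  rewrite addrACA -mulrDl -!rmorphD !NAB /= => /vge_quad_norm[a1 a2] /vge_quad_norm[b1 b2].
  have add x x' (c : int) : (x == 0) || (n <= w x *+ 2 + c) -> (x' == 0) || (n <= w x' *+ 2 + c) ->
      (x + x' == 0) || (n <= w (x + x') *+ 2 + c).
    have [->|x0] := eqVneq x 0; first by rewrite add0r.
    have [->|x'0] := eqVneq x' 0; first by rewrite addr0 (negPf x0).
    have [//|xx0 /=] := eqVneq (x + x') 0.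
    case: wP => _ _ /(_ x x' x0 x'0 xx0) + _; rewrite ge_min.
    move: (w x) (w x') (w (x + x')) => p1 p2 p3; clear; move: n => p4; lia.
  apply/vge_quad_norm; split; last exact: add.
  by have := add A A' 0; rewrite !addr0; apply.
- by have [h h0 hv] := ex; exists h; rewrite ?hv.
Qed.

End Ramified.
End QuadraticValuations.

Lemma dvaluation_scale_eq (E : fieldType) (u w : E -> int) (e : int) : 0 < e ->
  is_dvaluation u -> is_dvaluation w -> (forall x, w x = e * u x) -> w = u.
Proof.
move=> e0 du dw we; have [x _ wx] := dval_surj dw.
have e1 : e = 1.
  by have := we x; rewrite wx; move: (u x) => k; case: (ltP 0 k) => hk; nia.
by apply/funext => z; rewrite we e1 mul1r.
Qed.

(** * Places of k(x) and of the function field of the curve *)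

Section RationalFunctions.
Variable k : closedFieldType.
Local Notation F := {fraction {poly k}}.
Local Notation toF := (@FracField.tofrac {poly k}).
Implicit Types (p q : {poly k}) (x : F).

Lemma fracP x : exists p q, q != 0 /\ x = toF p / toF q.
Proof.
exists (frac (generic_quotient.repr x)).1, (frac (generic_quotient.repr x)).2.
by split; [exact: denom_ratioP|exact: fracE].
Qed.

Section DegreeValuation.
Variable dg : {poly k} -> int.
Hypothesis dgM : forall p q, p != 0 -> q != 0 -> dg (p * q) = dg p + dg q.
Hypothesis dgD : forall p q, p != 0 -> q != 0 -> p + q != 0 ->
  Order.min (dg p) (dg q) <= dg (p + q).
Hypothesis dg1 : exists p q, [/\ p != 0, q != 0 & dg p - dg q = 1].

Definition frac_val x : int := if x == 0 then 0 else
  dg (frac (generic_quotient.repr x)).1 - dg (frac (generic_quotient.repr x)).2.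

Lemma frac_valE p q : p != 0 -> q != 0 -> frac_val (toF p / toF q) = dg p - dg q.
Proof.
move=> p0 q0; rewrite /frac_val mulf_eq0 invr_eq0 !tofrac_eq0 (negPf p0) (negPf q0) /=.
set x := toF p / _; have := fracE x; have := denom_ratioP (generic_quotient.repr x).
move: (frac _).1 (frac _).2 => n d d0 xE.
have n0 : n != 0.
  apply: contraTneq (_ : x != 0) => [n0|]; first by rewrite xE n0 tofrac0 mul0r eqxx.
  by rewrite mulf_neq0 ?invr_eq0 ?tofrac_eq0.
move/eqP: xE; rewrite /x eqr_div ?tofrac_eq0 // -!tofracM tofrac_eq => /eqP pd.
by have := dgM p0 d0; rewrite pd dgM //; lia.
Qed.

Lemma frac_val_poly p : p != 0 -> frac_val (toF p) = dg p.
Proof.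
move=> p0; have := frac_valE p0 (oner_neq0 _); rewrite tofrac1 divr1 => ->.
have := dgM (oner_neq0 {poly k}) (oner_neq0 {poly k}); rewrite mulr1.
by move: (dg 1) (dg p) => a b; lia.
Qed.

Lemma frac_val_dvaluation : is_dvaluation frac_val.
Proof.
have nz p q : q != 0 -> toF p / toF q != 0 -> p != 0.
  by move=> q0; apply: contraNneq => ->; rewrite tofrac0 mul0r.
have [p1 [q1 [p10 q10 d1]]] := dg1.
have ex : exists2 x, x != 0 & frac_val x = 1.
  by exists (toF p1 / toF q1); rewrite ?frac_valE // mulf_neq0 ?invr_eq0 ?tofrac_eq0.
apply: valuation_dvaluation => //; split.
- by rewrite /frac_val eqxx.
- move=> x y; have [p [q [q0 ->]]] := fracP x; have [p' [q' [q'0 ->]]] := fracP y.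
  move=> /(nz _ _ q0) p0 /(nz _ _ q'0) p'0.
  by rewrite mulf_div -!tofracM !frac_valE ?mulf_neq0 // !dgM //; lia.
- move=> x y; have [p [q [q0 ->]]] := fracP x; have [p' [q' [q'0 ->]]] := fracP y.
  move=> /(nz _ _ q0) p0 /(nz _ _ q'0) p'0.
  rewrite addf_div ?tofrac_eq0 // -!tofracM -tofracD.
  have qq0 : q * q' != 0 by rewrite mulf_neq0.
  move/(nz _ _ qq0) => n0; rewrite !frac_valE //.
  have := dgD (mulf_neq0 p0 q'0) (mulf_neq0 p'0 q0) n0; rewrite !dgM // !ge_min.
  by move: (dg (_ + _)) (dg p) (dg q) (dg p') (dg q') => a b c d e; lia.
- by have [x x0 vx] := ex; exists x; rewrite ?vx.
Qed.

End DegreeValuation.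

Lemma mu_XsubC (a : k) : mup a ('X - a%:P) = 1%N.
Proof. by have := mup_XsubCX 1 a a; rewrite expr1 eqxx. Qed.

Definition ord_pt (a : k) : F -> int := frac_val (fun p => (mup a p)%:Z).
Definition ord_inf : F -> int := frac_val (fun p => - (size p).-1%:Z).

Lemma mu_dgM a p q : p != 0 -> q != 0 -> (mup a (p * q))%:Z = (mup a p)%:Z + (mup a q)%:Z.
Proof. by move=> p0 q0; rewrite mupM. Qed.

Lemma ord_pt_dvaluation a : is_dvaluation (ord_pt a).
Proof.
apply: frac_val_dvaluation; first exact: mu_dgM.
- move=> p q p0 q0 pq0; set m := minn (mup a p) (mup a q).
  have : (m <= mup a (p + q))%N.
    by rewrite mup_geq // dvdp_add // -mup_geq // ?geq_minl ?geq_minr.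
  by rewrite /m ge_min; lia.
- exists ('X - a%:P), 1; rewrite polyXsubC_eq0 oner_neq0 mu_XsubC; split=> //.
  by rewrite mupNroot // root1.
Qed.

Lemma size_dgM p q : p != 0 -> q != 0 ->
  - (size (p * q)).-1%:Z = - (size p).-1%:Z + - (size q).-1%:Z.
Proof.
move=> p0 q0; rewrite size_mul //.
by move: p0 q0; rewrite -!size_poly_gt0; move: (size p) (size q) => a b; lia.
Qed.

Lemma ord_inf_dvaluation : is_dvaluation ord_inf.
Proof.
apply: frac_val_dvaluation; first exact: size_dgM.
- move=> p q p0 q0 pq0; have := size_polyD p q; rewrite ge_min.
  move: p0 q0 pq0; rewrite -!size_poly_gt0.
  by move: (size (p + q)) (size p) (size q) => a b c; lia.
- exists 1, 'X; rewrite oner_neq0 polyX_eq0 size_polyX size_poly1; split=> //.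
Qed.

Lemma ord_pt_poly a p : p != 0 -> ord_pt a (toF p) = (mup a p)%:Z.
Proof. by move=> p0; apply: frac_val_poly => //; exact: mu_dgM. Qed.

Lemma ord_inf_poly p : p != 0 -> ord_inf (toF p) = - (size p).-1%:Z.
Proof. by move=> p0; apply: frac_val_poly => //; exact: size_dgM. Qed.

Lemma ord_pt_const a c : c != 0 -> ord_pt a (toF c%:P) = 0.
Proof. by move=> c0; rewrite ord_pt_poly ?polyC_eq0 // mupNroot // /root hornerC. Qed.

Lemma ord_inf_const c : c != 0 -> ord_inf (toF c%:P) = 0.
Proof. by move=> c0; rewrite ord_inf_poly ?polyC_eq0 // size_polyC c0. Qed.

Section Classification.
Variable w : F -> int.
Hypotheses (dw : is_dvaluation w) (wc : forall c, c != 0 -> w (toF c%:P) = 0).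

Let wP := dvaluation_valuation dw.

Lemma poly_dg_scale (dg : {poly k} -> int) (e : int) :
  (forall p q, p != 0 -> q != 0 -> dg (p * q) = dg p + dg q) ->
  (forall p, p != 0 -> w (toF p) = e * dg p) -> forall x, w x = e * frac_val dg x.
Proof.
move=> dgM wp x; have [p [q [q0 ->]]] := fracP x.
have [->|p0] := eqVneq p 0; first by rewrite tofrac0 mul0r (val0 wP) /frac_val eqxx mulr0.
by rewrite frac_valE // (valF wP) ?tofrac_eq0 // !wp // mulrBr.
Qed.

(** A pole of X makes the leading term of every polynomial dominant, so w is proportional to minus
    the degree. *)
Lemma dvaluation_inf : w (toF 'X) < 0 -> w = ord_inf.
Proof.
move=> wX; apply: (@dvaluation_scale_eq _ _ _ (- w (toF 'X))) => //; first by lia.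
  exact: ord_inf_dvaluation.
apply: poly_dg_scale; first exact: size_dgM.
elim/poly_ind => [|p c IH]; first by rewrite eqxx.
have [->|p0] := eqVneq p 0.
  rewrite mul0r add0r polyC_eq0 => c0; rewrite wc // size_polyC c0 oppr0 mulr0 //.
move=> _; have pX0 : p * 'X != 0 by rewrite mulf_neq0 ?polyX_eq0.
have wpX : w (toF (p * 'X)) = w (toF 'X) * (size p)%:Z.
  rewrite tofracM (valM wP) ?tofrac_eq0 ?polyX_eq0 // IH //.
  by rewrite -[in RHS](prednK (n := size p)) ?size_poly_gt0 // mulrNN -addn1 PoszD mulrDr mulr1.
have [||_] := @valDl _ w wP (toF (p * 'X)) (toF c%:P); first by rewrite tofrac_eq0.
  have [->|c0] := eqVneq c 0; first by rewrite tofrac0 vge0.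
  rewrite vgeP ?tofrac_eq0 ?polyC_eq0 // wc // wpX.
  by move: p0; rewrite -size_poly_gt0; move: wX; move: (w _) (size p) => b m; nia.
by rewrite -tofracD => ->; rewrite wpX size_MXaddC (negPf p0) /= mulrNN.
Qed.

Lemma vge_const c : vge w 0 (toF c%:P).
Proof.
have [->|c0] := eqVneq c 0; first by rewrite tofrac0 vge0.
by rewrite vge_val // wc.
Qed.

Lemma vge_poly p : 0 <= w (toF 'X) -> vge w 0 (toF p).
Proof.
move=> wX; elim/poly_ind: p => [|p c IH]; first by rewrite tofrac0 vge0.
rewrite tofracD tofracM vgeD ?vge_const // vgeM0 // vge_val //.
Qed.

(** A polynomial that does not vanish at a is a nonzero constant plus a multiple of X - a, hence has
    value 0; only the multiplicity of a counts. *)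
Lemma dvaluation_pt a : 0 < w (toF ('X - a%:P)) -> w = ord_pt a.
Proof.
move=> wa; apply: (@dvaluation_scale_eq _ _ _ (w (toF ('X - a%:P)))) => //.
  exact: ord_pt_dvaluation.
have wX : 0 <= w (toF 'X).
  have X0 : toF 'X != 0 by rewrite tofrac_eq0 polyX_eq0.
  rewrite -vgeP // -['X](subrK a%:P) tofracD vgeD ?vge_const // vge_val //.
  exact: ltW.
apply: poly_dg_scale; first exact: mu_dgM.
move=> p p0; have [m [q]] := multiplicity_XsubC p a; rewrite p0 /= => qa pE.
have q0 : q != 0 by apply: contraNneq qa => ->; rewrite root0.
have wq : w (toF q) = 0.
  have /dvdpP[r rE] : 'X - a%:P %| q - q.[a]%:P.
    by rewrite dvdp_XsubCl /root !hornerE subrr.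
  have qE : q = q.[a]%:P + r * ('X - a%:P) by rewrite -rE addrC subrK.
  have qa0 : q.[a] != 0 by [].
  have [||_] := @valDl _ w wP (toF q.[a]%:P) (toF (r * ('X - a%:P))).
  - by rewrite tofrac_eq0 polyC_eq0.
  - rewrite wc // add0r tofracM vgeMl ?vge_poly // vge_val //; lia.
  - by rewrite -tofracD -qE wc.
have X0 : 'X - a%:P != 0 :> {poly k} by rewrite polyXsubC_eq0.
have -> : mup a p = m.
  by rewrite pE mupMr // mup_XsubCX eqxx.
rewrite pE tofracM tofracXn (valM wP) ?tofrac_eq0 ?expf_neq0 ?tofrac_eq0 // wq (valX wP) add0r.
by rewrite -mulr_natr natz.
Qed.

(** If X has no pole, some polynomial has positive value, and so has one of its linear factors, k
    being algebraically closed. *)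
Lemma dvaluation_classification : w = ord_inf \/ exists a, w = ord_pt a.
Proof.
have [wX|wX] := ltP (w (toF 'X)) 0; first by left; exact: dvaluation_inf.
right; have [x x0 wx] := dval_surj dw; rewrite unitfE in x0.
have [p [q [q0 xE]]] := fracP x.
have p0 : p != 0 by apply: contraNneq x0 => p0; rewrite xE p0 tofrac0 mul0r.
have wp : 0 < w (toF p).
  have := vge_poly q wX; rewrite vgeP ?tofrac_eq0 //.
  by move: wx; rewrite xE (valF wP) ?tofrac_eq0 //; lia.
apply: contrapT => none; have wXa a : w (toF ('X - a%:P)) <= 0.
  by rewrite leNgt; apply/negP => /dvaluation_pt ?; apply: none; exists a.
have [r pE] := closed_field_poly_normal p.
have : w (toF p) <= 0.
  rewrite pE -mul_polyC tofracM (valM wP) ?tofrac_eq0 ?polyC_eq0 ?lead_coef_eq0 //; last first.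
    by rewrite monic_neq0 ?monic_prod_XsubC.
  rewrite wc ?lead_coef_eq0 // add0r; elim: (r) => [|a s IH].
    by rewrite big_nil tofrac1 (val1 wP).
  rewrite big_cons tofracM (valM wP) ?tofrac_eq0 ?polyXsubC_eq0 //; last first.
    by rewrite monic_neq0 ?monic_prod_XsubC.
  by rewrite -[leRHS]addr0 lerD //; exact: wXa.
by lia.
Qed.

End Classification.

Lemma frac_poly x : (forall a, vge (ord_pt a) 0 x) -> exists p, x = toF p.
Proof.
move=> xa; have [p [q [q0 xE]]] := fracP x.
have [p0|p0] := eqVneq p 0; first by exists 0; rewrite xE p0 tofrac0 mul0r.
have [n] := ubnP (size q); elim: n p q p0 q0 xE => // n IH p q p0 q0 xE sq.
have [sq1|sq1] := leqP (size q) 1.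
  move/size1_polyC: sq1 => qC; have c0 : q`_0 != 0 by rewrite -polyC_eq0 -qC.
  move: (q`_0) qC c0 => c qC c0.
  exists (c^-1 *: p); rewrite xE qC -mul_polyC tofracM.
  have cF0 : toF c%:P != 0 by rewrite tofrac_eq0 polyC_eq0.
  apply: (mulIf cF0).
  by rewrite divfK // mulrAC -tofracM -polyCM mulVf // polyC1 tofrac1 mul1r.
have [a ra] : exists a, root q a by apply/closed_rootP; rewrite neq_ltn sq1 orbT.
have x0 : x != 0 by rewrite xE mulf_neq0 ?invr_eq0 ?tofrac_eq0.
have rp : root p a.
  rewrite -dvdp_XsubCl XsubC_dvd //; have := xa a.
  rewrite vgeP // xE /ord_pt frac_valE //; last exact: mu_dgM.
  by move: ra; rewrite -dvdp_XsubCl XsubC_dvd //; lia.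
have /factor_theorem[p' p'E] := rp; have /factor_theorem[q' q'E] := ra.
have X0 : 'X - a%:P != 0 :> {poly k} by rewrite polyXsubC_eq0.
have p'0 : p' != 0 by apply: contraNneq p0 => e; rewrite p'E e mul0r.
have q'0 : q' != 0 by apply: contraNneq q0 => e; rewrite q'E e mul0r.
apply: (IH p' q') => //.
  have XF0 : toF ('X - a%:P) != 0 by rewrite tofrac_eq0.
  have cancel_common (c d e : F) : e != 0 -> (c * e) / (d * e) = c / d.
    by move=> e0; rewrite invfM mulrACA divff // mulr1.
  by rewrite xE p'E q'E [in LHS]tofracM [toF (q' * _)]tofracM; exact: cancel_common.
by move: sq; rewrite q'E size_Mmonic ?monicXsubC // size_XsubC addn2.
Qed.

Lemma frac_const x : (forall a, vge (ord_pt a) 0 x) -> vge ord_inf 0 x ->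
  exists c, x = toF c%:P.
Proof.
move=> /frac_poly[s ->] sinf.
have [s0|s0] := eqVneq s 0; first by exists 0; rewrite s0.
move: sinf; rewrite vgeP ?tofrac_eq0 // ord_inf_poly // => ss.
have : (size s <= 1)%N by lia.
by move/size1_polyC => ->; exists s`_0.
Qed.

Lemma frac_mul_ind (P : F -> Prop) :
  (forall c, c != 0 -> P (toF c%:P)) -> (forall a, P (toF ('X - a%:P))) ->
  (forall x y, x != 0 -> y != 0 -> P x -> P y -> P (x * y)) ->
  (forall x, x != 0 -> P x -> P x^-1) -> forall x, x != 0 -> P x.
Proof.
move=> Pc PX PM PV.
have Pp p : p != 0 -> P (toF p).
  move=> p0; have [r ->] := closed_field_poly_normal p.
  have l0 : lead_coef p != 0 by rewrite lead_coef_eq0.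
  suff PP : toF (\prod_(a <- r) ('X - a%:P)) != 0 /\ P (toF (\prod_(a <- r) ('X - a%:P))).
    case: PP => PP0 PP1; rewrite -mul_polyC tofracM.
    apply: PM; [by rewrite tofrac_eq0 polyC_eq0|exact: PP0|exact: Pc|exact: PP1].
  elim: r => [|a r [IH0 IH]].
    by rewrite big_nil tofrac1 oner_neq0 -tofrac1 -polyC1; split=> //; apply: Pc; exact: oner_neq0.
  have XF0 : toF ('X - a%:P) != 0 by rewrite tofrac_eq0 polyXsubC_eq0.
  rewrite big_cons tofracM; split; first exact: (mulf_neq0 XF0 IH0).
  exact: (PM _ _ XF0 IH0 (PX a) IH).
move=> x x0; have [p [q [q0 xE]]] := fracP x.
have p0 : p != 0 by apply: contraNneq x0 => p0; rewrite xE p0 tofrac0 mul0r.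
have pF0 : toF p != 0 by rewrite tofrac_eq0.
have qF0 : toF q != 0 by rewrite tofrac_eq0.
have qV0 : (toF q)^-1 != 0 by rewrite invr_eq0.
rewrite xE; exact: (PM _ _ pF0 qV0 (Pp p p0) (PV _ qF0 (Pp q q0))).
Qed.

End RationalFunctions.

Section PushForward.
Variables (T : choiceType) (t t' : T -> T).
Hypotheses (tK : cancel t t') (t'K : cancel t' t).

(** [divisor_act] is an instance of this expression, which also serves for the hyperelliptic
    involution. *)
Definition push (D : {freeg T}) : {freeg T} := \sum_(P <- dom D) << coeff P D *g t P >>.

Lemma coeff_push D Q : coeff Q (push D) = coeff (t' Q) D.
Proof.
rewrite /push raddf_sum /= (eq_bigr (fun P => coeff P D * (P == t' Q)%:R)); last first.
  by move=> P _; rewrite coeffU -(can2_eq tK t'K).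
have [Qd|Qd] := boolP (t' Q \in dom D); last first.
  rewrite coeff_outdom // big_seq big1 // => P Pd.
  by rewrite (negPf (_ : P != t' Q)) ?mulr0 //; apply: contraNneq Qd => <-.
rewrite (bigD1_seq (t' Q)) ?uniq_dom //= eqxx mulr1 big1 ?addr0 // => P /negPf ->.
by rewrite mulr0.
Qed.

Lemma pushD D D' : push (D + D') = push D + push D'.
Proof. by apply/eqP/freeg_eqP => Q; rewrite coeffD !coeff_push coeffD. Qed.

Lemma deg_push D : deg (push D) = deg D.
Proof.
rewrite /push raddf_sum /= -[in RHS](freeg_sumE D) raddf_sum /=.
by apply: eq_bigr => P _; rewrite !degU.
Qed.

End PushForward.

Lemma in_qpolyC (R : comNzRingType) (h : {poly R}) c : in_qpoly h c%:P = qpolyC h c.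
Proof.
apply/val_inj; apply: in_qpoly_small.
by rewrite (leq_ltn_trans (size_polyC_leq1 _)) // size_mk_monic_gt1.
Qed.

Lemma in_qpoly_linear (R : comNzRingType) (h : {poly R}) c d :
  in_qpoly h (c%:P + d%:P * 'X) = qpolyC h c + qpolyC h d * in_qpoly h 'X.
Proof. by rewrite in_qpolyD in_qpolyM !in_qpolyC. Qed.

Section FunctionField.
Variables (k : closedFieldType) (f : {poly k}) (rs : seq k).
Hypotheses (k2 : (2%:R : k) != 0) (rs_uniq : uniq rs) (rs_odd : odd (size rs)).
Hypotheses (f0 : f != 0) (f_split : f = lead_coef f *: \prod_(a <- rs) ('X - a%:P)).
Local Notation F := {fraction {poly k}}.
Local Notation toF := (@FracField.tofrac {poly k}).

Lemma size_f : size f = (size rs).+1.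
Proof. by rewrite f_split size_scale ?lead_coef_eq0 // size_prod_XsubC. Qed.

Lemma ord_inf_f : ord_inf (toF f) = - (size rs)%:Z.
Proof. by rewrite ord_inf_poly // size_f. Qed.

Lemma ord_pt_f a : ord_pt a (toF f) = (a \in rs)%:R.
Proof.
rewrite ord_pt_poly // f_split -mul_polyC mupM ?polyC_eq0 ?lead_coef_eq0 ?f0 ?monic_neq0 ?monic_prod_XsubC //.
rewrite mupNroot ?add0n; last by rewrite /root hornerC lead_coef_eq0.
elim: rs rs_uniq => [|b r IH] /=; first by rewrite big_nil mupNroot // root1.
case/andP => br ur; rewrite big_cons mupM ?polyXsubC_eq0 ?monic_neq0 ?monic_prod_XsubC //.
rewrite PoszD IH // inE -['X - b%:P]expr1 mup_XsubCX.
by have [->|ab] := eqVneq a b; rewrite ?(negPf br) //=; case: (_ \in _).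
Qed.

Lemma f_nsq (b : F) : b ^+ 2 != toF f.
Proof.
have wP := dvaluation_valuation (ord_inf_dvaluation k).
apply/eqP => /(congr1 (@ord_inf k)); rewrite (valX wP) ord_inf_f.
rewrite mulr2n; move: (size rs) rs_odd (ord_inf b) => m o a e; lia.
Qed.

Lemma curve_irreducible : monic_irreducible_poly (curve_poly f).
Proof.
split; last by have := monic_mk_monic (curve_poly f); rewrite curve_poly_mk.
apply: cubic_irreducible => [|x]; first by rewrite size_XnsubC.
by rewrite /root !hornerE subr_eq0 f_nsq.
Qed.

Definition ffield : fieldType := {poly %/ curve_poly f with curve_irreducible}.
Definition ff_base : {rmorphism F -> ffield} := qpolyC (curve_poly f).
Definition ff_y : ffield := in_qpoly (curve_poly f) 'X.

Lemma ff_yE : ff_y ^+ 2 = ff_base (toF f).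
Proof.
rewrite /ff_y expr2 -[LHS]/(in_qpoly (curve_poly f) 'X * in_qpoly (curve_poly f) 'X : {poly %/ curve_poly f}).
rewrite -in_qpolyM -expr2.
have -> : 'X^2 = curve_poly f + (toF f)%:P by rewrite /curve_poly subrK.
rewrite in_qpolyD; have -> : in_qpoly (curve_poly f) (curve_poly f) = 0.
  apply/val_inj; rewrite /= curve_poly_mk Pdiv.RingMonic.rmodpp //.
  by rewrite -{1}curve_poly_mk monic_mk_monic.
rewrite add0r; apply/val_inj; apply: in_qpoly_small.
by rewrite (leq_ltn_trans (size_polyC_leq1 _)) // size_mk_monic_gt1.
Qed.

Lemma ff_span (h : ffield) : exists AB : F * F, h = ff_base AB.1 + ff_base AB.2 * ff_y.
Proof.
have [p pE0] : exists p, p = val (h : {poly %/ curve_poly f}) by exists (val (h : {poly %/ curve_poly f})).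
have hE : h = in_qpoly (curve_poly f) p.
  by rewrite pE0; apply/val_inj/esym; apply: in_qpoly_small; exact: size_mk_monic.
have sp : (size p <= 2)%N.
  have := size_mk_monic (h : {poly %/ curve_poly f}); rewrite -pE0 curve_poly_mk.
  by rewrite /curve_poly size_XnsubC.
have pE : p = (p`_0)%:P + (p`_1)%:P * 'X.
  apply/polyP => n; rewrite coefD coefC coefMX coefC.
  case: n => [|[|n]] //=; rewrite ?addr0 ?add0r //.
  by rewrite nth_default // (leq_trans sp).
have qE : in_qpoly (curve_poly f) p =
    qpolyC (curve_poly f) p`_0 + qpolyC (curve_poly f) p`_1 * in_qpoly (curve_poly f) 'X.
  by rewrite [in LHS]pE; exact: in_qpoly_linear.
by exists (p`_0, p`_1); exact: (etrans hE qE).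
Qed.

Lemma F2 : (2%:R : F) != 0.
Proof. by rewrite -(rmorph_nat (toF : {rmorphism _ -> _})) tofrac_eq0 -polyC_natr polyC_eq0. Qed.

End FunctionField.

(** * Points of the curve above the x-line *)

Section Places.
Variables (k : closedFieldType) (f : {poly k}) (rs : seq k).
Hypotheses (k2 : (2%:R : k) != 0) (rs_uniq : uniq rs) (rs_odd : odd (size rs)).
Hypotheses (f0 : f != 0) (f_split : f = lead_coef f *: \prod_(a <- rs) ('X - a%:P)).
Local Notation F := {fraction {poly k}}.
Local Notation toF := (@FracField.tofrac {poly k}).
Variables (E : fieldType) (i : {rmorphism F -> E}) (y : E).
Hypotheses (yE : y ^+ 2 = i (toF f)).
Hypothesis span : forall h : E, exists AB : F * F, h = i AB.1 + i AB.2 * y.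
Variables (T : choiceType) (ordp : T -> E -> int).
Hypothesis ordp_inj : injective ordp.
Hypothesis ordp_dval : forall P, is_dvaluation (ordp P).
Hypothesis ordp_cst : forall P c, c != 0 -> ordp P (i (toF c%:P)) = 0.
Hypothesis ordp_onto : forall v : E -> int, is_dvaluation v ->
  (forall c, c != 0 -> v (i (toF c%:P)) = 0) -> exists P, ordp P = v.

Let nsq := f_nsq k2 rs_uniq rs_odd f0 f_split.
Let F2' : (2%:R : F) != 0 := F2 k2.
Let oP P := dvaluation_valuation (ordp_dval P).

Variables (s : {rmorphism E -> E}) (N : E -> F).
Hypotheses (si : forall a, s (i a) = i a) (sy : s y = - y).
Hypotheses (NE : forall h, h * s h = i (N h)).
Hypothesis NAB : forall A B, N (i A + i B * y) = A ^+ 2 - B ^+ 2 * toF f.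

Let sK := quad_conjK span si sy.

Lemma quad_root (h : E) : exists p : {poly F}, [/\ p != 0, (size p <= 3)%N & root (map_poly i p) h].
Proof.
have [[A B] /= hE] := span h; exists ('X^2 - (A *+ 2) *: 'X + (A ^+ 2 - B ^+ 2 * toF f)%:P).
set q := (A ^+ 2 - _); set p := (X in X != 0).
have sp : size p = 3.
  rewrite /p -addrA size_polyDl ?size_polyXn //.
  apply: leq_ltn_trans (size_polyD _ _) _; rewrite gtn_max size_polyN.
  by rewrite (leq_ltn_trans (size_scale_leq _ _)) ?size_polyX // (leq_ltn_trans (size_polyC_leq1 _)).
split; rewrite -?size_poly_gt0 ?sp //.
rewrite /root /p rmorphD rmorphB /= map_polyXn map_polyZ map_polyX map_polyC /= !hornerE.
rewrite hE /q rmorphMn rmorphB [i (B ^+ 2 * _)]rmorphM !rmorphXn /= -yE; apply/eqP; ring.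
Qed.

Lemma quad_algebraic (h : E) : algebraicOver i h.
Proof. by have [p [p0 _ ph]] := quad_root h; exists p. Qed.

Definition over (w : F -> int) (P : T) : Prop :=
  exists2 e : int, 0 < e & forall a, ordp P (i a) = e * w a.

Lemma place_over P : over (@ord_inf k) P \/ exists a, over (ord_pt a) P.
Proof.
have [e [w [e0 dw we]]] := dvaluation_restrict quad_algebraic (ordp_dval P).
have wc c : c != 0 -> w (toF c%:P) = 0.
  by move=> c0; have := ordp_cst P c0; rewrite we => /eqP; rewrite mulf_eq0 (gt_eqF e0) => /eqP.
have [wE|[a wE]] := dvaluation_classification dw wc; [left|right; exists a]; exists e => //;
  by rewrite -wE.
Qed.

Lemma over_exists w : is_dvaluation w -> (forall c, c != 0 -> w (toF c%:P) = 0) ->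
  exists P, over w P.
Proof.
move=> dw wc; have [e [v [e0 dv vw]]] := dvaluation_extend quad_root dw.
have [|P Pv] := ordp_onto dv; first by move=> c c0; rewrite vw wc // mulr0.
by exists P; exists e => // a; rewrite Pv.
Qed.

Lemma over_uniq w w' P : is_dvaluation w -> is_dvaluation w' -> over w P -> over w' P -> w = w'.
Proof.
move=> dw dw' [e e0 we] [e' e'0 we'].
have [x _ wx] := dval_surj dw; have [x' _ wx'] := dval_surj dw'.
have ee : e = e'.
  have := we x; have := we' x; rewrite wx => -> ; have := we x'; have := we' x'; rewrite wx' => ->.
  move: (w x') (w' x) => a b h1 h2.
  have a0 : 0 < a by clear -e0 e'0 h1; nia.
  have b0 : 0 < b by clear -e0 e'0 h2; nia.
  by clear -e0 e'0 h1 h2 a0 b0; nia.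
apply/funext => z; have := we z; rewrite we' ee => /mulfI -> //; lia.
Qed.

Lemma conj_exists P : exists Q, forall h, ordp Q h = ordp P (s h).
Proof.
have dv := dvaluation_conj span si sy (ordp_dval P).
have [|Q QE] := ordp_onto dv; first by move=> c c0; rewrite /= si ordp_cst.
by exists Q => h; rewrite QE.
Qed.

Variable t : T -> T.
Hypothesis tE : forall P h, ordp (t P) h = ordp P (s h).

Lemma conjpK : involutive t.
Proof. by move=> P; apply/ordp_inj/funext => h; rewrite !tE sK. Qed.

Lemma over_conj w P : over w P -> over w (t P).
Proof. by case=> e e0 we; exists e => // a; rewrite tE si. Qed.

Lemma over_two w P Q : over w P -> over w Q -> Q = P \/ Q = t P.
Proof.
move=> [e e0 we] [e' e'0 we'].
have [QP|QP] := over_pair F2' span si sy NE (ordp_dval P) (ordp_dval Q) e0 e'0 we we'.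
  by left; exact: ordp_inj.
by right; apply/ordp_inj; rewrite QP; apply/funext => h; rewrite tE.
Qed.

(** The composite of w and N is a point above w and is invariant under the involution; since the
    points above w are conjugate, it is the only one. *)
Lemma over_ramified w P : is_dvaluation w -> (forall c, c != 0 -> w (toF c%:P) = 0) ->
  odd `|w (toF f)|%N -> over w P -> t P = P /\ (forall h, h != 0 -> ordp P h = w (N h)).
Proof.
move=> dw wc wf wP; have vw := dvaluation_valuation dw.
have dv := ramified_dvaluation yE F2' span NE NAB dw wf.
have Ni a : N (i a) = a ^+ 2 by rewrite (quad_norm_base NAB).
have vi a : (if i a == 0 then 0 else w (N (i a))) = 2 * w a.
  rewrite fmorph_eq0 Ni (valX vw) mulr2n; have [->|_] := eqVneq a 0; last by ring.
  by rewrite (val0 vw).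
have [|Q QE] := ordp_onto dv; first by move=> c c0; rewrite vi wc ?mulr0.
have tQ : t Q = Q.
  by apply/ordp_inj/funext => h; rewrite tE QE fmorph_eq0 (quad_norm_conj span si sy NE).
have Qw : over w Q by exists 2 => // a; rewrite QE vi.
have PQ : P = Q by have [|] := over_two Qw wP; rewrite ?tQ.
by rewrite PQ tQ; split=> // h h0; rewrite QE (negPf h0).
Qed.

(** Let b^2 = f(a), which is nonzero. At an invariant P the functions y - b and y + b would have the
    same order, positive because their product f - f(a) vanishes at a; but they differ by a nonzero
    constant. *)
Lemma over_split a P : a \notin rs -> over (ord_pt a) P ->
  t P <> P /\ forall x, ordp P (i x) = ord_pt a x.
Proof.
move=> ars [e e0 we]; have w_f : ord_pt a (toF f) = 0 by rewrite (ord_pt_f rs_uniq f0 f_split) (negPf ars).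
have tP : t P <> P.
  move=> tP; have [b bE] : exists b, b ^+ 2 = f.[a].
    have [|b] := @closed_rootP k ('X^2 - (f.[a])%:P) _; rewrite ?size_XnsubC //.
    by rewrite /root !hornerE subr_eq0 => /eqP; exists b.
  have fa : f.[a] != 0.
    by rewrite f_split hornerZ mulf_neq0 ?lead_coef_eq0 // horner_prod; apply/eqP => /eqP;
       rewrite -horner_prod -/(root _ _) root_prod_XsubC (negPf ars).
  have b0 : b != 0 by apply: contraNneq fa => b0; rewrite -bE b0 expr0n.
  pose c : E := i (toF b%:P).
  have c2 : c ^+ 2 = i (toF (f.[a])%:P) by rewrite /c -!rmorphXn /= -bE rmorphXn.
  have c0 : c != 0 by rewrite fmorph_eq0 tofrac_eq0 polyC_eq0.
  have E2 : (2%:R : E) != 0 by rewrite -(rmorph_nat i) fmorph_eq0.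
  have yc (c' : E) : c' = c \/ c' = - c -> y + c' != 0.
    move=> c'E; rewrite addr_eq0; apply/eqP => yE'.
    have [x xE] : exists x, y = i x.
      by case: c'E yE' => -> ->; [exists (- toF b%:P); rewrite rmorphN|exists (toF b%:P); rewrite opprK].
    by have := nsq x; rewrite -(inj_eq (fmorph_inj i)) rmorphXn -xE yE eqxx.
  have p1 : y - c != 0 by apply: yc; right.
  have p2 : y + c != 0 by apply: yc; left.
  have pE : (y - c) * (y + c) = i (toF (f - (f.[a])%:P)).
    rewrite tofracB rmorphB -c2 -yE; ring.
  have vc : ordp P (c *+ 2) = 0.
    by rewrite -mulr_natr (valM (oP P)) // ordp_cst // add0r -(rmorph_nat i) -(rmorph_nat (toF : {rmorphism _ -> _})) -polyC_natr ordp_cst.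
  have eqv : ordp P (y - c) = ordp P (y + c).
    by rewrite -{1}tP tE rmorphB sy si -opprD (valN (oP P)).
  have fn0 : f - (f.[a])%:P != 0.
    by apply: contraTneq p1 => fE; move: pE; rewrite fE tofrac0 rmorph0 => /eqP; rewrite mulf_eq0 (negPf p2) orbF => ->.
  have v1 : 0 < ordp P (y - c).
    have : 0 < ordp P ((y - c) * (y + c)).
      rewrite pE we pmulr_rgt0 // ord_pt_poly // ltz_nat.
      by rewrite -[(0 < _)%N]/(1 <= _)%N mup_geq // expr1 dvdp_XsubCl /root !hornerE subrr.
    by rewrite (valM (oP P) p1 p2) eqv -mulr2n pmulrn_lgt0.
  have : vge (ordp P) 1 (c *+ 2).
    have -> : c *+ 2 = (y + c) - (y - c) by ring.
    by rewrite (vgeB (oP P)) // vge_val // -?eqv.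
  by rewrite vgeP ?vc // -mulr_natr mulf_neq0.
have tPs : ordp P \o s <> ordp P.
  by move=> h; apply: tP; apply/ordp_inj; rewrite -[RHS]h; apply/funext => x; rewrite tE.
have e1 := split_index1 F2' span si sy NE (ordp_dval P) e0 we tPs.
by split=> // x; rewrite we e1 mul1r.
Qed.

End Places.

Lemma ord_pt_XsubC (k : closedFieldType) (a b : k) :
  ord_pt b (FracField.tofrac ('X - a%:P)) = (a == b)%:R.
Proof. by rewrite ord_pt_poly ?polyXsubC_eq0 // -['X - a%:P]expr1 mup_XsubCX; case: (a == b). Qed.

Lemma ord_inf_XsubC (k : closedFieldType) (a : k) : ord_inf (FracField.tofrac ('X - a%:P)) = -1.
Proof. by rewrite ord_inf_poly ?polyXsubC_eq0 // size_XsubC. Qed.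

Section Parametrization.
Variables (k : closedFieldType) (f : {poly k}) (rs : seq k).
Hypotheses (k2 : (2%:R : k) != 0) (rs_uniq : uniq rs) (rs_odd : odd (size rs)).
Hypotheses (f0 : f != 0) (f_split : f = lead_coef f *: \prod_(a <- rs) ('X - a%:P)).
Local Notation F := {fraction {poly k}}.
Local Notation toF := (@FracField.tofrac {poly k}).
Variables (E : fieldType) (i : {rmorphism F -> E}) (y : E).
Hypotheses (yE : y ^+ 2 = i (toF f)).
Hypothesis span : forall h : E, exists AB : F * F, h = i AB.1 + i AB.2 * y.
Variables (T : choiceType) (ordp : T -> E -> int).
Hypothesis ordp_inj : injective ordp.
Hypothesis ordp_dval : forall P, is_dvaluation (ordp P).
Hypothesis ordp_cst : forall P c, c != 0 -> ordp P (i (toF c%:P)) = 0.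
Hypothesis ordp_onto : forall v : E -> int, is_dvaluation v ->
  (forall c, c != 0 -> v (i (toF c%:P)) = 0) -> exists P, ordp P = v.
Variables (s : {rmorphism E -> E}) (N : E -> F).
Hypotheses (si : forall a, s (i a) = i a) (sy : s y = - y).
Hypotheses (NE : forall h, h * s h = i (N h)).
Hypothesis NAB : forall A B, N (i A + i B * y) = A ^+ 2 - B ^+ 2 * toF f.

(** As the degree is odd, f has odd order at infinity as well as at its roots; above each of these
    lies a single point, of index 2. For any other a, [pt a] is an arbitrary one of the two points
    above a and the involution gives the other. *)
Lemma point_parametrization : exists (t : T -> T) (pinf : T) (pt : k -> T),
  [/\ forall P h, ordp (t P) h = ordp P (s h), involutive t, t pinf = pinf &
      forall a, (t (pt a) == pt a) = (a \in rs)] /\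
  [/\ forall P, P = pinf \/ exists a, P = pt a \/ P = t (pt a),
      forall x, ordp pinf (i x) = ord_inf x * 2,
      forall a x, ordp (pt a) (i x) = ord_pt a x *+ (a \in rs).+1,
      forall a, pt a != pinf & forall a b, pt a = pt b \/ t (pt a) = pt b -> a = b].
Proof.
have [t tE] := choice (conj_exists span ordp_dval ordp_cst ordp_onto si sy).
have [pinf pinfP] := over_exists yE span ordp_onto (ord_inf_dvaluation k) (@ord_inf_const k).
have [pt ptP] := choice (fun a => over_exists yE span ordp_onto (ord_pt_dvaluation a) (@ord_pt_const k a)).
have ram := over_ramified k2 yE span ordp_inj ordp_dval ordp_onto si sy NE NAB tE.
have two := over_two k2 span ordp_inj ordp_dval si sy NE tE.
have Ni a : N (i a) = a ^+ 2 by rewrite (quad_norm_base NAB).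
have [tinf vinf] : t pinf = pinf /\ forall h, h != 0 -> ordp pinf h = ord_inf (N h).
  apply: ram (ord_inf_dvaluation k) (@ord_inf_const k) _ pinfP.
  by rewrite (ord_inf_f f0 f_split) abszN absz_nat.
have ramr a : a \in rs -> t (pt a) = pt a /\ forall h, h != 0 -> ordp (pt a) h = ord_pt a (N h).
  move=> ars; apply: ram (ord_pt_dvaluation a) (@ord_pt_const k a) _ (ptP a).
  by rewrite (ord_pt_f rs_uniq f0 f_split) ars.
have split a ars := over_split k2 rs_uniq rs_odd f0 f_split yE span ordp_inj ordp_dval ordp_cst si sy NE tE ars (ptP a).
have uniq := over_uniq f k2 rs_odd.
exists t, pinf, pt; split; split=> //.
- exact: (conjpK span ordp_inj si sy tE).
- move=> a; have [ars|ars] := boolP (a \in rs); first by apply/eqP; have [] := ramr a ars.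
  by apply/eqP => tp; have [] := split a ars.
- move=> P; have [PP|[a PP]] := place_over yE span ordp_dval ordp_cst P; [left|right; exists a].
    by have [->|->] := two _ _ _ pinfP PP.
  by have [->|->] := two _ _ _ (ptP a) PP; [left|right].
- move=> x; have vP := dvaluation_valuation (ord_inf_dvaluation k).
  have [->|x0] := eqVneq x 0; last by rewrite vinf ?fmorph_eq0 // Ni (valX vP) mulr2n; ring.
  by rewrite rmorph0 (val0 vP) (val0 (dvaluation_valuation (ordp_dval _))).
- move=> a x; have vP := dvaluation_valuation (ord_pt_dvaluation a).
  have [ars|ars] := boolP (a \in rs); last by have [_ ->] := split a ars.
  have [->|x0] := eqVneq x 0; last by rewrite (proj2 (ramr a ars)) ?fmorph_eq0 // Ni (valX vP).
  by rewrite rmorph0 (val0 vP) (val0 (dvaluation_valuation (ordp_dval _))).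
- move=> a; apply/eqP => e; have := ptP a; rewrite e => /(uniq _ _ _ _ _ _ _ (ord_inf_dvaluation k) (ord_pt_dvaluation a) pinfP).
  by move=> /(congr1 (fun w => w (toF ('X - a%:P)))); rewrite ord_inf_XsubC ord_pt_XsubC eqxx.
- move=> a b e; have aP : over i ordp (ord_pt a) (pt b).
    by case: e => <-; [exact: ptP|exact: (over_conj si tE (ptP a))].
  have := uniq _ _ _ _ _ _ _ (ord_pt_dvaluation a) (ord_pt_dvaluation b) aP (ptP b).
  move=> /(congr1 (fun w => w (toF ('X - a%:P)))); rewrite !ord_pt_XsubC eqxx.
  by case: eqVneq.
Qed.

End Parametrization.

(** * Divisors and two-torsion of the Jacobian *)

Lemma addz_ge0_eq0 (a b : int) : a + b = 0 -> 0 <= a -> 0 <= b -> a = 0.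
Proof. by lia. Qed.

Lemma double_int_eq0 (a : int) : a + a = 0 -> a = 0.
Proof. by lia. Qed.

Lemma odd_double_sub (a : int) n : odd n -> a *+ 2 + - n%:Z <> 0.
Proof. by rewrite mulr2n; lia. Qed.

Lemma int_parity (n : int) : exists m : int, n = m * 2 + (odd `|n|%N)%:R.
Proof. by exists (n %/ 2)%Z; lia. Qed.

Section Divisors.
Variables (k : closedFieldType) (f : {poly k}) (rs : seq k).
Hypotheses (k2 : (2%:R : k) != 0) (rs_uniq : uniq rs) (rs_odd : odd (size rs)).
Hypotheses (f0 : f != 0) (f_split : f = lead_coef f *: \prod_(a <- rs) ('X - a%:P)).
Local Notation F := {fraction {poly k}}.
Local Notation toF := (@FracField.tofrac {poly k}).
Variables (E : fieldType) (i : {rmorphism F -> E}) (y : E).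
Hypotheses (yE : y ^+ 2 = i (toF f)).
Hypothesis span : forall h : E, exists AB : F * F, h = i AB.1 + i AB.2 * y.
Variables (T : choiceType) (ordp : T -> E -> int).
Hypothesis ordp_dval : forall P, is_dvaluation (ordp P).
Variables (s : {rmorphism E -> E}) (N : E -> F).
Hypotheses (si : forall a, s (i a) = i a) (sy : s y = - y).
Hypotheses (NE : forall h, h * s h = i (N h)).
Hypothesis NAB : forall A B, N (i A + i B * y) = A ^+ 2 - B ^+ 2 * toF f.
Variables (t : T -> T) (pinf : T) (pt : k -> T).
Hypotheses (tE : forall P h, ordp (t P) h = ordp P (s h)) (tK : involutive t).
Hypotheses (tinf : t pinf = pinf) (tpt : forall a, (t (pt a) == pt a) = (a \in rs)).
Hypotheses (pcases : forall P, P = pinf \/ exists a, P = pt a \/ P = t (pt a)).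
Hypotheses (vinf : forall x, ordp pinf (i x) = ord_inf x * 2).
Hypotheses (vpt : forall a x, ordp (pt a) (i x) = ord_pt a x *+ (a \in rs).+1).
Hypotheses (pt_inf : forall a, pt a != pinf).
Hypotheses (pt_inj : forall a b, pt a = pt b \/ t (pt a) = pt b -> a = b).

Let oP P := dvaluation_valuation (ordp_dval P).
Let E2 : (2%:R : E) != 0.
Proof. by rewrite -(rmorph_nat i) fmorph_eq0 F2. Qed.
Let y0 : y != 0.
Proof.
apply/eqP => y0; have := fmorph_eq0 i (toF f).
by rewrite -yE y0 expr0n eqxx tofrac_eq0 (negPf f0).
Qed.

Definition divisor_of (D : {freeg T}) (h : E) : Prop := forall P, coeff P D = ordp P h.
Definition princ (D : {freeg T}) : Prop := exists2 h, h != 0 & divisor_of D h.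

Lemma divisor_ofM D D' h h' : h != 0 -> h' != 0 ->
  divisor_of D h -> divisor_of D' h' -> divisor_of (D + D') (h * h').
Proof. by move=> h0 h'0 DE D'E P; rewrite coeffD DE D'E (valM (oP P)). Qed.

Lemma divisor_ofV D h : divisor_of D h -> divisor_of (- D) h^-1.
Proof. by move=> DE P; rewrite coeffN DE (valV (oP P)). Qed.

Lemma princ0 : princ 0.
Proof. by exists 1; rewrite ?oner_neq0 // => P; rewrite coeff0 (val1 (oP P)). Qed.

Lemma princD D D' : princ D -> princ D' -> princ (D + D').
Proof.
by move=> [h h0 hE] [h' h'0 h'E]; exists (h * h'); [exact: mulf_neq0|exact: divisor_ofM].
Qed.

Lemma princN D : princ D -> princ (- D).
Proof. by move=> [h h0 hE]; exists h^-1; [rewrite invr_eq0|exact: divisor_ofV]. Qed.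

Lemma princMz D (n : int) : princ D -> princ (D *~ n).
Proof.
move=> pD; have pM m : princ (D *+ m).
  by elim: m => [|m IH]; rewrite ?mulr0n ?mulrS; [exact: princ0|exact: princD].
case: n => n; first exact: pM.
by rewrite NegzE mulrNz; apply: princN; exact: (pM n.+1).
Qed.

Lemma princ_sum I (r : seq I) (p : pred I) G : (forall j, p j -> princ (G j)) ->
  princ (\sum_(j <- r | p j) G j).
Proof. by move=> pG; elim/big_rec: _ => [|j D pj pD]; [exact: princ0|apply: princD; auto]. Qed.

(** The fibre of x above a minus the fibre above infinity, that is, the divisor of X - a; the two
    points coincide when a is a root. *)
Definition line_divisor a : {freeg T} := << pt a >> + << t (pt a) >> - << pinf >> *+ 2.

Lemma deg_line a : deg (line_divisor a) = 0.
Proof. by rewrite /line_divisor raddfB raddfD raddfMn /= !degU. Qed.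

Lemma t_pt_inf a : t (pt a) != pinf.
Proof. by rewrite -tinf (inj_eq (inv_inj tK)) pt_inf. Qed.

Lemma line_divisorE a : divisor_of (line_divisor a) (i (toF ('X - a%:P))).
Proof.
move=> P; rewrite /line_divisor coeffB coeffD coeffMn !coeffU !mul1r.
have side b : (pt a == pt b)%:R + (t (pt a) == pt b)%:R - (pinf == pt b)%:R *+ 2 =
    ordp (pt b) (i (toF ('X - a%:P))) :> int.
  rewrite vpt ord_pt_XsubC (eq_sym pinf) (negPf (pt_inf b)) mul0rn subr0.
  have [->|ab] := eqVneq a b; first by rewrite eqxx tpt; case: (b \in rs).
  rewrite mul0rn; case: eqP => [e|_]; first by case/eqP: ab; apply: pt_inj; left.
  by case: eqP => [e|//]; case/eqP: ab; apply: pt_inj; right.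
case: (pcases P) => [->|[b [->|->]]]; last 1 first.
- rewrite tE si -side -(inj_eq (inv_inj tK) (pt a)) tK (inj_eq (inv_inj tK)).
  by rewrite -{1}tinf (inj_eq (inv_inj tK)) [X in X - _]addrC.
- by rewrite vinf ord_inf_XsubC (negPf (pt_inf a)) (negPf (t_pt_inf a)) eqxx.
- exact: side.
Qed.

Lemma princ_line a : princ (line_divisor a).
Proof.
by exists (i (toF ('X - a%:P))); [rewrite fmorph_eq0 tofrac_eq0 polyXsubC_eq0|exact: line_divisorE].
Qed.

Lemma ordp_cst P c : c != 0 -> ordp P (i (toF c%:P)) = 0.
Proof.
move=> c0; case: (pcases P) => [->|[b [->|->]]]; rewrite ?tE ?si ?vinf ?vpt.
- by rewrite ord_inf_const // mul0r.
- by rewrite ord_pt_const // mul0rn.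
- by rewrite ord_pt_const // mul0rn.
Qed.

Lemma base_divisor x : x != 0 -> exists2 D, deg D = 0 & divisor_of D (i x).
Proof.
have i0 (z : F) : z != 0 -> i z != 0 by rewrite fmorph_eq0.
move: x; apply: frac_mul_ind => [c c0|a|x z x0 z0 [D D0 DE] [D' D'0 D'E]|x x0 [D D0 DE]].
- by exists 0; rewrite ?deg0 // => P; rewrite coeff0 ordp_cst.
- by exists (line_divisor a); [exact: deg_line|exact: line_divisorE].
- exists (D + D'); first by rewrite raddfD /= D0 D'0.
  by rewrite rmorphM; exact: (divisor_ofM (i0 _ x0) (i0 _ z0) DE D'E).
- exists (- D); first by rewrite raddfN /= D0.
  by rewrite fmorphV; exact: divisor_ofV.
Qed.

Lemma vge_sum_span P A B : 0 <= ordp P (i A) -> 0 <= ordp P (i B) -> 0 <= ordp P y -> vge (ordp P) 0 (i A + i B * y).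
Proof.
move=> vA vB vy; rewrite (vgeD (oP P)) //; first exact: vge_val.
by rewrite (vgeM0 (oP P)) // vge_val.
Qed.

Lemma coeff_seq (r : seq T) (c : T -> int) Q : uniq r -> (forall P, P \notin r -> c P = 0) ->
  coeff Q (\sum_(P <- r) << c P *g P >>) = c Q.
Proof.
move=> ur c0; rewrite raddf_sum /= (eq_bigr (fun P => c P * (P == Q)%:R)); last first.
  by move=> P _; rewrite coeffU.
have [Qr|Qr] := boolP (Q \in r); last first.
  rewrite c0 // big_seq big1 // => P Pr.
  by rewrite (negPf (_ : P != Q)) ?mulr0 //; apply: contraNneq Qr => <-.
rewrite (bigD1_seq Q) //= eqxx mulr1 big1 ?addr0 // => P /negPf ->.
by rewrite mulr0.
Qed.

(* A zero or pole of [h = A + B y] lies over one of [N h], [A], [B] or [f]: off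
   the norm's divisor the orders of [h] and its conjugate are opposite. *)
Lemma divisor_exists h : h != 0 -> exists2 D, deg D = 0 & divisor_of D h.
Proof.
move=> h0; have N0 : N h != 0 by exact: (quad_norm_neq0 NE h0).
have nrm P : ordp P h + ordp P (s h) = ordp P (i (N h)).
  by rewrite -NE (valM (oP P)) ?fmorph_eq0.
have [[A B] /= hE] := span h.
have [Dn Dn0 DnE] := base_divisor N0.
have tf0 : toF f != 0 by rewrite tofrac_eq0.
have [Df _ DfE] := base_divisor tf0.
have dv x : exists D, divisor_of D (i x).
  have [->|x0] := eqVneq x 0; last by have [D] := base_divisor x0; exists D.
  by exists 0 => P; rewrite rmorph0 (val0 (oP P)) coeff0.
have [[DA DAE] [DB DBE]] := (dv A, dv B).
pose r := undup (dom Dn ++ dom Df ++ dom DA ++ dom DB).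
have out P : P \notin r -> ordp P h = 0.
  rewrite mem_undup !mem_cat !negb_or !mem_dom !negbK DnE DfE DAE DBE.
  case/and4P => /eqP vN /eqP vf /eqP vA /eqP vB.
  have vy : ordp P y = 0.
    have : ordp P (y ^+ 2) = 0 by rewrite yE.
    by rewrite (valX (oP P)) => /eqP; rewrite mulrn_eq0 => /eqP.
  have v1 : 0 <= ordp P h.
    have : vge (ordp P) 0 h by rewrite hE vge_sum_span ?vA ?vB ?vy.
    by rewrite vgeP.
  have v2 : 0 <= ordp P (s h).
    have : vge (ordp P) 0 (s h).
      rewrite hE (quad_conjE si sy) -mulNr -rmorphN vge_sum_span ?vA ?vy //.
      by rewrite rmorphN (valN (oP P)) vB.
    by rewrite vgeP ?fmorph_eq0.
  by have := nrm P; rewrite vN => /addz_ge0_eq0; apply.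
pose D := \sum_(P <- r) << ordp P h *g P >>.
have DE : divisor_of D h by move=> Q; rewrite coeff_seq ?undup_uniq.
(* D and its conjugate have the same degree and add up to the divisor of the norm, of degree 0. *)
exists D => //; have : D + push t D = Dn.
  by apply/eqP/freeg_eqP => P; rewrite coeffD (coeff_push tK tK) !DE DnE tE nrm.
move/(congr1 (@deg T)); rewrite raddfD /= deg_push Dn0.
exact: double_int_eq0.
Qed.

Lemma base_const x : (forall P, 0 <= ordp P (i x)) -> exists c, x = toF c%:P.
Proof.
move=> xP; apply: frac_const => [a|]; apply: vge_val.
  by have := xP (pt a); rewrite vpt pmulrn_lge0.
by have := xP pinf; rewrite vinf pmulr_lge0.
Qed.

(** The trace 2 A and the norm of h are functions of x without poles, hence constants; so (2 B)^2 f
    is constant too, while its order at infinity would be odd if B were nonzero. *)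
Lemma ff_const h : h != 0 -> (forall P, ordp P h = 0) -> exists c, h = i (toF c%:P).
Proof.
move=> h0 hP; have [[A B] /= hE] := span h.
have sA : h + s h = i (A *+ 2) by rewrite hE (quad_conjE si sy) rmorphMn; ring.
have [a aE] : exists c, A *+ 2 = toF c%:P.
  apply: base_const => P; have [->|A0] := eqVneq (A *+ 2) 0.
    by rewrite rmorph0 (val0 (oP P)).
  have : vge (ordp P) 0 (i (A *+ 2)) by rewrite -sA (vgeD (oP P)) // vge_val // -?tE hP.
  by rewrite vgeP ?fmorph_eq0.
have [n nE] : exists c, N h = toF c%:P.
  apply: base_const => P; rewrite -NE (valM (oP P)) ?fmorph_eq0 // -tE !hP //.
have F20 : (2%:R : F) != 0 by exact: F2.
have BE : (B *+ 2) ^+ 2 * toF f = toF (a ^+ 2 - n *+ 4)%:P.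
  have -> : (a ^+ 2 - n *+ 4)%:P = a%:P ^+ 2 - n%:P *+ 4.
    by rewrite polyCB polyCMn rmorphXn.
  rewrite tofracB tofracMn tofracXn -aE -nE hE NAB; ring.
have B0 : B = 0.
  apply/eqP/negPn/negP => B0; have vP := dvaluation_valuation (ord_inf_dvaluation k).
  have B20 : B *+ 2 != 0 by rewrite -mulr_natr; exact: (mulf_neq0 B0 F20).
  have B40 : (B *+ 2) ^+ 2 != 0 := expf_neq0 2 B20.
  have tf0 : toF f != 0 by rewrite tofrac_eq0.
  have c0 : a ^+ 2 - n *+ 4 != 0 by rewrite -polyC_eq0 -tofrac_eq0 -BE (mulf_neq0 B40 tf0).
  have := congr1 (@ord_inf k) BE; rewrite (ord_inf_const c0) (valM vP B40 tf0).
  rewrite (valX vP) (ord_inf_f f0 f_split).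
  exact: (odd_double_sub rs_odd).
have AE : A = toF (a / 2%:R)%:P; last first.
  by exists (a / 2%:R); rewrite hE B0 rmorph0 mul0r addr0 AE.
apply: (mulIf F20); rewrite mulr_natr aE -(rmorph_nat (toF : {rmorphism _ -> _})) -polyC_natr.
by rewrite /= -tofracM -polyCM divfK.
Qed.

(** The involution is -1 on the Jacobian because P + t P - 2 pinf is always the divisor of a
    function of x. *)
Lemma norm_princ D : deg D = 0 -> princ (D + push t D).
Proof.
have tt a : line_divisor a = << t (pt a) >> + << t (t (pt a)) >> - << pinf >> *+ 2.
  by rewrite tK [X in X - _]addrC.
have pP P : princ (<< P >> + << t P >> - << pinf >> *+ 2).
  case: (pcases P) => [->|[a [->|->]]]; last by rewrite -tt; exact: princ_line.
  - by rewrite tinf -mulr2n subrr; exact: princ0.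
  - exact: princ_line.
move=> D0; suff H : forall D, princ (D + push t D - << pinf >> *~ (deg D *+ 2)).
  by have := H D; rewrite D0 mul0rn mulr0z subr0.
apply: freeg_ind_dom0 => [|c P D' _ _ IH].
  have -> : push t 0 = 0 by rewrite /push dom0 big_nil.
  by rewrite deg0 mul0rn mulr0z addr0 subr0; exact: princ0.
have -> : << c *g P >> + D' + push t (<< c *g P >> + D') - << pinf >> *~ (deg (<< c *g P >> + D') *+ 2)
   = (<< P >> + << t P >> - << pinf >> *+ 2) *~ c + (D' + push t D' - << pinf >> *~ (deg D' *+ 2)).
  apply/eqP/freeg_eqP => Q; rewrite !(coeffD, coeffB, coeff_push tK tK, coeffU, coeffN, raddfMz, raddfMn) /=.
  rewrite raddfD /= degU !coeffU -!(can2_eq tK tK) !coeffD ?coeffN ?coeffMn ?coeffN !coeffU !mul1r.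
  by move: (deg D') (P == Q) (t P == Q) (pinf == Q) => d b1 b2 b3; rewrite !mulrzz; ring.
by apply: princD => //; exact: princMz.
Qed.

Lemma eq_off_inf D D' : deg D = deg D' -> (forall Q, Q != pinf -> coeff Q D = coeff Q D') -> D = D'.
Proof.
move=> dD cD; apply/eqP; rewrite -subr_eq0; apply/eqP; set X := D - D'.
have XE : X = << coeff pinf X *g pinf >>.
  apply/eqP/freeg_eqP => Q; rewrite coeffU eq_sym; have [->|Qi] := eqVneq Q pinf; first by rewrite mulr1.
  by rewrite mulr0 coeffB cD ?subrr.
have : deg X = 0 by rewrite raddfB /= dD subrr.
by rewrite XE degU => ->; apply/eqP; rewrite freegU_eq0.
Qed.

Definition half_point a : {freeg T} := << pt a >> - << pinf >>.

Lemma deg_half_point a : deg (half_point a) = 0.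
Proof. by rewrite raddfB /= !degU subrr. Qed.

Lemma coeff_half_point a b : coeff (pt b) (half_point a) = (a == b)%:R.
Proof.
rewrite coeffB !coeffU !mul1r (eq_sym pinf) (negPf (pt_inf b)) subr0.
by congr (_%:R); congr nat_of_bool; apply/eqP/eqP => [e|->//]; apply: pt_inj; left.
Qed.

Lemma coeff_half_point_conj a Q : a \in rs -> coeff (t Q) (half_point a) = coeff Q (half_point a).
Proof.
rewrite -tpt => /eqP ta; rewrite !coeffB !coeffU.
by rewrite -{1}ta -{1}tinf !(inj_eq (inv_inj tK)).
Qed.

Lemma princ_double a : a \in rs -> princ (half_point a *+ 2).
Proof.
move=> ars; have -> : half_point a *+ 2 = line_divisor a; last exact: princ_line.
rewrite /line_divisor; have /eqP -> : t (pt a) == pt a by rewrite tpt.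
by rewrite /half_point mulrnBl -mulr2n.
Qed.

Lemma sum_delta (r : seq k) (c : k -> int) b : uniq r ->
  \sum_(a <- r) (a == b)%:R * c a = c b *+ (b \in r).
Proof.
move=> ur; have [br|br] := boolP (b \in r); last first.
  rewrite big_seq big1 // => a ar.
  by rewrite (negPf (_ : a != b)) ?mul0r //; apply: contraNneq br => <-.
rewrite (bigD1_seq b) //= eqxx mul1r big1 ?addr0 // => P /negPf ->.
by rewrite mul0r.
Qed.

Definition half (p : pred k) : {freeg T} := \sum_(a <- rs | p a) half_point a.

Lemma coeff_half p b : coeff (pt b) (half p) = (p b)%:R *+ (b \in rs).
Proof.
rewrite -(sum_delta (fun a => (p a)%:R) b rs_uniq) /half raddf_sum /= big_mkcond /=.
by apply: eq_bigr => a _; rewrite coeff_half_point; case: (p a); rewrite ?mulr1 ?mulr0.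
Qed.

Lemma deg_half p : deg (half p) = 0.
Proof. by rewrite /half raddf_sum /= big1 // => a _; exact: deg_half_point. Qed.

Lemma coeff_half_conj p Q : coeff (t Q) (half p) = coeff Q (half p).
Proof.
rewrite /half !raddf_sum /= big_seq_cond [RHS]big_seq_cond; apply: eq_bigr => a /andP[ars _].
exact: coeff_half_point_conj.
Qed.

Lemma ordp_y b : ordp (pt b) y = (b \in rs)%:R.
Proof.
have : ordp (pt b) (y ^+ 2) = (b \in rs)%:R *+ 2.
  by rewrite yE vpt (ord_pt_f rs_uniq f0 f_split); case: (b \in rs).
rewrite (valX (oP _)) => /eqP; rewrite -subr_eq0 -mulrnBl mulrn_eq0 /= subr_eq0.
by move/eqP.
Qed.

(** The sum over all the roots is the divisor of y. *)
Lemma princ_half_all (p : pred k) : {in rs, forall a, p a} -> princ (half p).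
Proof.
move=> prs; have [D D0 DE] := divisor_exists y0; exists y => //.
suff -> : half p = D by [].
apply: eq_off_inf => [|Q Qinf]; first by rewrite deg_half D0.
have side b : coeff (pt b) (half p) = coeff (pt b) D.
  rewrite coeff_half DE ordp_y; have [brs|//] := boolP (b \in rs).
  by rewrite prs.
case: (pcases Q) Qinf => [->|[b [->|->]] _]; rewrite ?eqxx //.
rewrite coeff_half_conj side !DE tE sy (valN (oP _)) //.
Qed.

(* A function whose divisor is invariant is multiplied by a constant under the
   conjugation, hence lies in k(x) or in k(x) y. *)
Lemma half_princ (p : pred k) : princ (half p) -> exists b, {in rs, forall a, p a = b}.
Proof.
case=> h h0 hE; have sh0 : s h != 0 by rewrite fmorph_eq0.
have g0 : s h / h != 0 by rewrite mulf_neq0 ?invr_eq0.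
have [c cE] : exists c, s h / h = i (toF c%:P).
  by apply: ff_const => // P; rewrite (valF (oP P)) // -tE -!hE coeff_half_conj subrr.
have c2 : c ^+ 2 = 1.
  have : i (toF (c ^+ 2)%:P) = i (toF 1%:P).
    have gs : s h / h = h / s h by rewrite cE -(si (toF c%:P)) -cE fmorph_div (quad_conjK span si sy).
    rewrite tofrac1 rmorph1 polyC_exp tofracXn rmorphXn /= -cE expr2 {2}gs.
    by rewrite mulrA divfK // divff.
  by move/fmorph_inj/eqP; rewrite tofrac_eq => /eqP/polyC_inj.
have shE : s h = i (toF c%:P) * h by rewrite -cE divfK.
have [[A B] /= hAB] := span h.
have oddE b : b \in rs -> (p b)%:R = ordp (pt b) h by rewrite -hE coeff_half => ->.
have /orP[/eqP c1|/eqP c1] : (c == 1) || (c == -1) by rewrite -eqf_sqr c2 expr1n.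
- exists false => b brs; have := oddE b brs.
  have B0 : i B * y = 0.
    have : i B * y *+ 2 = h - s h by rewrite hAB (quad_conjE si sy); ring.
    by rewrite shE c1 tofrac1 rmorph1 mul1r subrr -mulr_natr => /eqP; rewrite mulf_eq0 (negPf E2) orbF => /eqP.
  rewrite hAB B0 addr0 vpt brs; move: (ord_pt b A) => z; case: (p b) => //; rewrite mulr2n.
  by move: z; clear => z; lia.
- exists true => b brs; have := oddE b brs.
  have A0 : i A = 0.
    have : i A *+ 2 = h + s h by rewrite hAB (quad_conjE si sy); ring.
    rewrite shE c1 polyCN tofracN rmorphN tofrac1 rmorph1 mulN1r subrr -mulr_natr => /eqP.
    by rewrite mulf_eq0 (negPf E2) orbF => /eqP.
  have iB0 : i B != 0 by apply: contraNneq h0 => iB; rewrite hAB A0 iB mul0r addr0.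
  rewrite hAB A0 add0r (valM (oP _)) // ordp_y vpt brs; move: (ord_pt b B) => z.
  case: (p b) => //; rewrite mulr2n; by move: z; clear => z; lia.
Qed.

(** Off the ramification points an invariant divisor is a combination of fibres, which contribute
    principal line divisors; at the roots only the parity of the multiplicity matters, by
    [princ_double]. *)
Lemma invariant_half D : deg D = 0 -> (forall Q, coeff (t Q) D = coeff Q D) ->
  exists p, princ (D - half p).
Proof.
move=> D0 tD; pose n a := coeff (pt a) D.
have xcE P : exists a, P = pinf \/ (P = pt a \/ P = t (pt a)).
  by case: (pcases P) => [->|[a aP]]; [exists 0; left|exists a; right].
(* [xc P] is the abscissa of P, with an arbitrary value at infinity. *)
have [xc xcP] := choice xcE.
pose A := [seq a <- undup [seq xc P | P <- dom D] | a \notin rs].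
have uA : uniq A by rewrite filter_uniq ?undup_uniq.
have DE : D = \sum_(a <- A) line_divisor a *~ n a + \sum_(a <- rs) half_point a *~ n a.
  set X := \sum_(a <- A) _; set Y := \sum_(a <- rs) _.
  apply: eq_off_inf => [|Q Qinf].
    rewrite D0 raddfD /= /X /Y !raddf_sum /= !big1 ?addr0 // => a _.
      by rewrite raddfMz /= deg_half_point mul0rz.
    by rewrite raddfMz /= deg_line mul0rz.
  have tXY P : coeff (t P) (X + Y) = coeff P (X + Y).
    rewrite !coeffD /X /Y !raddf_sum /=; congr (_ + _).
      by apply: eq_bigr => a _; rewrite !raddfMz /= !line_divisorE tE si.
    by rewrite big_seq [RHS]big_seq; apply: eq_bigr => a ars; rewrite !raddfMz /= coeff_half_point_conj.
  have side b : coeff (pt b) D = coeff (pt b) (X + Y).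
    rewrite coeffD /X /Y !raddf_sum /=.
    rewrite (eq_bigr (fun a => (a == b)%:R * (n a *+ (b \in rs).+1))); last first.
      by move=> a _; rewrite raddfMz /= line_divisorE vpt ord_pt_XsubC mulrzz; ring.
    rewrite (sum_delta (fun a => n a *+ (b \in rs).+1) b uA).
    rewrite (eq_bigr (fun a => (a == b)%:R * n a)); last first.
      by move=> a _; rewrite raddfMz /= coeff_half_point mulrzz.
    rewrite (sum_delta n b rs_uniq) mem_filter mem_undup.
    have [brs|brs] /= := boolP (b \in rs); first by rewrite add0r.
    rewrite mulr1n addr0; have [//|bA] := boolP (b \in _); rewrite mulr0n.
    apply: coeff_outdom; apply: contra bA => bD; apply/mapP; exists (pt b) => //.
    case: (xcP (pt b)) => [e|[e|e]]; first by move: (pt_inf b); rewrite e eqxx.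
      by apply: pt_inj; left.
    by apply/esym/pt_inj; right.
  by case: (pcases Q) Qinf => [->|[b [->|->]] _]; rewrite ?eqxx // tD tXY.
pose p a := odd `|n a|%N; exists p; rewrite {1}DE -addrA.
apply: princD; first by apply: princ_sum => a _; exact: princMz (princ_line a).
rewrite /half [X in _ - X]big_mkcond -sumrB big_seq; apply: princ_sum => a ars.
have [m mE] : exists m : int, n a = m * 2 + (p a)%:R by exact: int_parity.
have -> : half_point a *~ n a - (if p a then half_point a else 0) = half_point a *+ 2 *~ m.
  rewrite mE mulrzDr (mulrC m) mulrzA -[half_point a *~ 2]/(half_point a *+ 2).
  by case: (p a); rewrite ?mulr1z ?mulr0z ?addrK ?subr0 ?addr0.
exact: princMz (princ_double ars).
Qed.

(* Hilbert 90 for the hyperelliptic involution. *)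
Lemma torsion_half D : deg D = 0 -> princ (D *+ 2) -> exists p, princ (D - half p).
Proof.
move=> D0 D2; have := princD D2 (princN (norm_princ D0)).
(* Subtracting D + t D from 2 D leaves D - t D, the divisor of g0. The norm of g0 then has trivial
   divisor, so it is a constant c, and division by a square root of c brings the norm to 1. *)
rewrite opprD mulr2n addrA addrK => -[g0 g00 g0E].
have [c cE] : exists c, i (N g0) = i (toF c%:P).
  apply: ff_const => [|P]; first by rewrite fmorph_eq0 (quad_norm_neq0 NE).
  rewrite -NE (valM (oP P)) ?fmorph_eq0 // -tE -!g0E !coeffB !(coeff_push tK tK) tK.
  by rewrite addrC subrKA subrr.
have c0 : c != 0.
  by rewrite -polyC_eq0 -tofrac_eq0 -(fmorph_eq0 i) -cE fmorph_eq0 (quad_norm_neq0 NE).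
have [e eE] : exists e, e ^+ 2 = c.
  have [|e] := @closed_rootP k ('X^2 - c%:P) _; rewrite ?size_XnsubC //.
  by rewrite /root !hornerE subr_eq0 => /eqP; exists e.
have e0 : e != 0 by apply: contraNneq c0 => e0; rewrite -eE e0 expr0n.
pose ie : E := i (toF e%:P).
have ie0 : ie != 0 by rewrite fmorph_eq0 tofrac_eq0 polyC_eq0.
pose g := g0 / ie; have gn0 : g != 0 by rewrite mulf_neq0 ?invr_eq0.
have gs : g * s g = 1.
  rewrite /g fmorph_div si mulf_div NE cE -expr2 -eE polyC_exp tofracXn rmorphXn divff //.
  by rewrite expf_neq0.
have gE P : ordp P g = coeff P D - coeff (t P) D.
  rewrite (valF (oP P)) // /ie ordp_cst // subr0 -g0E coeffB (coeff_push tK tK) //.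
have [h h0 shE] : exists2 h, h != 0 & s h = g * h.
  (* The standard solution 1 + s g fails only for g = -1, which is s y / y. *)
  have [e1|e1] := eqVneq (1 + s g) 0; last first.
    by exists (1 + s g) => //; rewrite rmorphD rmorph1 (quad_conjK span si sy) mulrDr gs mulr1 addrC.
  exists y => //; rewrite sy -[in LHS](mul1r y) -mulNr; congr (_ * _).
  have sg : s g = -1 by apply/eqP; rewrite -addr_eq0 addrC e1.
  by rewrite -(quad_conjK span si sy g) sg rmorphN1.
have [H H0 HE] := divisor_exists h0.
(* As s h = g h, the divisor of h compensates the defect D - t D of invariance. *)
have [|Q|p pP] := @invariant_half (D + H); first by rewrite raddfD /= D0 H0.
  rewrite !coeffD !HE tE shE (valM (oP Q)) // gE; ring.
exists p; have -> : D - half p = D + H - half p - H by rewrite addrAC [D + H - H]addrK.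
by apply: princD => //; apply: princN; exists h.
Qed.

End Divisors.

Definition funfield_base (k : fieldType) (f p : {poly k}) : funfield f :=
  qpolyC (curve_poly f) (FracField.tofrac p).

Definition point_diff (T : choiceType) (Q P : T) : {freeg T} := << P >> - << Q >>.

Section CurvePoints.
Variables (k : closedFieldType) (f : {poly k}) (rs : seq k).
Hypotheses (k2 : (2%:R : k) != 0) (rs_uniq : uniq rs) (rs_odd : odd (size rs)).
Hypotheses (f0 : f != 0) (f_split : f = lead_coef f *: \prod_(a <- rs) ('X - a%:P)).
Local Notation toF := (@FracField.tofrac {poly k}).
Local Notation E := (ffield k2 rs_uniq rs_odd f0 f_split).
Local Notation i := (ff_base k2 rs_uniq rs_odd f0 f_split).

Let ordp (P : Defs.point f) : E -> int := ord_at P.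

(** The point at infinity and the points above the roots are singled out by signs of the orders of X
    and X - a. Automorphisms of k permute these functions, so the action on the points follows from
    the characterization, however the points were obtained. *)
Lemma curve_points : exists (pinf : Defs.point f) (pt : k -> Defs.point f),
  [/\ pinf (funfield_base f 'X) < 0, forall P : Defs.point f, P (funfield_base f 'X) < 0 -> P = pinf,
      forall a, 0 < pt a (funfield_base f ('X - a%:P)) &
      forall a (P : Defs.point f), a \in rs -> 0 < P (funfield_base f ('X - a%:P)) -> P = pt a] /\
  [/\ forall D : divisor f, deg D = 0 -> D *+ 2 \in @principal _ f ->
        exists p : pred k, D - \sum_(a <- rs | p a) point_diff pinf (pt a) \in @principal _ f,
      forall a, a \in rs -> point_diff pinf (pt a) *+ 2 \in @principal _ f &
      forall p : pred k, \sum_(a <- rs | p a) point_diff pinf (pt a) \in @principal _ f <->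
        exists b, {in rs, forall a, p a = b}].
Proof.
have nsq := f_nsq k2 rs_uniq rs_odd f0 f_split.
have yE := ff_yE k2 rs_uniq rs_odd f0 f_split.
have span := @ff_span k f rs k2 rs_uniq rs_odd f0 f_split.
have [s [si sy]] := quad_conj_exists yE span nsq.
have [N [NE NAB]] := quad_norm_exists yE span si sy.
have ordp_inj : injective ordp by move=> P Q; exact: val_inj.
have ordp_dval P : @is_dvaluation E (ordp P) by case: P => v /= /asboolP[].
have ordp_cst P c : c != 0 -> ordp P (i (toF c%:P)) = 0.
  by move=> c0; case: P => v /= /asboolP[_]; apply.
have ordp_onto (v : E -> int) : @is_dvaluation E v ->
    (forall c, c != 0 -> v (i (toF c%:P)) = 0) -> exists P, ordp P = v.
  move=> dv vc; have vP : `[< is_point (v : funfield f -> int) >] by apply/asboolP.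
  by exists (Point vP).
have [t [pinf [pt [[tE tK tinf tpt] [pcases vinf vpt pt_inf pt_inj]]]]] :=
  point_parametrization k2 rs_uniq rs_odd f0 f_split yE span ordp_inj ordp_dval ordp_cst
    ordp_onto si sy NE NAB.
have ordX a : 0 <= ord_pt a (toF 'X) by rewrite ord_pt_poly ?polyX_eq0.
have vX a : 0 <= ordp (pt a) (i (toF 'X)) by rewrite vpt pmulrn_lge0.
have vXa a b : ordp (pt b) (i (toF ('X - a%:P))) = (a == b)%:R *+ (b \in rs).+1.
  by rewrite vpt ord_pt_XsubC.
have princE (D : divisor f) : princ ordp D <-> D \in @principal _ f.
  split=> [[h h0 hE]|/asboolP[h uh hE]].
    by apply/asboolP; exists h => //; rewrite -[_ \is a _]/((h : E) \is a GRing.unit) unitfE.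
  by exists h => //; move: uh; rewrite -[_ \is a _]/((h : E) \is a GRing.unit) unitfE.
exists pinf, pt; split; split.
- have -> : pinf (funfield_base f 'X) = ord_inf (toF 'X) * 2 by exact: vinf.
  by rewrite ord_inf_poly ?polyX_eq0 // size_polyX.
- move=> P; case: (pcases P) => [->//|[a [->|->]]]; last rewrite -[X in X < 0]/(ordp _ (i _)) tE si.
    by rewrite -[X in X < 0]/(ordp _ (i _)) ltNge vX.
  by rewrite ltNge vX.
- by move=> a; rewrite -[X in 0 < X]/(ordp _ (i _)) vXa eqxx; case: (a \in rs).
- move=> a P ars; rewrite -[X in 0 < X]/(ordp _ (i _)); case: (pcases P) => [->|[b [->|->]]].
  + by rewrite vinf ord_inf_XsubC.
  + by rewrite vXa; have [->|] := eqVneq a b; rewrite ?mul0rn.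
  + by rewrite tE si vXa; have [<-|] := eqVneq a b; rewrite ?mul0rn // => _; apply/eqP; rewrite tpt.
- move=> D D0 /princE D2.
  have [p pP] := torsion_half k2 rs_uniq rs_odd f0 f_split yE span ordp_dval si sy NE NAB
    tE tK tinf tpt pcases vinf vpt pt_inf pt_inj D0 D2.
  by exists p; apply/princE.
- by move=> a ars; apply/princE; exact: (princ_double si tE tK tinf tpt pcases vinf vpt pt_inf pt_inj).
- move=> p; split=> [/princE|[b pb]].
    exact: (half_princ k2 rs_uniq rs_odd f0 f_split yE span ordp_dval si sy NE NAB tE tK tinf tpt vinf vpt pt_inf pt_inj).
  apply/princE; case: b pb => pb.
    exact: (princ_half_all rs_uniq f0 f_split yE span ordp_dval si sy NE tE tK tinf tpt pcases vinf vpt pt_inf pt_inj).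
  rewrite big_seq_cond big1 => [|a /andP[ars]]; first exact: princ0.
  by rewrite pb.
Qed.

End CurvePoints.

(** * Galois action on divisor classes *)

Section PicClasses.
Variables (k : fieldType) (f : {poly k}).
Implicit Types D : divisor f.

Definition to_pic D : Pic f := \pi_{ideal_quot @principal _ f}%qT D.

Lemma to_picD D D' : to_pic (D + D') = to_pic D + to_pic D'.
Proof. by rewrite /to_pic -[RHS]Quotient.pi_add. Qed.

Lemma to_pic_eq D D' : to_pic D = to_pic D' <-> D - D' \in @principal _ f.
Proof. by split=> [/eqP|h]; [|apply/eqP]; rewrite -Quotient.idealrBE. Qed.

Lemma to_pic0 : to_pic 0 = 0.
Proof. by apply: (addrI (to_pic 0)); rewrite addr0 -to_picD addr0. Qed.

Lemma to_pic_eq0 D : to_pic D = 0 <-> D \in @principal _ f.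
Proof. by rewrite -to_pic0 to_pic_eq subr0. Qed.

Lemma to_pic_sum I (r : seq I) (p : pred I) (G : I -> divisor f) :
  to_pic (\sum_(j <- r | p j) G j) = \sum_(j <- r | p j) to_pic (G j).
Proof. by apply: (big_morph _ to_picD); exact: to_pic0. Qed.

Lemma to_pic_repr (c : Pic f) : to_pic (generic_quotient.repr c) = c.
Proof. exact: reprK. Qed.

Lemma funfield_map_base (s : {rmorphism k -> k}) (p : {poly k}) : map_poly s f = f ->
  funfield_map s (funfield_base f p) = funfield_base f (map_poly s p).
Proof.
move=> fs; rewrite /funfield_base -[in LHS]in_qpolyC (in_funfield_map _ fs) map_polyC /=.
by rewrite fraction_map_tofrac in_qpolyC.
Qed.

End PicClasses.

Section GaloisOnPoints.
Variables (K : fieldType) (iK : {rmorphism K -> algC}) (f : {poly K}).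
Local Notation fC := (map_poly iK f).
Implicit Types (s : autover iK) (P : Defs.point fC).

Lemma point_actE s P h : point_act s P h = P (funfield_map (aut_inv s) h).
Proof. by []. Qed.

Lemma point_actK s : cancel (point_act s) (@point_act K iK f (autover_inv s)).
Proof.
move=> P; apply/val_inj/funext => h /=; congr (ord_at P _).
apply: (funfield_mapK (aut_inv_fC f (autover_inv s)) (aut_inv_fC f s)).
exact: (@aut_invK _ _ _ (autover_inv s)).
Qed.

Lemma point_actVK s : cancel (@point_act K iK f (autover_inv s)) (point_act s).
Proof.
move=> P; apply/val_inj/funext => h /=; congr (ord_at P _).
apply: (funfield_mapK (aut_inv_fC f s) (aut_inv_fC f (autover_inv s))).
exact: (@autK _ _ _ (autover_inv s)).
Qed.

Lemma coeff_divisor_act s (D : divisor fC) Q :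
  coeff Q (divisor_act s D) = coeff (point_act (autover_inv s) Q) D.
Proof. exact: (coeff_push (point_actK s) (point_actVK s)). Qed.

Lemma divisor_actD s (D D' : divisor fC) :
  divisor_act s (D + D') = divisor_act s D + divisor_act s D'.
Proof. exact: (pushD (point_actK s) (point_actVK s)). Qed.

Lemma divisor_act_principal s (D : divisor fC) : D \in @principal _ fC ->
  divisor_act s D \in @principal _ fC.
Proof.
move=> /asboolP[h uh hE]; apply/asboolP; exists (funfield_map (Defs.aut s) h).
  exact: (funfield_map_unit (aut_fC f s)).
move=> P; rewrite coeff_divisor_act hE point_actE.
congr (ord_at P _); rewrite /funfield_map; congr (in_qpoly _ _).
apply: eq_map_poly => x; rewrite /fraction_map.
have e : aut_inv (autover_inv s) =1 Defs.aut s.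
  by move=> z; rewrite -[in LHS](autK s z) (@autK _ _ _ (autover_inv s)).
by congr (FracField.tofrac _ / FracField.tofrac _); apply: eq_map_poly.
Qed.

Lemma divisor_actN s (D : divisor fC) : divisor_act s (- D) = - divisor_act s D.
Proof. by apply/eqP/freeg_eqP => Q; rewrite coeffN !coeff_divisor_act coeffN. Qed.

Lemma Pic_act_to s (D : divisor fC) : Pic_act s (to_pic D) = to_pic (divisor_act s D).
Proof.
apply/to_pic_eq; rewrite -divisor_actN -divisor_actD.
by apply: divisor_act_principal; apply/to_pic_eq; exact: to_pic_repr.
Qed.

Lemma Pic_actD s : {morph @Pic_act K iK f s : c d / c + d}.
Proof.
move=> c d; rewrite -(to_pic_repr c) -(to_pic_repr d) -to_picD !Pic_act_to.
by rewrite divisor_actD to_picD.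
Qed.

Lemma Pic_act0 s : @Pic_act K iK f s 0 = 0.
Proof. by apply: (addrI (Pic_act s 0)); rewrite addr0 -Pic_actD addr0. Qed.

Lemma divisor_act_diff s P Q :
  divisor_act s (point_diff Q P) = point_diff (point_act s Q) (point_act s P).
Proof.
apply/eqP/freeg_eqP => R; rewrite coeff_divisor_act !coeffB !coeffU.
by rewrite -!(can2_eq (point_actK s) (point_actVK s)).
Qed.

End GaloisOnPoints.

Section TwoTorsion.
Variables (K : fieldType) (iK : {rmorphism K -> algC}) (f : {poly K}) (rs : seq algC).
Local Notation fC := (map_poly iK f).
Hypotheses (rs_uniq : uniq rs) (rs_odd : odd (size rs)) (f0 : f != 0).
Hypothesis f_split : fC = lead_coef fC *: \prod_(a <- rs) ('X - a%:P).

Lemma aut_rs (s : autover iK) a : a \in rs -> s a \in rs.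
Proof.
have rootE z : (z \in rs) = root fC z.
  by rewrite f_split rootZ ?lead_coef_eq0 ?map_poly_eq0 // root_prod_XsubC.
by rewrite !rootE => ra; rewrite -(aut_fC f s) fmorph_root.
Qed.

Lemma two_torsion : exists e : algC -> Pic fC,
  [/\ forall c, J2 iK f c <-> exists p : pred algC, c = \sum_(a <- rs | p a) e a,
      {in rs, forall a, e a *+ 2 = 0},
      forall p : pred algC, \sum_(a <- rs | p a) e a = 0 <-> exists b, {in rs, forall a, p a = b} &
      forall s, {in rs, forall a, Pic_act s (e a) = e (s a)}].
Proof.
have fC0 : fC != 0 by rewrite map_poly_eq0.
have C2 : (2%:R : algC) != 0 by rewrite pnatr_eq0.
have [pinf [pt [[inf1 inf2 pt1 pt2] [tor dbl rel]]]] := curve_points C2 rs_uniq rs_odd fC0 f_split.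
exists (fun a => to_pic (point_diff pinf (pt a))).
have sumE (p : pred algC) : \sum_(a <- rs | p a) to_pic (point_diff pinf (pt a)) =
    to_pic (\sum_(a <- rs | p a) point_diff pinf (pt a)) by rewrite to_pic_sum.
have double a : a \in rs -> to_pic (point_diff pinf (pt a)) *+ 2 = 0.
  by move=> ars; rewrite mulr2n -to_picD -mulr2n; apply/to_pic_eq0; exact: dbl.
split=> // [c|p|s a ars].
- split=> [[[D D0 <-] D2]|[p ->]].
    have [|p pP] := tor D D0; last by exists p; rewrite sumE; apply/to_pic_eq.
    by apply/to_pic_eq0; rewrite mulr2n to_picD -mulr2n.
  split; last first.
    by rewrite -sumrMnl big_seq_cond big1 // => a /andP[ars _]; exact: double.
  exists (\sum_(a <- rs | p a) point_diff pinf (pt a)); last by rewrite sumE.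
  by rewrite /= raddf_sum /= big1 // => a _; rewrite raddfB /= !degU subrr.
- by rewrite sumE to_pic_eq0 rel.
- rewrite Pic_act_to divisor_act_diff; congr (to_pic (point_diff _ _)).
    apply: inf2; rewrite point_actE funfield_map_base ?aut_inv_fC //.
    by rewrite map_polyX.
  apply: pt2; first exact: aut_rs.
  rewrite point_actE funfield_map_base ?aut_inv_fC // rmorphB /= map_polyX map_polyC /=.
  by rewrite autK.
Qed.

End TwoTorsion.

(** * Fixed points of the 2-Sylow subgroup *)

(** A maximal subgroup of a 2-group has index 2, and chi is the indicator of its complement. *)
Lemma index2_character (gT : finGroupType) (H : {group gT}) : (2.-group H)%g -> H :!=: 1%g ->
  exists chi : gT -> bool, (exists2 h, h \in H & chi h) /\
    (forall h h', h \in H -> h' \in H -> chi (h * h')%g = chi h (+) chi h').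
Proof.
move=> H2 H1; have [H1E|[M maxM _]] := maximal_exists (sub1G H); first by rewrite H1E eqxx in H1.
have MnH := p_maximal_normal H2 maxM; have nM := normal_norm MnH.
have cM : #|H / M|%g = 2%N by rewrite card_quotient // (p_maximal_index H2 maxM).
exists (fun h => h \notin M); split.
  by have /fintype.properP[_ [h hH hM]] := maxgroupp maxM; exists h.
have qE h : h \in H -> (h \in M) = (coset M h == 1%g).
  move=> hH; apply/idP/eqP; [exact: coset_id|apply: coset_idr].
  exact: (fintype.subsetP nM).
move=> h h' hH h'H; rewrite !qE ?groupM // morphM ?(fintype.subsetP nM) //=.
have [->|a1] := eqVneq (coset M h) 1%g; first by rewrite mul1g.
have [->|b1] := eqVneq (coset M h') 1%g; first by rewrite mulg1 (negPf a1).
have aQ : coset M h \in (H / M)%g by exact: mem_quotient.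
have bQ : coset M h' \in (H / M)%g by exact: mem_quotient.
have ab : coset M h = coset M h'.
  apply/eqP/negPn/negP => ab.
  have : (#|[:: 1%g; coset M h; coset M h']| <= #|(H / M)%g|)%N.
    by apply: subset_leq_card; apply/fintype.subsetP => z; rewrite !inE => /or3P[]/eqP-> //; exact: group1.
  by rewrite cM (card_uniqP _) // /= !inE !negb_or (eq_sym 1%g) a1 (eq_sym 1%g) b1 ab.
by rewrite -ab -expg2 -cM expg_cardG // eqxx.
Qed.

Section ShapiroCocycle.
Variables (gT : finGroupType) (G2 : {group gT}) (Y : finType) (to : {action gT &-> Y}).
Variables (V : zmodType) (A : set V) (act : gT -> V -> V) (e : Y -> V).
Hypotheses (G2p : (2.-group G2)%g) (Yodd : odd #|Y|).
Hypothesis AE : forall c, A c <-> exists S : {set Y}, c = \sum_(x in S) e x.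
Hypothesis e2 : forall x, e x *+ 2 = 0.
Hypothesis e0 : forall S : {set Y}, \sum_(x in S) e x = 0 -> S = finset.set0 \/ S = [set: Y]%SET.
Hypothesis actE : forall g, g \in G2 -> forall S : {set Y},
  act g (\sum_(x in S) e x) = \sum_(x | to x g^-1%g \in S) e x.
Hypothesis H1 : H1_trivial G2 A act.

Lemma sum_addb (p q : pred Y) :
  \sum_(x | p x) e x + \sum_(x | q x) e x = \sum_(x | p x (+) q x) e x.
Proof.
rewrite big_mkcond [X in _ + X]big_mkcond [RHS]big_mkcond -big_split /=; apply: eq_bigr => x _.
by case: (p x); case: (q x); rewrite /= ?addr0 ?add0r // -mulr2n e2.
Qed.

Lemma sum_opp (p : pred Y) : - \sum_(x | p x) e x = \sum_(x | p x) e x.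
Proof.
apply/eqP; rewrite eq_sym -addr_eq0 sum_addb big_pred0 // => x; exact: addbb.
Qed.

(** The sum determines a subset up to complement, and agreement at one point excludes the
    complement. *)
Lemma sum_pred_eq (p q : pred Y) y0 : p y0 = q y0 ->
  \sum_(x | p x) e x = \sum_(x | q x) e x -> p =1 q.
Proof.
move=> pq /eqP; rewrite -subr_eq0 sum_opp sum_addb => /eqP pq0 x.
have : \sum_(x in [set x | p x (+) q x]%SET) e x = 0.
  by rewrite -[RHS]pq0; apply: eq_bigl => z; rewrite inE.
case/e0 => /finset.setP E; last by have := E y0; rewrite !inE pq addbb.
by have := E x; rewrite !inE; case: (p x); case: (q x).
Qed.

(* If the stabilizer H of [b] in [G2] were nontrivial, a nontrivial character
   of H would induce (Shapiro) a cocycle supported on the orbit of [b] that is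
   not a coboundary; the fixed point [b0] makes J[2] the even part of F_2^Y. *)
Lemma H1_fixed_point : exists b0, forall b, b != b0 ->
  forall g, g \in G2 -> to b g = b -> g = 1%g.
Proof.
(* A 2-group acting on a set of odd cardinality has a fixed point. *)
have [b0 b0fix] : exists b0, forall g, g \in G2 -> to b0 g = b0.
  have acts : [acts G2, on [set: Y]%SET | to]%g.
    by apply/actsP => g _ x; rewrite !finset.in_setT.
  have := pgroup_fix_mod G2p acts; rewrite cardsT.
  have [->|[b]] := set_0Vmem ('Fix_([set: Y] | to)(G2))%g.
    by rewrite cards0 mod0n modn2 Yodd.
  by rewrite finset.in_setI => /andP[_ /afixP bfix] _; exists b.
exists b0 => b bb0 g gG bg; apply/eqP/negPn/negP => g1.
pose H := [group of 'C_G2[b | to]%g].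
have HP h : (h \in H) = (h \in G2) && (to b h == b).
  by rewrite /H /= finset.in_setI; congr (_ && _); apply/astab1P/eqP.
have H2 : (2.-group H)%g by apply: pgroupS G2p; exact: subsetIl.
have HN1 : H :!=: 1%g.
  apply/eqP => H1E; have : g \in H by rewrite HP gG bg eqxx.
  by rewrite H1E finset.in_set1 (negPf g1).
have [chi [[h0 h0H chi0] chiM]] := index2_character H2 HN1.
pose O := orbit to G2 b.
have O_G x u : u \in G2 -> (to x u \in O) = (x \in O).
  move=> uG; apply/orbitP/orbitP => -[w wG bw].
    by exists (w * u^-1)%g; rewrite ?groupM ?groupV // actM bw -actM mulgV act1.
  by exists (w * u)%g; rewrite ?groupM // actM bw.
have tr x : exists t, x \in O -> t \in G2 /\ to b t = x.
  have [/orbitP[t tG bt]|_] := boolP (x \in O); first by exists t.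
  by exists 1%g.
have [t tP] := choice tr.
(* The induced cocycle: t x carries b to x, so going from b to x u^-1, then by u to x, then back to
   b is an element of H, to which chi applies. *)
pose cx (u : gT) (x : Y) := (x \in O) && chi (t (to x u^-1) * u * (t x)^-1)%g.
have elt u x : u \in G2 -> x \in O -> (t (to x u^-1) * u * (t x)^-1)%g \in H.
  move=> uG xO; have [tG bt] := tP x xO.
  have [tG' bt'] := tP (to x u^-1%g) (etrans (O_G x u^-1%g (groupVr uG)) xO).
  rewrite HP !groupM ?groupV //=; rewrite !actM bt' -(actM to x) mulVg act1.
  by rewrite -{1}bt -actM mulgV act1.
pose c u := \sum_(x | cx u x) e x.
have sumS (p : pred Y) : \sum_(x in [set x | p x]%SET) e x = \sum_(x | p x) e x.
  by apply: eq_bigl => z; rewrite inE.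
have actP u p : u \in G2 -> act u (\sum_(x | p x) e x) = \sum_(x | p (to x u^-1%g)) e x.
  by move=> uG; rewrite -sumS actE //; apply: eq_bigl => x; rewrite inE.
have [| |m /AE[S ->] mE] := H1 (c := c).
- by move=> u uG; apply/AE; exists [set x | cx u x]%SET; rewrite sumS.
- move=> u v uG vG; rewrite /c actP // sum_addb; apply: eq_bigl => x.
  rewrite /cx (O_G x v^-1%g) ?groupV //; have [xO /=|//] := boolP (x \in O).
  rewrite -chiM ?elt // ?O_G ?groupV //; congr (chi _).
  by rewrite invMg actM !mulgA mulgKV.
have cE u : u \in G2 -> cx u =1 fun x => (to x u^-1%g \in S) (+) (x \in S).
  (* Neither side contains the fixed point b0, so the coboundary relation in J[2] lifts to an
     equality of subsets. *)
  move=> uG; apply: (sum_pred_eq (y0 := b0)); last first.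
    by rewrite -/(c u) mE // actE // -sum_addb sum_opp.
  have b0O : (b0 \in O) = false.
    apply/negP => /orbitP[w wG bw]; case/eqP: bb0.
    by have := b0fix _ (groupVr wG); rewrite -{1}bw -actM mulgV act1.
  by rewrite /cx b0O b0fix ?groupV // addbb.
have bO : b \in O by exact: orbit_refl.
have [tbG tb] := tP b bO.
have tbH : t b \in H by rewrite HP tbG tb eqxx.
have /andP[h0G /eqP h0b] : (h0 \in G2) && (to b h0 == b) by rewrite -HP.
have h0Vb : to b h0^-1%g = b by rewrite -[in LHS]h0b -actM mulgV act1.
(* At u = h0 and x = b the coboundary vanishes, but the cocycle takes the value chi h0: t b lies in
   H, and conjugation by it does not affect chi. *)
have := cE h0 h0G b; rewrite h0Vb addbb /cx bO h0Vb /= !chiM ?groupM ?groupV //.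
have := chiM _ _ tbH (groupVr tbH); rewrite mulgV.
have := chiM 1%g 1%g (group1 H) (group1 H); rewrite mulg1 chi0.
by case: (chi 1%g) (chi (t b)) (chi (t b)^-1%g) => [] [] [].
Qed.

End ShapiroCocycle.

(** A 2-element has a conjugate in G2, where a nontrivial element fixes no point other than b0; the
    conjugating element therefore carries every fixed point of t to b0. *)
Lemma H1_free2 (gT : finGroupType) (G2 : {group gT}) (Y : finType)
    (to : {action gT &-> Y}) (b0 : Y) : (2.-Sylow([set: gT]) G2)%g ->
  (forall b, b != b0 -> forall g, g \in G2 -> to b g = b -> g = 1%g) ->
  forall t y z, (2.-elt t)%g -> t != 1%g -> to y t = y -> to z t = z -> y = z.
Proof.
move=> sylG2 free t y z t2 t1 ty tz; apply/eqP/negPn/negP => yz.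
have [x _ tx] := Sylow_Jsub sylG2 (finset.subsetT <[t]>%G) t2.
have txG : (t ^ x)%g \in G2 by rewrite (fintype.subsetP tx) // memJ_conjg cycle_id.
have fixx w : to w t = w -> to (to w x) (t ^ x)%g = to w x.
  by move=> tw; rewrite -actM -conjgC actM tw.
have t1x : (t ^ x)%g != 1%g by rewrite conjg_eq1.
have same w : to w t = w -> to w x = b0.
  move=> tw; apply/eqP/negPn/negP => wb.
  by case/eqP: t1x; exact: free wb _ txG (fixx w tw).
by case/eqP: yz; apply: (act_inj to x); rewrite /= !same.
Qed.

Lemma big_seq_sub (R : Type) (idx : R) (op : Monoid.com_law idx) (T : choiceType)
    (r : seq T) (P : pred T) (F : T -> R) : uniq r ->
  \big[op/idx]_(x <- r | P x) F x = \big[op/idx]_(y : seq_sub r | P (val y)) F (val y).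
Proof.
move=> ur; rewrite -(big_map val P F); apply: perm_big; apply: uniq_perm => //.
  by rewrite map_inj_uniq ?index_enum_uniq //; exact: val_inj.
move=> x; apply/idP/mapP => [xr|[y _ ->]]; last exact: valP.
by exists (SeqSub xr); rewrite // mem_index_enum.
Qed.

(** * The roots of f lie in the 2-torsion field *)

Section RootsOfCurve.
Variables (K : fieldExtType rat) (f : {poly K}) (d : nat).
Hypotheses (f_sep : separable_poly f) (f_deg : size f = d.+1) (d_odd : odd d) (d_ge3 : (3 <= d)%N).
Variable iK : {rmorphism K -> algC}.
Local Notation fC := (map_poly iK f).

Let f0 : f != 0.
Proof. by rewrite -size_poly_eq0 f_deg. Qed.

Lemma complex_roots : exists rs : seq algC,
  [/\ uniq rs, size rs = d & fC = lead_coef fC *: \prod_(a <- rs) ('X - a%:P)].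
Proof.
have [rs rsE] := closed_field_poly_normal fC.
have l0 : lead_coef fC != 0 by rewrite lead_coef_eq0 map_poly_eq0.
exists rs; split=> //.
  have := f_sep; rewrite -(separable_map iK) rsE -separable_prod_XsubC.
  by rewrite (eqp_separable (eqp_scale _ l0)).
by have := congr1 (fun p : {poly algC} => size p) rsE; rewrite size_scale // size_prod_XsubC size_map_poly f_deg => -[].
Qed.

Variables (L : splittingFieldType K) (iL : {rmorphism L -> algC}).
Hypotheses (iLK : forall x : K, iL x%:A = iK x) (L_def : range iL = J2_field iK f).

(** An automorphism s that is trivial on J[2] satisfies e (s a) = e a, so the set {a, s a} has sum 0
    if s a <> a. It would then contain all the roots, which d >= 3 forbids; hence the roots lie in L
    = K(J[2]). *)
Lemma two_torsion_roots : exists (rs : seq L) (e : L -> Pic fC),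
  [/\ uniq rs, size rs = d,
      map_poly (in_alg L) f = (lead_coef f)%:A *: \prod_(x <- rs) ('X - x%:P) &
  [/\ forall c, J2 iK f c <-> exists p : pred L, c = \sum_(x <- rs | p x) e x,
      {in rs, forall x, e x *+ 2 = 0},
      forall p : pred L, \sum_(x <- rs | p x) e x = 0 <-> exists b, {in rs, forall x, p x = b} &
      forall (t : autover iK) (g : gal_of {:L}), (forall x, t (iL x) = iL (g x)) ->
        {in rs, forall x, Pic_act t (e x) = e (g x)}]].
Proof.
have [rC [rC_uniq rC_size rC_split]] := complex_roots.
have rC_odd : odd (size rC) by rewrite rC_size.
have [e [eJ e2 e0 eact]] := two_torsion rC_uniq rC_odd f0 rC_split.
have inL a : a \in rC -> exists x, iL x = a.
  move=> ar; suff : J2_field iK f a by rewrite -L_def => -[x _ <-]; exists x.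
  move=> s sJ; apply/eqP/negPn/negP => sa.
  have ea : e (s a) = e a.
    rewrite -eact //; apply: sJ; apply/eJ; exists (pred1 a).
    rewrite -big_filter; have -> : [seq x <- rC | pred1 a x] = [:: a].
      by apply/perm_small_eq => //; apply: uniq_perm; rewrite ?filter_uniq // => x;
         rewrite mem_filter /= inE; case: eqP => [->|].
    by rewrite big_seq1.
  have sar : s a \in rC by exact: (aut_rs f0 rC_split).
  pose p := [pred x | (x == a) || (x == s a)].
  have pE : perm_eq [seq x <- rC | p x] [:: a; s a].
    apply: uniq_perm; rewrite ?filter_uniq //= ?inE ?andbT 1?eq_sym // => x.
    by rewrite mem_filter /= !inE; case: eqP => [->|_] /=; [rewrite ar|case: eqP => [->|]].
  have /e0[b pb] : \sum_(x <- rC | p x) e x = 0.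
    by rewrite -big_filter (perm_big _ pE) big_cons big_seq1 ea; exact: (e2 a ar).
  have bE : b = true by rewrite -(pb a ar) /= eqxx.
  have : (size rC <= size [:: a; s a])%N.
    by apply: uniq_leq_size => // x xr; have := pb x xr; rewrite bE /= !inE.
  by rewrite rC_size leqNgt d_ge3.
have inL' a : exists x, a \in rC -> iL x = a.
  by have [/inL[x xE]|_] := boolP (a \in rC); [exists x|exists 0].
have [g gP] := choice inL'.
have [rs rsD] : exists rs, rs = map g rC by exists (map g rC).
have rsE : map iL rs = rC by rewrite rsD -map_comp -[RHS]map_id; apply/eq_in_map => a ar; exact: gP.
have rsP x : (x \in rs) = (iL x \in rC) by rewrite -rsE mem_map //; exact: fmorph_inj.
have gK x : x \in rs -> g (iL x) = x.
  by rewrite rsP => xr; apply: (fmorph_inj iL); exact: gP.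
have sumE (p : pred L) : \sum_(x <- rs | p x) e (iL x) = \sum_(a <- rC | p (g a)) e a.
  by rewrite -[in RHS]rsE big_map big_seq_cond [RHS]big_seq_cond; apply: eq_bigl => x;
     case: (boolP (x \in rs)) => //= /gK ->.
have sumE' (p : pred algC) : \sum_(a <- rC | p a) e a = \sum_(x <- rs | p (iL x)) e (iL x).
  by rewrite -[in LHS]rsE big_map.
exists rs, (fun x => e (iL x)); split.
- by apply: (map_uniq (f := iL)); rewrite rsE.
- by rewrite rsD size_map.
- apply: (map_poly_inj iL); rewrite -map_poly_comp map_polyZ rmorph_prod /=.
  have -> : map_poly (iL \o in_alg L) f = fC by apply: eq_map_poly => x /=; exact: iLK.
  rewrite rC_split lead_coef_map iLK; congr (_ *: _); rewrite -[in LHS]rsE big_map.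
  by apply: eq_bigr => x _; rewrite rmorphB /= map_polyX map_polyC.
split.
- move=> c; rewrite eJ; split=> -[p ->]; first by exists (p \o iL); rewrite sumE'.
  by exists (p \o g); rewrite sumE.
- by move=> x; rewrite rsP => /e2.
- move=> p; rewrite sumE e0; split=> -[b pb]; exists b => x.
    by move=> xr; have := pb (iL x); rewrite -rsP => /(_ xr); rewrite gK.
  by move=> xr; apply: pb; rewrite rsD map_f.
- by move=> t h th x; rewrite rsP => xr; rewrite eact // th.
Qed.

End RootsOfCurve.

Section RootClasses.
Variables (K : fieldExtType rat) (f : {poly K}).
Variables (iK : {rmorphism K -> algC}) (L : splittingFieldType K) (iL : {rmorphism L -> algC}).
Variables (rs : seq L) (e : L -> Pic (map_poly iK f)).
Hypotheses (f_size : (1 < size f)%N) (rs_uniq : uniq rs) (rs_odd : odd (size rs)).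
Hypothesis f_split : map_poly (in_alg L) f = (lead_coef f)%:A *: \prod_(x <- rs) ('X - x%:P).
Hypothesis eJ : forall c, J2 iK f c <-> exists p : pred L, c = \sum_(x <- rs | p x) e x.
Hypothesis e2 : {in rs, forall x, e x *+ 2 = 0}.
Hypothesis e0 : forall p : pred L, \sum_(x <- rs | p x) e x = 0 <-> exists b, {in rs, forall x, p x = b}.
Hypothesis eact : forall (t : autover iK) (g : gal_of {:L}), (forall x, t (iL x) = iL (g x)) ->
  {in rs, forall x, Pic_act t (e x) = e (g x)}.
Local Notation Y := (seq_sub rs).
Local Notation to := (root_action f_size f_split).

Definition root_class (y : Y) : Pic (map_poly iK f) := e (val y).

Lemma card_roots : #|{: Y}| = size rs.
Proof. by rewrite card_seq_sub. Qed.

Lemma root_class2 y : root_class y *+ 2 = 0.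
Proof. exact: e2 (valP y). Qed.

Lemma J2_root_classes c : J2 iK f c <-> exists S : {set Y}, c = \sum_(x in S) root_class x.
Proof.
rewrite eJ; split=> [[p ->]|[S ->]].
  exists [set y | p (val y)]%SET; rewrite big_seq_sub //.
  by apply: eq_bigl => y; rewrite inE.
exists (fun x => if insub x is Some y then y \in S else false).
by rewrite [RHS]big_seq_sub //; apply: eq_bigl => y; rewrite valK.
Qed.

Lemma root_classes_eq0 (S : {set Y}) :
  \sum_(x in S) root_class x = 0 <-> S = finset.set0 \/ S = [set: Y]%SET.
Proof.
pose p x := if insub x is Some y then y \in S else false.
have pE (y : Y) : p (val y) = (y \in S) by rewrite /p valK.
have -> : \sum_(x in S) root_class x = \sum_(x <- rs | p x) e x.
  by rewrite [RHS]big_seq_sub //; apply: eq_bigl => y; rewrite pE.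
rewrite e0; split=> [[b pb]|[SE|SE]].
- case: b pb => pb; [right|left]; apply/finset.setP => y; rewrite !inE.
    by rewrite -pE pb ?(valP y).
  by rewrite -pE pb ?(valP y).
- by exists false => x xr; rewrite -[x]/(val (SeqSub xr)) pE SE inE.
- by exists true => x xr; rewrite -[x]/(val (SeqSub xr)) pE SE inE.
Qed.

Lemma Pic_act_root_classes (t : autover iK) (g : gal_of {:L}) : (forall x, t (iL x) = iL (g x)) ->
  forall S : {set Y}, Pic_act t (\sum_(x in S) root_class x) =
    \sum_(x | to x g^-1%g \in S) root_class x.
Proof.
move=> tg S; rewrite (big_morph _ (Pic_actD t) (Pic_act0 f t)).
rewrite [RHS](reindex_inj (act_inj to g)) /=; apply: eq_big => y.
  by congr (_ \in S); apply/esym; exact: (actK to g y).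
by move=> _; rewrite /root_class (eact tg) ?(valP y).
Qed.

Hypothesis iLK : forall x : K, iL x%:A = iK x.

Lemma gal_act_lift (g : gal_of {:L}) : exists t : autover iK, (forall x, t (iL x) = iL (g x)) /\
  forall c, gal_act iK f iL g c = Pic_act t c.
Proof.
have [t tg] := gal_lift iLK g.
pose S := [set s : autover iK | forall x, s (iL x) = iL (g x)]%classic.
exists (xget (autover_id iK) S); split=> //.
by have := @xgetI _ (autover_id iK) S t tg.
Qed.

Lemma roots_free (G2 : {group gal_of {:L}}) : (2.-Sylow('Gal({:L} / 1)) G2)%g ->
  H1_trivial G2 (J2 iK f) (gal_act iK f iL) ->
  forall t y z, (2.-elt t)%g -> t != 1%g -> to y t = y -> to z t = z -> y = z.
Proof.
rewrite gal_setT => sylG2 H1.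
have Yodd : odd #|{: Y}| by rewrite card_roots.
have actE g : g \in G2 -> forall S : {set Y},
    gal_act iK f iL g (\sum_(x in S) root_class x) = \sum_(x | to x g^-1%g \in S) root_class x.
  by move=> _ S; have [t [tg ->]] := gal_act_lift g; exact: Pic_act_root_classes.
have [b0 b0P] := H1_fixed_point (pHall_pgroup sylG2) Yodd J2_root_classes root_class2
  (fun S => proj1 (root_classes_eq0 S)) actE H1.
exact: H1_free2 sylG2 b0P.
Qed.

End RootClasses.

(** * Kummer theory *)

Section KummerCharacters.
Variables (K : fieldExtType rat) (iK : {rmorphism K -> algC}).
Variables (L : splittingFieldType K) (iL : {rmorphism L -> algC}).
Hypothesis iLK : forall x : K, iL x%:A = iK x.
Implicit Types (s t u : autover iL) (a b : L).

(** The Kummer character of a, with Z/2 realized as [bool] under [addb]; any other square root gives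
    the same character. *)
Definition kummer (a : L) (s : autover iL) : bool := s (sqrtC (iL a)) != sqrtC (iL a).

Lemma sqrt_aut s a (z : algC) : z ^+ 2 = iL a -> s z = z \/ s z = - z.
Proof.
move=> za; have /eqP := congr1 (Defs.aut s) za.
by rewrite rmorphXn /= aut_fix -za eqf_sqr => /orP[/eqP|/eqP]; [left|right].
Qed.

Lemma kummer_sqrt s a (z : algC) : z ^+ 2 = iL a -> kummer a s = (s z != z).
Proof.
move=> za; have : sqrtC (iL a) ^+ 2 == z ^+ 2 by rewrite sqrtCK za.
rewrite eqf_sqr /kummer => /orP[/eqP->//|/eqP->].
by rewrite rmorphN eqr_opp.
Qed.

Lemma aut_sqrt s a (z : algC) : z ^+ 2 = iL a -> s z = (-1) ^+ kummer a s * z.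
Proof.
move=> za; rewrite (kummer_sqrt s za); case: eqP => [->|sz] /=; first by rewrite mul1r.
by case: (sqrt_aut s za) => // ->; rewrite expr1 mulN1r.
Qed.

Lemma kummer_sign s a (z : algC) (b : bool) : a != 0 -> z ^+ 2 = iL a -> s z = (-1) ^+ b * z ->
  kummer a s = b.
Proof.
move=> a0 za; have z0 : z != 0.
  by apply: contraNneq a0 => z0; rewrite -(fmorph_eq0 iL) -za z0 expr0n.
rewrite (kummer_sqrt s za) => ->; case: b => /=; last by rewrite mul1r eqxx.
by rewrite expr1 mulN1r eq_sym -addr_eq0 -mulr2n mulrn_eq0 (negPf z0).
Qed.

Lemma kummerM s a b : a != 0 -> b != 0 -> kummer (a * b) s = kummer a s (+) kummer b s.
Proof.
move=> a0 b0; have [za zb] := (sqrtCK (iL a), sqrtCK (iL b)).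
apply: (@kummer_sign s _ (sqrtC (iL a) * sqrtC (iL b))); first exact: mulf_neq0.
  by rewrite exprMn za zb rmorphM.
by rewrite rmorphM /= (aut_sqrt s za) (aut_sqrt s zb) mulrACA -signr_addb.
Qed.

Lemma kummer_sqr s c : c != 0 -> kummer (c ^+ 2) s = false.
Proof.
move=> c0; apply: (@kummer_sign s _ (iL c)); rewrite ?expf_neq0 ?rmorphXn //=.
by rewrite aut_fix mul1r.
Qed.

Lemma kummer_sqeq s a b : b != 0 -> sqeq a b -> kummer a s = kummer b s.
Proof. by move=> b0 [c c0 ->]; rewrite kummerM ?expf_neq0 // kummer_sqr // addbF. Qed.

Lemma kummer_comp s t u a : a != 0 -> u =1 s \o t -> kummer a u = kummer a s (+) kummer a t.
Proof.
move=> a0 ust; have za := sqrtCK (iL a); apply: (kummer_sign a0 za).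
rewrite ust /= (aut_sqrt t za) rmorphM rmorphXn rmorphN1 /= (aut_sqrt s za).
by rewrite mulrA -signr_addb addbC.
Qed.

Lemma kummer_conj (t : autover iK) (g : gal_of {:L}) s s' a : a != 0 ->
  (forall x, t (iL x) = iL (g x)) -> s' \o t =1 t \o s -> kummer (g a) s' = kummer a s.
Proof.
move=> a0 tg sts; have za := sqrtCK (iL a).
apply: (@kummer_sign s' _ (t (sqrtC (iL a)))); first by rewrite fmorph_eq0.
  by rewrite -rmorphXn za tg.
have := sts (sqrtC (iL a)); rewrite /= => ->.
by rewrite (aut_sqrt s za) rmorphM rmorphXn rmorphN1.
Qed.

Lemma kummer_trivial a : (forall s, kummer a s = false) -> exists c, c ^+ 2 = a.
Proof.
move=> sa; have [|c cE] := @autover_fixed K L iL (sqrtC (iL a)).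
  by move=> s; apply/eqP; have /negbT := sa s; rewrite negbK.
by exists c; apply: (fmorph_inj iL); rewrite rmorphXn /= cE sqrtCK.
Qed.

Lemma kummer_eq a b : a != 0 -> b != 0 -> (forall s, kummer a s = kummer b s) -> sqeq a b.
Proof.
move=> a0 b0 ab; have [|c cE] := @kummer_trivial (a * b).
  by move=> s; rewrite kummerM // ab addbb.
have c0 : c != 0 by apply: contraTneq (mulf_neq0 a0 b0) => c0; rewrite -cE c0 expr0n eqxx.
exists (c / b); first by rewrite mulf_neq0 ?invr_eq0.
by rewrite expr_div_n cE; field.
Qed.

Lemma kummer_prod s (I : finType) (F : I -> L) : (forall j, F j != 0) ->
  kummer (\prod_j F j) s = odd #|[set j | kummer (F j) s]%SET|.
Proof.
move=> F0; rewrite -sum1_card [X in odd X]big_mkcond /=.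
have -> : kummer (\prod_j F j) s = \big[addb/false]_j kummer (F j) s.
  suff [] : \prod_j F j != 0 /\ kummer (\prod_j F j) s = \big[addb/false]_j kummer (F j) s by [].
  elim/big_rec2: _ => [|j b p _ [p0 pE]].
    by split; [exact: oner_neq0|rewrite -(expr1n _ 2) kummer_sqr ?oner_neq0].
  by split; [exact: mulf_neq0|rewrite kummerM // pE].
rewrite (big_morph odd oddD (erefl _)) /=; apply: eq_bigr => j _.
by rewrite inE; case: (kummer (F j) s).
Qed.

End KummerCharacters.

(** * Extensions generated by square roots *)

Section SquareRootExtension.
Variables (L : fieldType) (iL : {rmorphism L -> algC}).

Lemma algC_min_poly z : exists p : {poly L},
  [/\ root (map_poly iL p) z, p != 0 & irreducible_poly p].
Proof.
have ex : exists n, `[< exists p : {poly L}, [/\ root (map_poly iL p) z, p != 0 & size p = n] >].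
  have [q [qE qm] _] := minCpolyP z.
  have qmap : map_poly iL (map_poly ratr q) = map_poly ratr q.
    by rewrite -map_poly_comp; apply: eq_map_poly => c /=; rewrite fmorph_rat.
  exists (size (map_poly ratr q : {poly L})); apply/asboolP; exists (map_poly ratr q); split=> //.
    by rewrite qmap -qE root_minCpoly.
  by rewrite -(map_poly_eq0 iL) qmap -qE monic_neq0 ?minCpoly_monic.
case: (ex_minnP ex) => n /asboolP[p [pz p0 sp]] nmin; exists p; split=> //.
apply/(subfx_irreducibleP pz p0) => q qz q0; rewrite sp; apply: nmin.
by apply/asboolP; exists q.
Qed.

(** A primitive element of the square roots in algC, through its minimal polynomial over L, gives M
    as an abstract extension; it is the splitting field of the product of the X^2 - x. *)
Lemma sqrt_extension (b : seq L) : exists (M : splittingFieldType L) (iM : {rmorphism M -> algC}) (w : seq M),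
  [/\ forall x : L, iM x%:A = iL x, map (fun y => y ^+ 2) w = map (in_alg M) b & <<1 & w>>%VS = fullv].
Proof.
pose r := map (fun x => sqrtC (iL x)) b.
have [z [a za] [ps rE]] := algC_PET r.
have [p [pz p0 pirr]] := algC_min_poly z.
pose M0 : fieldExtType L := SubFieldExtType pz pirr.
pose iM : {rmorphism M0 -> algC} := @subfx_inj _ _ iL z p.
pose z1 : M0 := subfx_root iL z p.
have iMz : iM z1 = z by exact: subfx_inj_root.
have iML (x : L) : iM x%:A = iL x.
  by apply: etrans (subfx_injZ pz p0 x 1) _; rewrite -[subfx_inj 1]/(iM 1) rmorph1 mulr1.
have gen (x : M0) : exists q, x = (map_poly (in_alg M0) q).[z1].
  by have [q qE] := subfxEroot pz p0 x; exists q.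
have [w wr] : exists w : seq M0, map iM w = r.
  exists (map (fun q : {poly rat} => (map_poly ratr q).[z1]) ps); rewrite rE -map_comp; apply: eq_map => q /=; rewrite -horner_map iMz -map_poly_comp.
  by congr (_.[_]); apply: eq_map_poly => c /=; rewrite fmorph_rat.
have w2 : map (fun y => y ^+ 2) w = map (in_alg M0) b.
  apply: (inj_map (fmorph_inj iM)); rewrite -map_comp -[RHS]map_comp.
  transitivity (map (fun y => y ^+ 2) r).
    by rewrite -wr -map_comp; apply: eq_map => y /=; rewrite rmorphXn.
  by rewrite /r -map_comp; apply: eq_map => x /=; rewrite sqrtCK; exact/esym/iML.
have zw : z1 \in <<1 & w>>%VS.
  have -> : z1 = \sum_(i < size r) w`_i *+ a i.
    apply: (fmorph_inj iM); rewrite iMz za rmorph_sum; apply: eq_bigr => i _.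
    have iw : (i < size w)%N by have := congr1 size wr; rewrite size_map => ->.
    have ri : r`_i = iM w`_i by have := nth_map 0 0 iM iw; rewrite wr.
    by rewrite rmorphMn /= ri.
  apply: memv_suml => i _; rewrite rpredMn ?seqv_sub_adjoin ?mem_nth //.
  by have := congr1 size wr; rewrite size_map => ->.
have full : <<1 & w>>%VS = fullv.
  apply/vspaceP => x; rewrite memvf; have [q ->] := gen x.
  elim/poly_ind: q => [|q c IH]; first by rewrite rmorph0 horner0 mem0v.
  rewrite rmorphD rmorphM /= map_polyX map_polyC hornerMXaddC.
  by apply: memvD; [exact: memvM|rewrite memvZ ?mem1v].
have ax : SplittingField.axiom M0.
  exists (\prod_(x <- b) ('X^2 - (x%:A : M0)%:P)).
    by apply: rpred_prod => x _; rewrite rpredB ?rpredX ?polyOverX ?polyOverC ?memvZ ?mem1v.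
  exists (w ++ map -%R w); last first.
    apply/eqP; rewrite eqEsubv subvf -{1}full; apply: adjoin_seqSr => y yw.
    by rewrite mem_cat yw.
  have -> : \prod_(x <- b) ('X^2 - (x%:A : M0)%:P) = \prod_(y <- w) ('X^2 - (y ^+ 2)%:P).
    rewrite -(big_map (in_alg M0) predT (fun y => 'X^2 - y%:P)) -w2 big_map.
    by [].
  have -> : \prod_(y <- w ++ map -%R w) ('X - y%:P) = \prod_(y <- w) (('X - y%:P) * ('X - (- y)%:P)).
    by rewrite big_cat /= big_map big_split.
  rewrite (eq_bigr (fun y => ('X - y%:P) * ('X - (- y)%:P))) ?eqpxx // => y _.
  by rewrite polyCN opprK polyC_exp -subr_sqr.
pose M : splittingFieldType L := HB.pack M0 (FieldExt_isSplittingField.Build L M0 ax).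
by exists M, (iM : {rmorphism M -> algC}), w.
Qed.

End SquareRootExtension.

Section UnramifiedSquareRoots.
Variables (K : fieldType) (L : splittingFieldType K) (iL : {rmorphism L -> algC}).

Lemma subfield_set_gen (M : fieldExtType L) (w : seq M) (A : set M) : subfield_set A ->
  (forall x : L, A x%:A) -> (forall y, y \in w -> A y) -> <<1 & w>>%VS = fullv -> forall x, A x.
Proof.
move=> [AS AV] AL Aw full x; have : x \in <<1 & w>>%VS by rewrite full memvf.
move: x; elim/last_ind: w Aw {full} => [|w y IH] Aw x.
  by rewrite Fadjoin_nil => /vlineP[c ->].
have {}IH z : z \in <<1 & w>>%VS -> A z.
  by apply: IH => v vw; apply: Aw; rewrite mem_rcons inE vw orbT.
rewrite adjoin_rcons => /Fadjoin_polyP[p pw ->].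
have Ay : A y by apply: Aw; rewrite mem_rcons mem_head.
have A0 : A 0 by have := AL 0; rewrite scale0r.
have AD u v : A u -> A v -> A (u + v).
  by case: AS => A1 AB AM Au Av; rewrite -[v]opprK -[- v]sub0r; apply: (AB _ _ Au (AB _ _ A0 Av)).
have pA j : A p`_j by apply: IH; exact: (polyOverP pw).
elim/poly_ind: p pA {pw} => [|p c IHp] pA; first by rewrite horner0.
rewrite hornerMXaddC; apply: AD; last by have := pA 0%N; rewrite coefD coefMX coefC add0r.
case: AS => _ _; apply => //; apply: IHp => j.
by have := pA j.+1; rewrite coefD coefMX coefC /= addr0.
Qed.

Lemma subfield_set_sqrt (M : fieldType) (A : set M) (y : M) : subfield_set A -> A (y ^+ 2) ->
  subfield_set [set z | exists p q, [/\ A p, A q & z = p + q * y]]%classic.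
Proof.
case=> -[A1 AB AM] AV Ay2.
have A0 : A 0 by rewrite -(subrr 1); exact: AB.
have AN z : A z -> A (- z) by move=> Az; rewrite -sub0r; exact: AB.
have AD u v : A u -> A v -> A (u + v) by move=> Au Av; rewrite -[v]opprK; apply: (AB _ _ Au (AN _ Av)).
split; first split.
- by exists 1, 0; rewrite mul0r addr0.
- move=> _ _ [p [q [Ap Aq ->]]] [p' [q' [Ap' Aq' ->]]]; exists (p - p'), (q - q').
  by split; [exact: AB|exact: AB|ring].
- move=> _ _ [p [q [Ap Aq ->]]] [p' [q' [Ap' Aq' ->]]].
  exists (p * p' + q * q' * y ^+ 2), (p * q' + q * p').
  by split; [exact: (AD _ _ (AM _ _ Ap Ap') (AM _ _ (AM _ _ Aq Aq') Ay2))|exact: (AD _ _ (AM _ _ Ap Aq') (AM _ _ Aq Ap'))|ring].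
move=> _ [p [q [Ap Aq ->]]]; have [Ay|nAy] := pselect (A y).
  exists (p + q * y)^-1, 0; split; rewrite ?mul0r ?addr0 //.
  exact: (AV _ (AD _ _ Ap (AM _ _ Aq Ay))).
have [q0|q0] := eqVneq q 0.
  by exists p^-1, 0; rewrite q0 !mul0r !addr0; split=> //; exact: AV.
have conj_neq0 u : A u -> u + q * y != 0.
  move=> Au; apply: contra_notN nAy => /eqP e; have -> : y = - u * q^-1.
    by apply: (mulfI q0); rewrite mulrCA divff // mulr1; apply/eqP; rewrite -addr_eq0 addrC e.
  exact: (AM _ _ (AN _ Au) (AV _ Aq)).
have n0 : p ^+ 2 - q ^+ 2 * y ^+ 2 != 0.
  have -> : p ^+ 2 - q ^+ 2 * y ^+ 2 = - ((p + q * y) * (- p + q * y)) by ring.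
  by rewrite oppr_eq0 mulf_neq0 // conj_neq0 //; exact: AN.
have An : A (p ^+ 2 - q ^+ 2 * y ^+ 2)^-1.
  exact: (AV _ (AB _ _ (AM _ _ Ap Ap) (AM _ _ (AM _ _ Aq Aq) Ay2))).
exists (p * (p ^+ 2 - q ^+ 2 * y ^+ 2)^-1), (- q * (p ^+ 2 - q ^+ 2 * y ^+ 2)^-1).
split; [exact: (AM _ _ Ap An)|exact: (AM _ _ (AN _ Aq) An)|].
apply: (mulfI (conj_neq0 p Ap)); rewrite divff ?conj_neq0 // -(divff n0).
move: (_ ^-1) => z; ring.
Qed.

(** The roots are adjoined one at a time, with the invariant that nonzero elements obtained so far
    have values taken on L. The step is [unramified_values], whose witness d lies in L and so in
    every intermediate field. At the end this applies to a uniformizer of M. *)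
Lemma unramified_ext_sqrt (M : splittingFieldType L) (iM : {rmorphism M -> algC}) (b : seq L) (w : seq M) :
  (forall x, x \in b -> @unramified_over K L 1%g x) ->
  map (fun y => y ^+ 2) w = map (in_alg M) b -> <<1 & w>>%VS = fullv -> unramified_ext M.
Proof.
move=> bu w2 full.
have wb y : y \in w -> exists2 x, x \in b & y ^+ 2 = x%:A.
  by move=> yw; apply/mapP; rewrite -w2; exact: (map_f (fun y => y ^+ 2)).
split=> [v dv|s sL]; last first.
  apply: (subfield_set_gen (A := fun y => s y \is Num.real)) full => //.
    split; first split=> [|x y|x y]; rewrite /= ?rmorph1 ?rmorphB ?rmorphM ?real1 //; [exact: realB|exact: realM|].
    by move=> x; rewrite /= fmorphV realV.
  move=> y /wb[x xb yx]; apply: sqr_ge0_real; rewrite -rmorphXn yx /=.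
  have [_ _ _ pos] := bu x xb.
  by apply/ltW/(pos (s \o in_alg M : {rmorphism L -> algC})) => z _; exact: sL.
have vP := dvaluation_valuation dv.
have alg (x : M) : algebraicOver (in_alg M) x.
  by have [p [p0 _ rp]] := fieldext_algebraic x; exists p.
have [e [u [e0 du vu]]] := dvaluation_restrict alg dv.
have M2 : (2%:R : M) != 0 by rewrite -(fmorph_eq0 iM) rmorph_nat pnatr_eq0.
pose V (A : set M) := forall x, A x -> x != 0 -> exists2 c : L, c != 0 & v x = v c%:A.
have [A [AS AL Aw AV]] : exists A : set M, [/\ subfield_set A, forall x : L, A x%:A,
    forall y, y \in w -> A y & V A].
  elim: w wb {w2 full} => [|y w IH] wb.
    exists [set z | exists c : L, z = c%:A]%classic; split=> //.
    - split; first split.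
      + by exists 1; rewrite scale1r.
      + by move=> _ _ [c ->] [c' ->]; exists (c - c'); rewrite scalerBl.
      + by move=> _ _ [c ->] [c' ->]; exists (c * c'); rewrite -!/(in_alg M _) rmorphM.
      by move=> _ [c ->]; exists c^-1; rewrite -!/(in_alg M _) fmorphV.
    - by move=> c; exists c.
    - by move=> _ [c ->] c0; exists c => //; apply: contraNneq c0 => ->; rewrite scale0r.
  have [z zw|A [AS AL Aw AV]] := IH; first by apply: wb; rewrite inE zw orbT.
  have [x xb yx] := wb y (mem_head _ _); have [_ x0 xu _] := bu x xb.
  have [d [_ [d0 dv0 dg]]] := xu u du.
  have Ay2 : A (y ^+ 2) by rewrite yx.
  exists [set z | exists p q, [/\ A p, A q & z = p + q * y]]%classic; split.
  - exact: subfield_set_sqrt.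
  - move=> c; exists c%:A, 0; split; rewrite ?mul0r ?addr0 //.
    by have := AL 0; rewrite scale0r.
  - have A0 : A 0 by have := AL 0; rewrite scale0r.
    have A1 : A 1 by have := AL 1; rewrite scale1r.
    move=> z; rewrite inE => /orP[/eqP->|/Aw Az]; first by exists 0, 1; rewrite add0r mul1r.
    by exists z, 0; rewrite mul0r addr0.
  move=> _ [p [q [Ap Aq ->]]] pq0.
  have y0 : y != 0.
    apply: contraNneq x0 => y0; have /eqP : x%:A = 0 :> M by rewrite -yx y0 expr0n.
    by rewrite -[_%:A]/(in_alg M x) fmorph_eq0.
  have dM0 : d%:A != 0 :> M by rewrite -[_%:A]/(in_alg M d) fmorph_eq0.
  have uv : unramified_at v (d%:A) (y ^+ 2).
    have jE : y ^+ 2 / d%:A ^+ 2 = in_alg M (x / d ^+ 2).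
      by rewrite yx -!/(in_alg M _) fmorph_div rmorphXn.
    split=> //; rewrite jE; first by rewrite vu dv0 mulr0.
    have -> : (in_alg M (x / d ^+ 2) - 1) / 4 = in_alg M ((x / d ^+ 2 - 1) / 4).
      by rewrite [RHS]fmorph_div [in RHS]rmorphB [in RHS]rmorph1 [in RHS]rmorph_nat.
    move: dg; rewrite /vge fmorph_eq0 => /orP[->//|h].
    by apply/orP; right; rewrite vu mulr_ge0 // ltW.
  have [c [Ac c0 vc]] := unramified_values vP M2 AS Ay2 y0 (AL d) uv Ap Aq pq0.
  by rewrite -vc; exact: AV.
have [x ux vx] := dval_surj dv; rewrite unitfE in ux.
have [c _ cE] := AV x (subfield_set_gen AS AL Aw full x) ux.
by exists c; rewrite -cE.
Qed.

End UnramifiedSquareRoots.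

Lemma pos_mul_eq1 (e a : int) : 0 < e -> e * a = 1 -> e = 1.
Proof. by move=> e0 ea; have a0 : 0 < a; nia. Qed.

(** * Characters trivial on an unramified extension *)

Section UnramifiedKummer.
Variables (K : fieldExtType rat) (L : splittingFieldType K) (iL : {rmorphism L -> algC}).
Variables (M : splittingFieldType L) (iM : {rmorphism M -> algC}).
Hypotheses (iML : forall x : L, iM x%:A = iL x) (Munr : unramified_ext M).
Implicit Types s t u : autover iL.
Local Notation gM := (gal_of {:M}).

Lemma extension_conjugate (i : {rmorphism M -> algC}) :
  exists nu : {rmorphism algC -> algC}, forall x, nu (iM x) = i x.
Proof.
have [b bP] := splitting_generators L; have [c cP] := extension_generators M bP.
exact: (embeddings_conjugate cP).
Qed.

Lemma extension_lift (g : gM) : exists s, forall x, s (iM x) = iM (g x).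
Proof.
have [nu nuP] := extension_conjugate (iM \o g).
have nuL x : nu (iL x) = iL x by rewrite -iML nuP /= gal_alg.
by exists (autover_of nuL) => x; exact: nuP.
Qed.

Lemma extension_fixed (x : M) : (forall g : gM, g x = x) -> exists c : L, x = c%:A.
Proof.
move=> gx; have /galois_fixedField fE := galois_char0 iM 1%AS.
apply/vlineP; rewrite -fE; apply/fixedFieldP; first exact: memvf.
by move=> g _; exact: gx.
Qed.

Lemma extension_restrict s : exists g : gM, forall x, s (iM x) = iM (g x).
Proof.
have [x xT|g _ gP] := @gal_embedding L M [set: gM]%G algC iM (Defs.aut s \o iM).
  have [|c ->] := @extension_fixed x; first by move=> g; apply: xT; rewrite finset.in_setT.
  by rewrite /= iML aut_fix.
by exists g => x; rewrite -gP.
Qed.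

Variable phi : autover iL -> bool.
Hypothesis phiM : forall s t u, u =1 s \o t -> phi u = phi s (+) phi t.
Hypothesis phi_triv : forall s, (forall y, s (iM y) = iM y) -> phi s = false.

(** y need not generate M: a valuation of L extends to M with index 1, and a real embedding of L
    extends to M with real values, where b becomes a nonzero square. *)
Lemma unramified_square_root (y : M) (b : L) : y != 0 -> y ^+ 2 = b%:A ->
  @unramified_over K L 1%g b.
Proof.
move=> y0 yb; have b0 : b != 0.
  by apply: contraNneq y0 => b0; rewrite -sqrf_eq0 yb b0 scale0r.
have fix1 (x : L) : gal_fixed 1%g x by move=> g /set1P ->; rewrite gal1_all.
split=> // [w dw|s sL].
  have alg (x : M) : exists p : {poly L}, [/\ p != 0, (size p <= (\dim {:M}).+1)%N & root (map_poly (in_alg M) p) x].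
    exact: fieldext_algebraic.
  have [e [v [e0 dv vw]]] := dvaluation_extend alg dw.
  have [x vx] := Munr.1 v dv.
  have e1 : e = 1.
    have : e * w x = 1 by rewrite -(vw x).
    exact: pos_mul_eq1.
  have vwE : v \o in_alg M = w by apply/funext => z; rewrite /= vw e1 mul1r.
  have du : is_dvaluation (v \o in_alg M) by rewrite vwE.
  have [d dP] := unramified_sqrt iL dv du b0 yb.
  by exists d; split; rewrite // -vwE.
have [c cP] := splitting_generators L.
have [nu nuP] := embeddings_conjugate cP iL s.
have real y' : nu (iM y') \is Num.real.
  apply: (Munr.2 (nu \o iM : {rmorphism M -> algC})) => x /=.
  by rewrite iML nuP; apply: sL.
have -> : s b = nu (iM y) ^+ 2 by rewrite -nuP -iML -yb -rmorphXn -rmorphXn.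
by rewrite real_exprn_even_gt0 ?real // !fmorph_eq0.
Qed.

(** phi factors through Gal(M / L). A Lagrange resolvent y for it, nonzero for some m by
    independence of characters, is multiplied by the signs of phi under the group; so b = y^2 lies
    in L and has phi as Kummer character. *)
Lemma unramified_kummer : exists b : L,
  [/\ b != 0, forall s, kummer b s = phi s & @unramified_over K L 1%g b].
Proof.
have [lift liftP] := choice extension_lift.
pose psi g := phi (lift g).
have psiE s (g : gM) : (forall x, s (iM x) = iM (g x)) -> phi s = psi g.
  move=> sg; pose t := autover_comp (autover_inv (lift g)) s.
  have tE : s =1 lift g \o t by move=> z /=; rewrite aut_invK.
  rewrite (phiM tE) (phi_triv (s := t)) ?addbF // => x.
  by rewrite /= sg -liftP autK.
have psiM g h : psi (g * h)%g = psi g (+) psi h.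
  pose u := autover_comp (lift h) (lift g).
  have uE : u =1 lift h \o lift g by [].
  rewrite -(psiE u) => [|x]; first by rewrite (phiM uE) addbC.
  by rewrite /= !liftP galM_all.
have sgn0 : (-1) ^+ psi 1%g != 0 :> M by rewrite signr_eq0.
have [m _ y0] := gal_independent_contra (E := {:M}%AS) (P := predT)
  (c_ := fun g => (-1) ^+ psi g) (x := 1%g) isT sgn0.
set y := (\sum_(g | _) _) in y0.
have hy (h : gM) : h y = (-1) ^+ psi h * y.
  rewrite /y rmorph_sum mulr_sumr [RHS](reindex_inj (mulIg h)) /=; apply: eq_bigr => g _.
  by rewrite rmorphM rmorphXn rmorphN1 psiM galM_all mulrA -signr_addb addbCA addbb addbF.
have [b yb] : exists b : L, y ^+ 2 = b%:A.
  by apply: extension_fixed => h; rewrite rmorphXn /= hy exprMn -exprM mulnC exprM sqrrN expr1n expr1n mul1r.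
have b0 : b != 0 by apply: contraNneq y0 => b0; rewrite -sqrf_eq0 yb b0 scale0r.
exists b; split=> // [s|]; last exact: unramified_square_root y0 yb.
have [h hs] := extension_restrict s.
apply: (@kummer_sign K L iL s b (iM y)) => //; first by rewrite -iML -yb rmorphXn.
by rewrite hs hy rmorphM rmorphXn rmorphN1 (psiE s h hs).
Qed.

End UnramifiedKummer.

(** * The isomorphism *)

Lemma odd_card_big (T : finType) (p : pred T) :
  odd #|[set x | p x]%SET| = \big[addb/false]_x p x.
Proof.
rewrite -sum1_card big_mkcond (big_morph odd oddD (erefl _)) /=.
by apply: eq_bigr => x _; rewrite inE; case: (p x).
Qed.

Section KummerMap.
Variables (K : fieldExtType rat) (f : {poly K}).
Variables (iK : {rmorphism K -> algC}) (L : splittingFieldType K) (iL : {rmorphism L -> algC}).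
Hypothesis iLK : forall x : K, iL x%:A = iK x.
Variables (rs : seq L) (e : L -> Pic (map_poly iK f)).
Hypotheses (f_size : (1 < size f)%N) (rs_uniq : uniq rs) (rs_odd : odd (size rs)).
Hypothesis f_split : map_poly (in_alg L) f = (lead_coef f)%:A *: \prod_(x <- rs) ('X - x%:P).
Hypothesis eJ : forall c, J2 iK f c <-> exists p : pred L, c = \sum_(x <- rs | p x) e x.
Hypothesis e2 : {in rs, forall x, e x *+ 2 = 0}.
Hypothesis e0 : forall p : pred L, \sum_(x <- rs | p x) e x = 0 <-> exists b, {in rs, forall x, p x = b}.
Hypothesis eact : forall (t : autover iK) (g : gal_of {:L}), (forall x, t (iL x) = iL (g x)) ->
  {in rs, forall x, Pic_act t (e x) = e (g x)}.
Local Notation Y := (seq_sub rs).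
Local Notation to := (root_action f_size f_split).
Local Notation A := (root_alg f).
Local Notation rc := (root_class e).
Hypothesis free2 : forall (t : gal_of {:L}) (y z : Y),
  (2.-elt t)%g -> t != 1%g -> to y t = y -> to z t = z -> y = z.

Let rc2 := root_class2 e2.
Let rc0 := root_classes_eq0 rs_uniq e0.

Let Yodd : odd #|{: Y}|.
Proof. by rewrite card_roots. Qed.

Lemma sum_classE (p : pred Y) : \sum_(y | p y) rc y = \sum_(y in [set y | p y]%SET) rc y.
Proof. by apply: eq_bigl => y; rewrite inE. Qed.

(** Equal sums leave only equal or complementary subsets, and complementary ones have opposite
    parities since the number of roots is odd. *)
Lemma sum_class_inj (p q : pred Y) :
  odd #|[set y | p y]%SET| = odd #|[set y | q y]%SET| ->
  \sum_(y | p y) rc y = \sum_(y | q y) rc y -> p =1 q.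
Proof.
rewrite !odd_card_big => pq /eqP.
rewrite -subr_eq0 (sum_opp rc2) (sum_addb rc2) sum_classE => /eqP/rc0.
case=> /finset.setP E y; first by have := E y; rewrite !inE; case: (p y); case: (q y).
have : odd #|[set y | p y (+) q y]%SET| = odd #|{: Y}|.
  by congr odd; apply: eq_card => z; rewrite E inE.
by rewrite odd_card_big big_split /= pq addbb Yodd.
Qed.

Lemma eval_neq0 (u : A) (y : Y) : u \is a GRing.unit -> root_eval (val y) u != 0.
Proof. by move/(root_alg_unit f_size f_split); apply; exact: valP. Qed.

Definition kummer_map (c : sqclass A) (s : autover iL) : Pic (map_poly iK f) :=
  \sum_(y : Y | kummer (root_eval (val y) (val (generic_quotient.repr c))) s) rc y.

Lemma kummer_mapE (u : A) s : u \is a GRing.unit ->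
  kummer_map (to_sqclass u) s = \sum_(y : Y | kummer (root_eval (val y) u) s) rc y.
Proof.
move=> uu; rewrite /kummer_map; have := sqclass_repr (to_sqclass u).
set u' := generic_quotient.repr _.
have uu' : val u' \is a GRing.unit by exact: valP.
move/(to_sqclass_eq uu' uu) => [w uw u'E]; apply: eq_bigl => y; apply: kummer_sqeq.
  exact: eval_neq0.
exists (root_eval (val y) w); first exact: eval_neq0.
by rewrite u'E expr2 !(root_evalM f_size f_split) ?(valP y) // -expr2.
Qed.

Lemma sqclassP (c : sqclass A) : exists2 u : A, u \is a GRing.unit & c = to_sqclass u.
Proof. by exists (val (generic_quotient.repr c)); [exact: valP|rewrite sqclass_repr]. Qed.

Lemma kummer_mapD c c' s : kummer_map (c + c') s = kummer_map c s + kummer_map c' s.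
Proof.
have [[u uu ->] [w uw ->]] := (sqclassP c, sqclassP c').
rewrite -to_sqclassM // !kummer_mapE ?unitrM ?uu // (sum_addb rc2); apply: eq_bigl => y.
by rewrite (root_evalM f_size f_split) ?(valP y) // kummerM // eval_neq0.
Qed.

Lemma norm_to_sqclass (u : A) : u \is a GRing.unit ->
  norm_sqclass (to_sqclass u) = to_sqclass (@alg_norm K A u).
Proof. by move=> uu; apply: sqclass_map_to => //; [exact: alg_normM|exact: alg_norm1]. Qed.

Lemma norm_sqclassD (c c' : sqclass A) : norm_sqclass (c + c') = norm_sqclass c + norm_sqclass c'.
Proof.
have [[u uu ->] [w uw ->]] := (sqclassP c, sqclassP c').
rewrite -to_sqclassM // !norm_to_sqclass ?unitrM ?uu // alg_normM to_sqclassM //.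
  exact: alg_norm_unit.
exact: alg_norm_unit.
Qed.

Lemma norm_eval (u : A) : (@alg_norm K A u)%:A = \prod_(y : Y) root_eval (val y) u.
Proof. by rewrite (root_alg_norm f_size rs_uniq f_split) (big_seq_sub _ predT). Qed.

Lemma norm_square (u : A) : u \is a GRing.unit -> norm_sqclass (to_sqclass u) = 0 ->
  exists2 k : K, k != 0 & \prod_(y : Y) root_eval (val y) u = k%:A ^+ 2.
Proof.
move=> uu; rewrite norm_to_sqclass // => /to_sqclass_eq0[|k uk nE]; first exact: alg_norm_unit.
exists k; first by rewrite -unitfE.
by rewrite -norm_eval nE -!/(in_alg L _) rmorphXn.
Qed.

(** The norm is the product of the values of u at the roots; being a square, it makes their
    characters add up to zero. *)
Lemma kummer_even (u : A) (s : autover iL) : u \is a GRing.unit -> norm_sqclass (to_sqclass u) = 0 ->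
  odd #|[set y : Y | kummer (root_eval (val y) u) s]%SET| = false.
Proof.
move=> uu /(norm_square uu)[k k0 kE].
rewrite -(kummer_prod s (F := fun y : Y => root_eval (val y) u)) => [|y]; last exact: eval_neq0.
by rewrite kE kummer_sqr // -[k%:A]/(in_alg L k) fmorph_eq0.
Qed.

Lemma kummer_map_inj (c : sqclass A) : norm_sqclass c = 0 -> (forall s, kummer_map c s = 0) -> c = 0.
Proof.
have [u uu ->] := sqclassP c => nu ku.
have sq (y : Y) : exists z, z ^+ 2 = root_eval (val y) u.
  apply: (kummer_trivial (iL := iL)) => s.
  have := @sum_class_inj (fun y => kummer (root_eval (val y) u) s) (fun=> false) _ _ y.
  apply; last by rewrite big_pred0_eq -(kummer_mapE s uu) ku.
  by rewrite kummer_even // odd_card_big big1.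
have [k k0 kE] := norm_square uu nu.
have Feq (y : Y) (h : gal_of {:L}) : root_eval (val (to y h)) u = h (root_eval (val y) u).
  by rewrite root_eval_gal.
have kfix : gal_fixed [set: gal_of {:L}]%G (k%:A : L) by move=> h _; exact: gal_alg.
have sqfix (y : Y) : exists z : L, z ^+ 2 = root_eval (val y) u /\
    gal_fixed (stab to [set: gal_of {:L}]%G y) z.
  have [T T_Syl] := Sylow_exists 2 (stab_group to [set: gal_of {:L}]%G y).
  have [z zfix z2] := descend_square free2 T_Syl Feq (fun y => eval_neq0 y uu) sq kfix kE.
  by exists z.
(* Roots fixed by the stabilizers can be chosen equivariantly, and are then interpolated by one
   square root w of u in K[T] / (f). *)
have [|y z h _ _ /= zE|y _|F FP] := @equivariant_choice K L _ to [set: gal_of {:L}]%G [set: Y]%SET _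
  (fun y z => z ^+ 2 = root_eval (val y) u).
- by move=> y h _ _; rewrite finset.in_setT.
- by rewrite -rmorphXn zE; exact: root_eval_gal.
- exact: sqfix.
have [|y h|w wP] := @root_alg_interpolation K L f rs f_size rs_uniq f_split F.
- exact: gal_fixedT.
- by apply: (FP y _).2; rewrite ?finset.in_setT.
have w2 : u = w ^+ 2.
  apply: (root_eval_inj f_size rs_uniq f_split) => x xr.
  rewrite expr2 (root_evalM f_size f_split) // -expr2 -[x]/(val (SeqSub xr)) wP.
  by have [->] := FP (SeqSub xr) (finset.in_setT _).
apply/(to_sqclass_eq0 uu); exists w => //; move: uu; rewrite w2 unitrX_pos //.
Qed.

(** The field generated over L by the square roots of all the values of u serves both for continuity
    and for the unramified factorization. *)
Lemma kummer_map_C2 (c : sqclass A) : ker_norm_unramified f c -> C2 iK f iL (kummer_map c).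
Proof.
have [u uu ->] := sqclassP c => -[uunr nu].
have unr (y : Y) : @unramified_over K L 1%g (root_eval (val y) u).
  have := (unramified_root_classP iL f_size f_split uu).1 uunr y.
  apply: unramified_overS; rewrite finset.sub1set; exact: (group1 (stab_group to [set: gal_of {:L}]%G y)).
have [M [iM [w [iML w2 full]]]] := sqrt_extension iL [seq root_eval x u | x <- rs].
have Munr : unramified_ext M.
  by apply: (unramified_ext_sqrt iM _ w2 full) => _ /mapP[x xr ->]; exact: (unr (SeqSub xr)).
have triv (s : autover iL) : (forall y, s (iM y) = iM y) -> kummer_map (to_sqclass u) s = 0.
  move=> sM; rewrite kummer_mapE // big_pred0 // => y.
  have /mapP[z zw zE] : (root_eval (val y) u)%:A \in [seq v ^+ 2 | v <- w].
    by rewrite w2; apply: (map_f (in_alg M)); apply: (map_f (fun x => root_eval x u)); exact: (valP y).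
  by rewrite (kummer_sqrt s (z := iM z)) ?sM ?eqxx // -iML zE rmorphXn.
split.
- split=> [s|s t v vst].
    apply/(J2_root_classes rs_uniq eJ); exists [set y | kummer (root_eval (val y) u) s]%SET.
    by rewrite kummer_mapE // sum_classE.
  rewrite !kummer_mapE // (sum_addb rc2); apply: eq_bigl => y.
  by rewrite (kummer_comp _ vst) // eval_neq0.
- move=> t s s' st; have [g gP] := gal_restrict iLK t.
  rewrite !kummer_mapE // sum_classE [RHS](congr1 (Pic_act t) (sum_classE _)).
  rewrite (Pic_act_root_classes f_size f_split eact gP); apply: eq_bigl => y; rewrite !inE.
  rewrite -(kummer_conj (eval_neq0 _ uu) gP st) root_eval_gal /=.
  by rewrite -galM_all mulVg gal1_all.
- by exists M, iM; split.
by exists M, iM; split=> //; exact: galois_char0.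
Qed.

Lemma kummer_map_onto (phi : autover iL -> Pic (map_poly iK f)) : C2 iK f iL phi ->
  exists2 c, ker_norm_unramified f c & kummer_map c = phi.
Proof.
case=> -[phiJ phiD] phi_eq _ [M [iM [iML _ Munr phiM]]].
(* The complement represents the same class and has the other parity, since |Y| is odd. *)
have phiS s : exists S : {set Y}, odd #|S| = false /\ phi s = \sum_(y in S) rc y.
  have /(J2_root_classes rs_uniq eJ)[S SE] := phiJ s.
  case oS: (odd #|S|); last by exists S.
  exists (~: S); split.
    by have := cardsC S; move/(congr1 odd); rewrite oddD oS Yodd; case: odd.
  have full : \sum_(y in [set: Y]%SET) rc y = 0 by apply/rc0; right.
  rewrite SE -[RHS](sum_opp rc2); apply/eqP; rewrite -addr_eq0 (sum_addb rc2).
  by apply/eqP; apply: etrans full; apply: eq_bigl => y; rewrite !inE; case: (y \in S).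
have [S SP] := choice phiS; pose ph (y : Y) s := y \in S s.
have Seven s : odd #|[set y | ph y s]%SET| = false.
  by have [<- _] := SP s; congr odd; apply: eq_card => y; rewrite inE.
have phE s : phi s = \sum_(y | ph y s) rc y by have [_ ->] := SP s.
(* Even subsets are stable under symmetric difference and unique in their class, so each coordinate
   of phi is itself a character. *)
have phM y (s t v : autover iL) : v =1 s \o t -> ph y v = ph y s (+) ph y t.
  move=> vst; apply: (sum_class_inj (p := fun y => ph y v) (q := fun y => ph y s (+) ph y t)).
    by rewrite Seven odd_card_big big_split -!odd_card_big !Seven.
  by rewrite -phE (phiD _ _ _ vst) !phE (sum_addb rc2).
have ph_triv y (s : autover iL) : (forall z, s (iM z) = iM z) -> ph y s = false.
  move=> sM; apply: (sum_class_inj (p := fun y => ph y s) (q := fun=> false)).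
    by rewrite Seven odd_card_big big1.
  by rewrite -phE phiM // big_pred0_eq.
have ph_conj (t : autover iK) (g : gal_of {:L}) (s s' : autover iL) y : (forall x, t (iL x) = iL (g x)) ->
    s' \o t =1 t \o s -> ph (to y g) s' = ph y s.
  move=> tg st; rewrite -{2}(actK to g y).
  apply: (sum_class_inj (p := fun y => ph y s') (q := fun y => ph (to y g^-1%g) s)).
    rewrite Seven -(Seven s) !odd_card_big [RHS](reindex_inj (act_inj to g)) /=.
    by apply: eq_bigr => z _; congr (ph _ s); apply/esym; exact: (actK to g z).
  rewrite -phE (phi_eq t s s' st) phE (sum_classE (fun y => ph y s)).
  rewrite (Pic_act_root_classes f_size f_split eact tg).
  by apply: eq_bigl => z; rewrite inE.
have [b bP] := choice (fun y => unramified_kummer iML Munr (phM y) (ph_triv y)).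
have b0 y : b y != 0 by have [] := bP y.
have bk y s : kummer (b y) s = ph y s by have [_ ->] := bP y.
have b_eq y (h : gal_of {:L}) : sqeq (b (to y h)) (h (b y)).
  have [t th] := gal_lift iLK h.
  apply: (kummer_eq (iL := iL)) => [||s']; rewrite ?fmorph_eq0 //.
  have [s sE] := autover_conj iLK (autover_inv t) s'.
  have st : s' \o t =1 t \o s.
    by move=> z; have := sE (t z); rewrite /= autK => ->; rewrite aut_invK.
  by rewrite bk (ph_conj _ _ _ _ _ th st) (kummer_conj (b0 y) th st) bk.
have prod1 : sqeq (\prod_y b y) 1.
  apply: (kummer_eq (iL := iL)) => [||s]; rewrite ?oner_neq0 //.
    by apply/prodf_neq0 => y _.
  rewrite kummer_prod // -[in RHS](expr1n _ 2) kummer_sqr ?oner_neq0 // -(Seven s).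
  by congr odd; apply: eq_card => y; rewrite !inE bk.
have b_unr y : @unramified_over K L 1%g (b y) by have [] := bP y.
have [F [Feq FP [k kfix kE]]] := descend_classes iL Yodd free2 b0 b_eq b_unr prod1.
have [|y h|u uP] := @root_alg_interpolation K L f rs f_size rs_uniq f_split F.
- exact: gal_fixedT.
- exact: Feq.
have F0 y : F y != 0 by have [_ [d d0 ->]] := FP y; rewrite (mulf_neq0 (b0 y)) ?expf_neq0.
have uu : u \is a GRing.unit.
  by apply/(root_alg_unit f_size f_split) => x xr; rewrite -[x]/(val (SeqSub xr)) uP.
exists (to_sqclass u).
  split.
    by apply/(unramified_root_classP iL f_size f_split uu) => y; rewrite uP; have [] := FP y.
  have /(gal_fixedT iL)[k' k'E] := kfix.
  have nE : @alg_norm K A u = k' ^+ 2.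
    apply: (fmorph_inj (in_alg L)); rewrite rmorphXn /= norm_eval -k'E -kE.
    by apply: eq_bigr => y _; rewrite uP.
  have un := alg_norm_unit uu; rewrite norm_to_sqclass //.
  apply/to_sqclass_eq0 => //; exists k' => //.
  by move: un; rewrite nE unitrX_pos.
apply/funext => s; rewrite kummer_mapE // phE; apply: eq_bigl => y.
by rewrite uP -bk; apply: kummer_sqeq => //; have [_] := FP y.
Qed.

Lemma kummer_map_uniq c c' : norm_sqclass c = 0 -> norm_sqclass c' = 0 ->
  kummer_map c = kummer_map c' -> c = c'.
Proof.
move=> nc nc' cc; apply/eqP; rewrite -subr_eq0; apply/eqP.
have sub (a : sqclass A) : a - c' + c' = a by rewrite subrK.
apply: kummer_map_inj.
  by apply: (addIr (norm_sqclass c')); rewrite -norm_sqclassD sub nc nc' add0r.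
by move=> s; apply: (addIr (kummer_map c' s)); rewrite -kummer_mapD sub cc add0r.
Qed.

Lemma kummer_isomorphism : isomorphic_subgroups (C2 iK f iL) (ker_norm_unramified f).
Proof.
(* The Kummer map goes from classes to homomorphisms; [theta] inverts it on the classes of square
   norm and is arbitrary elsewhere. *)
have ex phi : exists c, (exists2 c', norm_sqclass c' = 0 & kummer_map c' = phi) ->
    norm_sqclass c = 0 /\ kummer_map c = phi.
  have [[c nc ck]|no] := pselect (exists2 c', norm_sqclass c' = 0 & kummer_map c' = phi).
    by exists c.
  by exists 0.
have [theta thetaP] := choice ex.
have thetaK c : norm_sqclass c = 0 -> theta (kummer_map c) = c.
  move=> nc; have [|n k] := thetaP (kummer_map c); first by exists c.
  exact: kummer_map_uniq.
have onto phi : C2 iK f iL phi -> exists2 c, ker_norm_unramified f c & kummer_map c = phi /\ theta phi = c.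
  by move=> /kummer_map_onto[c ck <-]; exists c => //; split=> //; apply: thetaK; case: ck.
exists theta; split; first split.
- by move=> phi /onto[c ck [_ ->]].
- move=> phi psi /set_mem/onto[c _ [<- ->]] /set_mem/onto[c' _ [<- ->]] ->.
  by [].
- move=> c ck; exists (kummer_map c); first exact: kummer_map_C2.
  by apply: thetaK; case: ck.
move=> _ _ /onto[c [_ nc] [<- ->]] /onto[c' [_ nc'] [<- ->]].
have -> : kummer_map c + kummer_map c' = kummer_map (c + c').
  by apply/funext => s; rewrite kummer_mapD.
by apply: thetaK; rewrite norm_sqclassD nc nc' addr0.
Qed.

End KummerMap.

Local Open Scope classical_set_scope.

Theorem theorem5p3 (K : fieldExtType rat) (f : {poly K}) (d : nat)
  (f_sep : separable_poly f) (f_deg : size f = d.+1)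
  (d_odd : odd d) (d_ge3 : (3 <= d)%N)
  (iK : {rmorphism K -> algC})
  (L : splittingFieldType K) (iL : {rmorphism L -> algC})
  (iLK : forall x : K, iL x%:A = iK x)
  (L_def : range iL = J2_field iK f)
  (G2 : {group gal_of {:L}}) (G2_Syl : (2.-Sylow('Gal({:L} / 1)) G2)%g)
  (H1_G2 : H1_trivial G2 (J2 iK f) (gal_act iK f iL)) :
  isomorphic_subgroups (C2 iK f iL) (ker_norm_unramified f).
Proof.
have [rs [e [rs_uniq rs_size f_split [eJ e2 e0 eact]]]] :=
  two_torsion_roots f_sep f_deg d_odd d_ge3 iLK L_def.
have f_size : (1 < size f)%N by rewrite f_deg; case: d d_ge3 {f_deg d_odd rs_size}.
have rs_odd : odd (size rs) by rewrite rs_size.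
have free2 := roots_free (f_size := f_size) (f_split := f_split) rs_uniq rs_odd eJ e2 e0 eact iLK G2_Syl H1_G2.
exact: (kummer_isomorphism iLK rs_uniq rs_odd eJ e2 e0 eact free2).
Qed.
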